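(* Let $s>1$, $C>0$, and let $A$ be a bounded subset of an $(s,C)$-Ahlfors regular set in $\mathbb{R}^2$. If $\underline{\dim}_B(A)=s$, then $\underline{\dim}_B(\mathrm{dist}(A,A))=1$. Likewise, if $\overline{\dim}_B(A)=s$, then $\overline{\dim}_B(\mathrm{dist}(A,A))=1$.
   Context: A set $E\subset\mathbb{R}^d$ is $(s,C)$-Ahlfors regular if there exists a Borel measure $\mu$ supported on $E$ (i.e. $\mu(\mathbb{R}^d\setminus E)=0$) such that $C^{-1}r^s\le\mu(B(x,r))\le Cr^s$ for all $x\in E$ and all $r\in(0,1]$. The distance set is $\mathrm{dist}(A,A)=\{|x-y|:x,y\in A\}$. For bounded $F\subset\mathbb{R}^d$, $\mathcal{N}(F,\delta)$ is the number of $\delta$-grid cubes that intersect $F$; the lower and upper box-counting dimensions are $\underline{\dim}_B(F)=\liminf_{\delta\downarrow0}\frac{\log\mathcal{N}(F,\delta)}{-\log\delta}$ and $\overline{\dim}_B(F)=\limsup_{\delta\downarrow0}\frac{\log\mathcal{N}(F,\delta)}{-\log\delta}$. *)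

(* Defs.v *)
From HB Require Import structures.
From mathcomp Require Import all_boot all_order all_algebra finmap.
From mathcomp Require Import all_classical all_reals all_analysis.
Set Implicit Arguments.
Unset Strict Implicit.
Unset Printing Implicit Defensive.
Import Order.TTheory GRing.Theory Num.Theory.
Import numFieldNormedType.Exports.
Local Open Scope classical_set_scope.
Local Open Scope ring_scope.

(* The library norm on 'rV[R]_d is the sup norm, hence the explicit Euclidean
   distance. *)
Definition edist (R : realType) (d : nat) (x y : 'rV[R]_d) : R :=
  Num.sqrt (\sum_(i < d) (x ord0 i - y ord0 i) ^+ 2).

Definition eball (R : realType) (d : nat) (x : 'rV[R]_d) (r : R) :
    set 'rV[R]_d :=
  [set y | edist x y <= r].

(* R^d with its Borel sigma-algebra. *)
Definition borelRd (R : realType) (d : nat) :=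
  g_sigma_algebraType (@open 'rV[R]_d).

(* [E] is not assumed to be Borel; [mu (R^d \ E) = 0] is expressed by
   negligibility, which is that equation when [E] is Borel. *)
Definition ahlfors_regular (R : realType) (d : nat) (s C : R)
    (E : set 'rV[R]_d) : Prop :=
  exists mu : {measure set (borelRd R d) -> \bar R},
    mu.-negligible (~` E) /\
    forall x r, E x -> 0 < r <= 1 ->
      ((C^-1 * r `^ s)%:E <= mu (eball x r) <= (C * r `^ s)%:E)%E.

Definition distance_set (R : realType) (d : nat) (A : set 'rV[R]_d) : set R :=
  [set t | exists x y, [/\ A x, A y & t = edist x y]].

(* Subsets of R seen as subsets of R^1. *)
Definition line_set (R : realType) (F : set R) : set 'rV[R]_1 :=
  [set const_mx t | t in F].

(* The cube of the grid (delta Z)^d with lower corner delta k. *)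
Definition grid_cube (R : realType) (d : nat) (delta : R) (k : 'rV[int]_d) :
    set 'rV[R]_d :=
  [set x | forall i : 'I_d,
     (k ord0 i)%:~R * delta <= x ord0 i < ((k ord0 i)%:~R + 1) * delta].

(* For bounded F and delta > 0 the set of indices is finite; [fset_set] is
   empty on infinite sets. *)
Definition grid_number (R : realType) (d : nat) (F : set 'rV[R]_d)
    (delta : R) : nat :=
  #|` fset_set [set k : 'rV[int]_d | F `&` grid_cube delta k !=set0] |%fset.

(* Since [ln 0 = 0], the empty set gets box dimension 0. *)
Definition box_ratio (R : realType) (d : nat) (F : set 'rV[R]_d)
    (delta : R) : \bar R :=
  (ln (grid_number F delta)%:R / - ln delta)%:E.

Definition lower_box_dim (R : realType) (d : nat) (F : set 'rV[R]_d) : \bar R :=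
  limf_einf (box_ratio F) 0^'+.

Definition upper_box_dim (R : realType) (d : nat) (F : set 'rV[R]_d) : \bar R :=
  limf_esup (box_ratio F) 0^'+.

(* Main.v *)
(* The cells of side [delta] met by [A], inside one square of size about 1, are the
   leaves of an M-adic tree, and Ahlfors regularity bounds by [K m^s] the number of
   nodes of any height that lie within [m] cells of a point. Fix a pin [x0] and count
   the values of [floor (dist x0 z / delta)] for the leaves [z] under a node. Two
   children of a node share a value at their own scale only if their difference is
   almost orthogonal to the direction of [x0], and Cauchy-Schwarz turns a bound on
   the number of these collisions into a lower bound on the growth of the number of
   values from one height to the next.

   As [s > 1], the energy estimate shows that, for all but a proportion
   [M^-eta] of the slopes, a node has at most about [M^(2s-1+eta)] colliding pairs, so
   that the number of values grows by about [M^(1-eta)]. A radial projection estimate,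
   which compares second moments of the mass of thin strips at two scales, shows
   that a typical pin sees a typical leaf along a slope that is exceptional at few
   heights only. It is applied to the pins under a node close to the root, none of
   whose children carries more than its share of the leaves; such a node exists
   because [A] has almost as many cells as the dimension permits.

   This gives [delta^-(1 - 7 eta)] distances at every small scale [delta] at which [A]
   has at least [delta^-(s - eps)] cells, and both assertions follow, since there are
   never more than about [1 / delta] distances. *)
Require Import Defs.
From HB Require Import structures.
From mathcomp Require Import all_boot all_order all_algebra finmap.
From mathcomp Require Import all_classical all_reals all_analysis.
From mathcomp Require Import zify ring lra.
Import Order.TTheory GRing.Theory Num.Theory.
Import numFieldNormedType.Exports.
Set Implicit Arguments.
Unset Strict Implicit.
Unset Printing Implicit Defensive.

Local Open Scope ring_scope.

(** The pin and the leaf lie under children of one node [u0], whose displacement is an integer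
    vector with coordinates below [M]. It fixes the direction up to about [1 / M], which is the
    precision needed at each lower height, where the children of a node also fill an [M] by [M]
    square. So one vector serves for all heights below [h0], and one radial estimate, applied to
    averages over the heights, treats them together. An exceptional height costs a factor of about
    [M^(2s)] in the squared count, but a small proportion [gam] of such heights, of order [eta / s],
    is harmless. Hence the projection estimate needs no rate. Strips of width 2 are compared with
    strips of width [M / r0]: a wide strip has mass at most 1, so few slopes means little mass, and
    the second moment of the difference is small because the two kernels cancel for most pairs. [M]
    is fixed first, large in terms of [eta], so that a constant lost at each height is at most
    [M^eta]; only then does the number [n] of heights grow. *)

Lemma sum_mul_sqr_le (R : realDomainType) (I : finType) (a b : I -> R) :
  (\sum_i a i * b i) ^+ 2 <= (\sum_i a i ^+ 2) * (\sum_i b i ^+ 2).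
Proof.
suff : 0 <= ((\sum_i a i ^+ 2) * (\sum_i b i ^+ 2)
            - (\sum_i a i * b i) ^+ 2) *+ 2 by rewrite pmulrn_lge0// subr_ge0.
have -> : ((\sum_i a i ^+ 2) * (\sum_i b i ^+ 2)
          - (\sum_i a i * b i) ^+ 2) *+ 2
   = \sum_i \sum_j (a i * b j - a j * b i) ^+ 2.
  have E1 : \sum_i \sum_j a i ^+ 2 * b j ^+ 2
      = (\sum_i a i ^+ 2) * (\sum_i b i ^+ 2).
    by rewrite mulr_suml; apply: eq_bigr => i _; rewrite mulr_sumr.
  have E2 : \sum_i \sum_j a j ^+ 2 * b i ^+ 2
      = (\sum_i a i ^+ 2) * (\sum_i b i ^+ 2).
    by rewrite exchange_big E1.
  have E3 : \sum_i \sum_j (a i * b i) * (a j * b j)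
      = (\sum_i a i * b i) ^+ 2.
    by rewrite expr2 mulr_suml; apply: eq_bigr => i _; rewrite mulr_sumr.
  rewrite mulrnBl mulr2n -{1}E1 -E2 -E3 -big_split -sumrMnl -sumrB /=.
  apply: eq_bigr => i _; rewrite -big_split -sumrMnl -sumrB /=.
  by apply: eq_bigr => j _; ring.
by do 2![apply: sumr_ge0 => ? _]; exact: sqr_ge0.
Qed.

Definition dinf (a b : int * int) : nat :=
  maxn `|a.1 - b.1|%N `|a.2 - b.2|%N.

(** * Energy sums and exact slope counts *)

Section energy.
Context {R : realType}.
Implicit Types (s K : R).

Lemma powRn_le s (m n : nat) : 0 <= s -> (m <= n)%N -> m%:R `^ s <= n%:R `^ s :> R.
Proof. by move=> s0 mn; apply: ge0_ler_powR; rewrite ?nnegrE ?ler0n// ler_nat. Qed.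

Lemma powR_expn (a : R) s (m : nat) : 0 <= a -> (a ^+ m) `^ s = (a `^ s) ^+ m.
Proof.
by move=> a0; rewrite -powR_mulrn// -powRrM mulrC powRrM powR_mulrn// powR_ge0.
Qed.

(* Dyadic decomposition of the distance [d]; the sum is geometric since [s > 1]. *)
Lemma energy_bound s : 1 < s -> exists2 C : R, 0 < C &
  forall (I : finType) (w : I -> R) (d : I -> nat) K,
  (forall i, 0 <= w i) ->
  (forall m, (0 < m)%N -> \sum_(i | (d i <= m)%N) w i <= K * m%:R `^ s) ->
  forall m, (0 < m)%N ->
  \sum_(i | (d i <= m)%N) w i / (maxn 1 (d i))%:R <= C * K * m%:R `^ (s - 1).
Proof.
move=> s1; set g := 2 `^ (s - 1) : R.
have g1 : 1 < g.
  have <- : 1 `^ (s - 1) = 1 :> R by rewrite powR1.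
  by apply: gt0_ltr_powR; rewrite ?subr_gt0 ?nnegrE ?ler01 ?ler0n ?ltr1n.
have g0 : 0 < g by lra.
pose C := 1 + 2 * g / (g - 1).
have C1 : 1 <= C by rewrite lerDl divr_ge0; lra.
exists (C * g); first by rewrite mulr_gt0//; lra.
move=> I w d K w0 wK.
have K0 : 0 <= K.
  by have := wK 1%N isT; rewrite powR1 mulr1; apply: le_trans; apply: sumr_ge0.
have dy k : \sum_(i | (d i <= 2 ^ k)%N) w i / (maxn 1 (d i))%:R <= C * K * g ^+ k.
  elim: k => [|k IH].
    rewrite expr0 mulr1; apply: (@le_trans _ _ K); last by rewrite ler_peMl.
    have := wK 1%N isT; rewrite powR1 mulr1; apply: le_trans.
    apply: ler_sum => i; rewrite expn0 => di.
    by rewrite (_ : maxn 1 (d i) = 1%N) ?divr1//; lia.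
  have -> : \sum_(i | (d i <= 2 ^ k.+1)%N) w i / (maxn 1 (d i))%:R =
     \sum_(i | (d i <= 2 ^ k)%N) w i / (maxn 1 (d i))%:R +
     \sum_(i | (2 ^ k < d i <= 2 ^ k.+1)%N) w i / (maxn 1 (d i))%:R.
    rewrite (bigID (fun i => (d i <= 2 ^ k)%N)) /=; congr (_ + _);
      by apply: eq_bigl => i; rewrite expnS; lia.
  have st : \sum_(i | (2 ^ k < d i <= 2 ^ k.+1)%N) w i / (maxn 1 (d i))%:R
            <= 2 * g * K * g ^+ k.
    have p0 : (0 : R) < (2 ^ k)%:R by rewrite ltr0n expn_gt0.
    apply: (@le_trans _ _ ((\sum_(i | (d i <= 2 ^ k.+1)%N) w i) / (2 ^ k)%:R)).
      rewrite mulr_suml [leRHS](bigID (fun i => (2 ^ k < d i)%N)) /=.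
      rewrite -[leLHS]addr0; apply: lerD; last first.
        by apply: sumr_ge0 => i _; rewrite divr_ge0// ltW.
      rewrite [leRHS](eq_bigl (fun i => (2 ^ k < d i <= 2 ^ k.+1)%N)); last first.
        by move=> i; rewrite andbC.
      apply: ler_sum => i /andP[di _]; rewrite ler_wpM2l// lef_pV2 ?posrE ?ler_nat ?ltr0n//; lia.
    rewrite ler_pdivrMr//; apply: le_trans (wK _ _) _; first by rewrite expn_gt0.
    rewrite -mulr_powRB1 ?ler0n//; last lra.
    rewrite !natrX powR_expn// -/g !exprS.
    by rewrite le_eqVlt; apply/orP; left; apply/eqP; ring.
  apply: le_trans (lerD IH st) _; rewrite exprS.
  have -> : C * K * g ^+ k + 2 * g * K * g ^+ k = (C + 2 * g) * (K * g ^+ k) by ring.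
  have -> : C * K * (g * g ^+ k) = (C * g) * (K * g ^+ k) by ring.
  apply: ler_wpM2r; first by rewrite mulr_ge0// exprn_ge0// ltW.
  rewrite -subr_ge0; have -> : C * g - (C + 2 * g) = C * (g - 1) - 2 * g by ring.
  by rewrite /C mulrDl divfK ?gt_eqF ?subr_gt0//; lra.
move=> m m0; have /andP[km mk] := trunc_log_bounds (isT : (1 < 2)%N) m0.
set k := trunc_log 2 m in km mk.
have : \sum_(i | (d i <= m)%N) w i / (maxn 1 (d i))%:R <= C * K * g ^+ k.+1.
  apply: le_trans (dy k.+1); rewrite [leRHS](bigID (fun i => (d i <= m)%N)) /=.
  rewrite -[leLHS]addr0; apply: lerD; last first.
    by apply: sumr_ge0 => i _; rewrite divr_ge0.
  by rewrite [leRHS](eq_bigl (fun i => (d i <= m)%N))// => i; lia.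
move/le_trans; apply; rewrite exprS.
have : g ^+ k <= m%:R `^ (s - 1).
  rewrite /g -powR_expn// -natrX; apply: powRn_le => //; lra.
have : 0 <= C * K * g by rewrite !mulr_ge0//; lra.
by move=> h1 h2; have := ler_wpM2l h1 h2; nra.
Qed.
End energy.

Section counting.
Context {R : realType}.

Lemma sum_indicator (I : finType) (P : pred I) :
  \sum_i (P i)%:R = #|[pred i | P i]|%:R :> R.
Proof.
rewrite -sum1_card natr_sum [RHS]big_mkcond; apply: eq_bigr => i _.
by rewrite inE; case: (P i).
Qed.

Lemma sum_delta N (z : int) (f : int -> R) :
  \sum_(i < N) (i%:Z == z)%:R * f i%:Z = (0 <= z < N%:Z)%R%:R * f z.
Proof.
case: (boolP (0 <= z < N%:Z)) => [zN|zN].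
  have zN' : (`|z| < N)%N by lia.
  rewrite (bigD1 (Ordinal zN'))//= big1 ?addr0; last first.
    move=> i; rewrite -val_eqE /= => iz.
    by rewrite (_ : (i%:Z == z) = false) ?mul0r//; lia.
  by rewrite (_ : `|z|%N%:Z = z) ?eqxx//; lia.
rewrite mul0r big1// => i _; have := ltn_ord i => iN.
by rewrite (_ : (i%:Z == z) = false) ?mul0r//; lia.
Qed.

Lemma card_int_interval N (lo : int) (e : nat) :
  (#|[pred j : 'I_N | (lo <= j%:Z < lo + e%:Z)%R]| <= e)%N /\
  (0 <= lo -> lo + e%:Z <= N%:Z ->
   #|[pred j : 'I_N | (lo <= j%:Z < lo + e%:Z)%R]| = e).
Proof.
set A := [pred j : 'I_N | _].
have le : (#|A| <= e)%N.
  rewrite cardE -(size_map (fun j : 'I_N => `|j%:Z - lo|%N)) -[leqRHS](size_iota 0 e).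
  apply: uniq_leq_size.
    rewrite map_inj_in_uniq ?enum_uniq// => i j; rewrite !mem_enum !inE => iA jA ij.
    by apply: val_inj => /=; lia.
  by move=> k /mapP[j]; rewrite mem_enum !inE => jA ->; rewrite mem_iota; lia.
split=> // lo0 loN; apply/eqP; rewrite eqn_leq le /=.
rewrite cardE -(size_map val) -[leqLHS](size_iota 0 e).
rewrite -(size_map (fun i => `|(lo + i%:Z)%R|%N)).
apply: uniq_leq_size.
  by rewrite map_inj_uniq ?iota_uniq// => i j; lia.
move=> k /mapP[i]; rewrite mem_iota => ie ->.
have iN : (`|(lo + i%:Z)%R|%N < N)%N by lia.
by apply/mapP; exists (Ordinal iN) => //; rewrite mem_enum inE /=; lia.
Qed.

(** A half-open window whose length is a multiple of the step [|v|] contains the same number of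
    terms of the progression wherever it starts. The independence of [b] is what later makes two
    kernels agree exactly and not just up to rounding. *)
Lemma affine_interval (v b : int) (e : nat) : v != 0 ->
  exists i0 : int, forall i : int,
    (0 <= v * i + b < (`|v| * e)%N%:Z) = (i0 <= i < i0 + e%:Z).
Proof.
move=> v0; pose w := `|v|%N%:Z; have w0 : 0 < w by rewrite /w; lia.
have be : b = (b %/ w)%Z * w + (b %% w)%Z by exact: divz_eq.
have r0 : 0 <= (b %% w)%Z by rewrite modz_ge0; lia.
have r1 : (b %% w)%Z < w by rewrite ltz_pmod.
rewrite PoszM -/w; move: be r0 r1; set k := (b %/ w)%Z; set r := (b %% w)%Z => be r0 r1.
have key (i : int) : (0 <= w * i + b < w * e%:Z) = (- k <= i < - k + e%:Z).
  apply/idP/idP; rewrite be => /andP[h1 h2]; apply/andP; split; nia.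
have [vp|vn] : v = w \/ v = - w by rewrite /w; lia.
  by exists (- k) => i; rewrite vp key.
exists (k - e%:Z + 1) => i; rewrite vn mulNr -mulrN key; lia.
Qed.

Section slopes.
Variables (J : nat).

(* The slopes are the integers [-J, J], indexed by ['I_J.*2.+1]. *)
Definition slope (j : 'I_J.*2.+1) : int := j%:Z - J%:Z.

Lemma slope_bound j : `|slope j| <= J%:Z.
Proof. rewrite /slope; have := ltn_ord j; lia. Qed.

Lemma slope_count_le (v b : int) (e : nat) : v != 0 ->
  \sum_j (0 <= v * slope j + b < (`|v| * e)%N%:Z)%R%:R <= e%:R :> R.
Proof.
move=> v0; have [i0 h] := @affine_interval v b e v0.
rewrite (eq_bigr (fun j : 'I__ => (i0 + J%:Z <= j%:Z < i0 + J%:Z + e%:Z)%R%:R)); last first.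
  by move=> j _; rewrite h /slope; congr (_%:R); lia.
by rewrite sum_indicator ler_nat; exact: (card_int_interval _ _ _).1.
Qed.

Lemma slope_count_eq (v b : int) (e : nat) : v != 0 -> (0 < e)%N ->
  (forall i, 0 <= v * i + b < (`|v| * e)%N%:Z -> `|i| <= J%:Z) ->
  \sum_j (0 <= v * slope j + b < (`|v| * e)%N%:Z)%R%:R = e%:R :> R.
Proof.
move=> v0 e0 hJ; have [i0 h] := @affine_interval v b e v0.
rewrite (eq_bigr (fun j : 'I__ => (i0 + J%:Z <= j%:Z < i0 + J%:Z + e%:Z)%R%:R)); last first.
  by move=> j _; rewrite h /slope; congr (_%:R); lia.
rewrite sum_indicator; congr (_%:R); apply: (card_int_interval _ _ _).2.
  by have := hJ i0; rewrite h; lia.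
by have := hJ (i0 + e%:Z - 1); rewrite h; lia.
Qed.

End slopes.
End counting.

Section frostman.
Context {R : realType}.

(** The condition [mu (B(c, m)) <= K m^s] at integer radii. It occurs in two normalizations: [K]
    constant for counting weights, and [K / M^s] for probability weights on an [M] by [M] square. *)
Definition frostman (I : finType) (pos : I -> int * int) (w : I -> R) (s K : R) :=
  forall c m, (0 < m)%N -> \sum_(i | (dinf (pos i) c <= m)%N) w i <= K * m%:R `^ s.

Lemma frostman_swap (I : finType) pos w s K : @frostman I pos w s K ->
  frostman (fun i => ((pos i).2, (pos i).1)) w s K.
Proof.
move=> h c m m0; apply: le_trans (h (c.2, c.1) m m0).
by rewrite (eq_bigl (fun i => (dinf (pos i) (c.2, c.1) <= m)%N))// => i; rewrite /dinf /= maxnC.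
Qed.

(** Cut along the second coordinate into at most [3 M / m] pieces of length [m], the strip of slope
    [a] is covered by as many balls of radius [(|a| + 1) m]. *)
Lemma frostman_strip (I : finType) pos w s K : 1 < s -> @frostman I pos w s K ->
  (forall i, 0 <= w i) -> forall (M m : nat) (c : int * int) (a : int),
  (0 < m <= M)%N -> (forall i, `|(pos i).2 - c.2| <= M%:Z) ->
  \sum_(i | `|(pos i).1 - c.1 + a * ((pos i).2 - c.2)| <= m%:Z) w i <=
  3 * M%:R * K * (`|a|%N.+1)%:R `^ s * m%:R `^ (s - 1).
Proof.
move=> s1 fw w0 M m c a /andP[m0 mM] posM.
pose N := ((2 * M) %/ m).+1.
pose idx i := (`|((pos i).2 - c.2 + M%:Z)%R|%N %/ m)%N.
have idxN i : (idx i < N)%N.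
  rewrite /idx /N ltnS; apply: leq_div2r; have := posM i; lia.
have p1 : forall i, true -> Ordinal (idxN i) \in 'I_N by [].
rewrite (partition_big (fun i => Ordinal (idxN i)) predT)//=.
apply: (@le_trans _ _ (\sum_(k < N) K * ((`|a|%N.+1) * m)%N%:R `^ s)).
  apply: ler_sum => k _.
  apply: le_trans (fw (c.1 - a * ((k * m)%N%:Z - M%:Z), c.2 + (k * m)%N%:Z - M%:Z) _ _); last by rewrite muln_gt0.
  rewrite big_mkcond [leRHS]big_mkcond; apply: ler_sum => i _.
  case: ifP => [/andP[/= h1 /eqP/(congr1 val)/= h2]|_]; last by case: ifP.
  rewrite ifT//; move: h2; rewrite /idx => h2.
  have := divn_eq `|((pos i).2 - c.2 + M%:Z)%R| m; rewrite h2.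
  have := ltn_pmod `|((pos i).2 - c.2 + M%:Z)%R| m0.
  set r := (_ %% m)%N => rm he.
  have h3 : (pos i).2 - c.2 = (k * m)%N%:Z - M%:Z + r%:Z by have := posM i; lia.
  rewrite /dinf /=; have -> : (pos i).2 - (c.2 + (k * m)%N%:Z - M%:Z) = r%:Z by lia.
  have -> : (pos i).1 - (c.1 - a * ((k * m)%N%:Z - M%:Z))
    = (pos i).1 - c.1 + a * ((pos i).2 - c.2) - a * r%:Z by rewrite h3; ring.
  have ar : (`|(a * r%:Z)%R| <= `|a| * m)%N by rewrite abszM leq_mul//; lia.
  by rewrite mulSn; lia.
have K0 : 0 <= K.
  by have := fw c 1%N isT; rewrite powR1 mulr1; apply: le_trans; apply: sumr_ge0.
rewrite sumr_const card_ord natrM powRM ?ler0n// -[leLHS]mulr_natl.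
have -> : m%:R `^ s = m%:R * m%:R `^ (s - 1) :> R.
  by rewrite mulr_powRB1 ?ler0n//; lra.
have Nm : N%:R * m%:R <= 3 * M%:R :> R.
  rewrite -!natrM ler_nat /N mulSn.
  have := leq_trunc_div (2 * M) m; lia.
have X0 : 0 <= K * (`|a|%N.+1)%:R `^ s * m%:R `^ (s - 1).
  by rewrite !mulr_ge0// powR_ge0.
by have := ler_wpM2r X0 Nm; congr (_ <= _); ring.
Qed.

End frostman.

(** * Radial projections of discrete Frostman sets *)

Section kernel.
Context {R : realType}.
Variables (L M : nat).
Hypotheses (L0 : (0 < L)%N) (M0 : (0 < M)%N).
Let q := M`!.
Let J := (2 * L * q)%N.
Let T0 := ((2 * L + 2) * q * M)%N.

(* [q = M!] is a multiple of every difference of coordinates below [M], so that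
   slopes [j / q] make all the lattice-point counts below exact. *)
Definition proj (j : 'I_J.*2.+1) (x : int * int) : int :=
  q%:Z * x.1 + slope j * x.2.

(** The pair [o] of a slope and an offset is a line; the window is a strip on one side of it, of
    width [a / q] along the first axis. *)
Definition window (a : nat) (x : int * int) (o : 'I_J.*2.+1 * 'I_T0.*2.+1) : bool :=
  0 <= proj o.1 x - slope o.2 < a%:Z.

Definition window_kernel (a b : nat) (x y : int * int) : R :=
  \sum_o (window a x o && window b y o)%:R.

Let q0 : (0 < q)%N. Proof. exact: fact_gt0. Qed.

Lemma proj_bound j x : 0 <= x.1 <= M%:Z -> 0 <= x.2 <= M%:Z ->
  `|proj j x| <= ((2 * L + 1) * q * M)%N%:Z.
Proof.
move=> x1 x2; rewrite /proj; apply: le_trans (ler_normD _ _) _.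
have h1 : `|q%:Z * x.1| <= q%:Z * M%:Z by rewrite normrM ler_pM//; lia.
have h2 : `|slope j * x.2| <= J%:Z * M%:Z.
  by rewrite normrM ler_pM//; [exact: slope_bound|lia].
by apply: le_trans (lerD h1 h2) _; rewrite /J !PoszM !PoszD; nia.
Qed.

(** For a fixed slope the offset is replaced by [k], the position of [y] in its window. [T0] leaves
    a margin of [q * M] beyond all projections, so that no offset is lost when [b <= q * M]. *)
Lemma window_sum a b x y j : 0 <= y.1 <= M%:Z -> 0 <= y.2 <= M%:Z ->
  (b <= q * M)%N ->
  \sum_t (window a x (j, t) && window b y (j, t))%:R = \sum_(k < b)
    (0 <= (x.2 - y.2) * slope j + (q%:Z * (x.1 - y.1) + k%:Z) < a%:Z)%R%:R :> R.
Proof.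
move=> y1 y2 bqM.
pose F (z : int) : R := (0 <= proj j x - z < a%:Z)%R%:R.
transitivity (\sum_(t < T0.*2.+1) \sum_(k < b) (k%:Z == proj j y - slope t)%:R * F (slope t)).
  apply: eq_bigr => t _.
  rewrite (sum_delta b (proj j y - slope t) (fun=> F (slope t))) /F /window /=.
  by case: (_ <= _ < _)%R; case: (_ <= _ < _)%R; rewrite ?mulr1 ?mulr0 ?mul0r.
rewrite exchange_big; apply: eq_bigr => k _ /=.
etransitivity.
  apply: (eq_bigr (fun t : 'I_T0.*2.+1 => (t%:Z == proj j y - k%:Z + T0%:Z)%:R
    * (fun i : int => F (i - T0%:Z)) t%:Z)) => t _ /=.
  rewrite (_ : (k%:Z == proj j y - slope t) = (t%:Z == proj j y - k%:Z + T0%:Z))//.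
  by rewrite /slope; lia.
rewrite sum_delta.
have := proj_bound j y1 y2; have := ltn_ord k.
set c := proj j y => kb cb.
have kq : (k < q * M)%N by lia.
have TE : T0 = ((2 * L + 1) * q * M + q * M)%N by rewrite /T0; ring.
rewrite (_ : (0 <= _ < _) = true) ?mul1r; last by lia.
rewrite /F addrK; congr (_%:R); congr nat_of_bool.
have -> : proj j x - (c - k%:Z) = (x.2 - y.2) * slope j + (q%:Z * (x.1 - y.1) + k%:Z).
  by rewrite /c /proj; ring.
by [].
Qed.

Lemma window_kernelE a b x y : 0 <= y.1 <= M%:Z -> 0 <= y.2 <= M%:Z ->
  (b <= q * M)%N ->
  window_kernel a b x y = \sum_(k < b) \sum_(j < J.*2.+1)
    (0 <= (x.2 - y.2) * slope j + (q%:Z * (x.1 - y.1) + k%:Z) < a%:Z)%R%:R.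
Proof.
move=> y1 y2 bqM; rewrite exchange_big /window_kernel.
rewrite -(pair_bigA _ (fun j t => (window a x (j, t) && window b y (j, t))%:R)) /=.
by apply: eq_bigr => j _; rewrite window_sum.
Qed.

Section pair.
Variables x y : int * int.
Hypotheses (x1M : 0 <= x.1 <= M%:Z) (x2M : 0 <= x.2 <= M%:Z).
Hypotheses (y1M : 0 <= y.1 <= M%:Z) (y2M : 0 <= y.2 <= M%:Z).
Let v1 := x.1 - y.1.
Let v2 := x.2 - y.2.

Lemma slope_dvd m : v2 != 0 -> exists2 e : nat, (q * m = `|v2| * e)%N &
  e%:R = (q * m)%:R / `|v2|%:R :> R.
Proof.
move=> v20; have /dvdnP[k qk] : (`|v2| %| q)%N by apply: dvdn_fact; lia.
exists (k * m)%N; first by rewrite qk; ring.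
rewrite qk (_ : (k * `|v2| * m = k * m * `|v2|)%N); last by ring.
by rewrite (natrM _ (k * m)) mulfK// pnatr_eq0; lia.
Qed.

Lemma window_kernel_le m b : v2 != 0 -> (b <= q * M)%N ->
  window_kernel (q * m) b x y <= b%:R * ((q * m)%:R / `|v2|%:R).
Proof.
move=> v20 bqM; have [e qe <-] := slope_dvd m v20.
have -> : b%:R * e%:R = \sum_(k < b) e%:R :> R.
  by rewrite sumr_const card_ord mulr_natl.
rewrite window_kernelE// qe.
by apply: ler_sum => k _; exact: slope_count_le.
Qed.

(** Each position [k] admits exactly [q m / |v2|] integer slopes. The last hypothesis says that none
    of them falls outside [[-J, J]]. *)
Lemma window_kernel_eq m b m' : v2 != 0 -> (b <= q * M)%N -> (0 < m)%N ->
  (m <= m')%N -> (b <= q * m')%N ->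
  (forall i, `|q%:Z * v1 + i * v2| < (q * m')%N%:Z -> `|i| <= J%:Z) ->
  window_kernel (q * m) b x y = b%:R * ((q * m)%:R / `|v2|%:R).
Proof.
move=> v20 bqM m0 mm bm main; have [e qe <-] := slope_dvd m v20.
have -> : b%:R * e%:R = \sum_(k < b) e%:R :> R.
  by rewrite sumr_const card_ord mulr_natl.
rewrite window_kernelE//.
apply: eq_bigr => k _; have kb := ltn_ord k.
have qmm : (q * m <= q * m')%N by rewrite leq_mul.
rewrite qe; apply: slope_count_eq => //.
  by case: e qe => //; rewrite muln0; nia.
move=> i hi; apply: main; rewrite -qe -/v1 -/v2 [v2 * _]mulrC in hi; lia.
Qed.

Lemma window_kernel_triv a b : (b <= q * M)%N ->
  window_kernel a b x y <= (5 * L * q)%:R * b%:R.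
Proof.
move=> bqM; have -> : (5 * L * q)%:R * b%:R = \sum_(k < b) (5 * L * q)%:R :> R.
  by rewrite sumr_const card_ord mulr_natr.
rewrite window_kernelE//.
apply: ler_sum => k _; rewrite sum_indicator ler_nat.
by apply: leq_trans (max_card _) _; rewrite card_ord /J; nia.
Qed.

Lemma window_kernel_eq0 a b : (b <= q * M)%N -> (b <= a)%N ->
  (forall j : 'I_J.*2.+1, ~~ (`|q%:Z * v1 + slope j * v2| < a%:Z)) ->
  window_kernel a b x y = 0.
Proof.
move=> bqM ba h; rewrite window_kernelE// big1// => k _; rewrite big1// => j _.
have := h j; have := ltn_ord k; rewrite [slope j * _]mulrC => kb hj.
by rewrite (_ : (0 <= _ < _) = false)//; rewrite -/v1 -/v2; lia.
Qed.

Lemma slope_near (j : 'I_J.*2.+1) m : `|q%:Z * v1 + slope j * v2| < (q * m)%N%:Z ->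
  (`|v1| < 2 * L * `|v2| + m)%N.
Proof.
move=> h; have sj : `|slope j * v2| <= J%:Z * `|v2|.
  by rewrite normrM ler_wpM2r// slope_bound.
have : (q * `|v1| < q * (2 * L * `|v2| + m))%N.
  have e1 : (q * `|v1|)%N%:Z = `|q%:Z * v1| by rewrite normrM PoszM; lia.
  have e2 : (q * (2 * L * `|v2| + m))%N%:Z = J%:Z * `|v2| + (q * m)%N%:Z.
    by rewrite /J; nia.
  lia.
by rewrite ltn_pmul2l.
Qed.

Definition kernel_const : R := (5 * L * (2 * L).+1)%:R.

(** If some slope joins [x] and [y], their distance is at most about [2L |v2| + m]. So either
    [|v2| >= m], the distance is comparable to [|v2|] and the slope count applies, or the distance
    is at most [(2L + 1) m] and counting all slopes is enough. *)
Lemma window_kernel_bound m : (0 < m <= M)%N ->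
  window_kernel (q * m) (q * m) x y
    <= kernel_const * (q * m)%:R ^+ 2 / (maxn 1 (dinf x y))%:R.
Proof.
move=> /andP[m0 mM]; have bM : (q * m <= q * M)%N by rewrite leq_mul.
rewrite ler_pdivlMr; last by rewrite ltr0n; lia.
have qm0 : (0 < q * m)%N by rewrite muln_gt0 q0.
have triv (D : nat) : (D <= (2 * L).+1 * m)%N ->
    window_kernel (q * m) (q * m) x y * D%:R <= kernel_const * (q * m)%:R ^+ 2.
  move=> Dm; apply: le_trans (ler_wpM2r (ler0n _ _) (window_kernel_triv (q * m) bM)) _.
  rewrite /kernel_const -!natrM -natrX -natrM ler_nat.
  apply: (@leq_trans (5 * L * q * (q * m) * ((2 * L).+1 * m))); last by nia.
  by rewrite leq_mul.
have [j0 hj|h] := pickP (fun j : 'I_J.*2.+1 => `|q%:Z * v1 + slope j * v2| < (q * m)%N%:Z); last first.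
  rewrite window_kernel_eq0 ?mul0r; first by rewrite mulr_ge0// exprn_ge0.
  - by [].
  - by [].
  - by move=> j; rewrite h.
have near := slope_near hj.
have [v2m|v2m] := ltnP `|v2| m.
  have h : (2 * L * `|v2| <= 2 * L * m)%N by rewrite leq_mul// ltnW.
  by apply: triv; rewrite /dinf mulSn -/v1 -/v2; lia.
have v20 : v2 != 0 by lia.
have v2R : (0 : R) < `|v2|%:R by rewrite ltr0n; lia.
apply: le_trans (ler_wpM2r (ler0n _ _) (window_kernel_le m v20 bM)) _.
have dv : (maxn 1 (dinf x y) <= (2 * L).+1 * `|v2|)%N by rewrite /dinf mulSn -/v1 -/v2; lia.
set A := (q * m)%:R; set D := (maxn _ _)%:R.
have -> : A * (A / `|v2|%:R) * D = D / `|v2|%:R * A ^+ 2 by ring.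
rewrite ler_wpM2r ?exprn_ge0// ler_pdivrMr// /kernel_const -natrM ler_nat.
by apply: leq_trans dv _; rewrite leq_mul// leq_pmull// muln_gt0.
Qed.

(* The window averages at the two scales [2q] and [q m'] have the same kernel
   except for differences in two thin strips around the extreme slopes. *)
Lemma window_kernel_diff m' : (1 < m' <= M)%N ->
  window_kernel (q * 2) (q * 2) x y
  - (4 / m'%:R) * window_kernel (q * 2) (q * m') x y
  + (4 / m'%:R ^+ 2) * window_kernel (q * m') (q * m') x y <=
  8 * kernel_const * q%:R ^+ 2 *
    ((`|v1 + (2 * L)%:Z * v2| <= m'%:Z) || (`|v1 - (2 * L)%:Z * v2| <= m'%:Z))%R%:R
  / (maxn 1 (dinf x y))%:R.
Proof.
move=> /andP[m1 mM]; have bM : (q * m' <= q * M)%N by rewrite leq_mul.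
have b2 : (q * 2 <= q * m')%N by rewrite leq_mul.
have m'0 : (0 : R) < m'%:R by rewrite ltr0n; lia.
have D0 : (0 : R) < (maxn 1 (dinf x y))%:R by rewrite ltr0n; lia.
have C0 : 0 <= kernel_const by rewrite ler0n.
have kge0 a b : 0 <= window_kernel a b x y by apply: sumr_ge0.
have [strip|nostrip] := boolP (_ || _).
  rewrite mulr1.
  have h2 := @window_kernel_bound 2; have hm := @window_kernel_bound m'.
  have h2' := h2 ltac:(lia); have hm' := hm ltac:(lia).
  have -> : 8 * kernel_const * q%:R ^+ 2 / (maxn 1 (dinf x y))%:R
    = kernel_const * (q * 2)%:R ^+ 2 / (maxn 1 (dinf x y))%:R +
      4 / m'%:R ^+ 2 * (kernel_const * (q * m')%:R ^+ 2 / (maxn 1 (dinf x y))%:R).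
    by rewrite !natrM; field; rewrite !gt_eqF.
  apply: lerD.
    apply: le_trans _ h2'; rewrite gerBl mulr_ge0// divr_ge0// ltW//.
  by apply: ler_wpM2l hm'; rewrite divr_ge0// exprn_ge0// ltW.
rewrite mulr0 mul0r.
have [j0 hj|h] := pickP (fun j : 'I_J.*2.+1 => `|q%:Z * v1 + slope j * v2| < (q * m')%N%:Z); last first.
  have e1 : window_kernel (q * 2) (q * 2) x y = 0.
    apply: window_kernel_eq0 => //; first lia.
    by move=> j; have := h j; lia.
  have e2 : window_kernel (q * m') (q * m') x y = 0.
    by apply: window_kernel_eq0 => // j; rewrite h.
  by rewrite e1 e2 mulr0 addr0 add0r oppr_le0 mulr_ge0// divr_ge0// ltW.
have near := slope_near hj.
have v20 : v2 != 0.
  apply/negP => /eqP v20; move: nostrip near; rewrite v20; lia.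
(* The affine map [i -> q v1 + i v2] is in the wide window at [slope j0]. Were it there also at some
   [i] beyond [J] or [-J], it would be there at that end of the range, which lies in between, and
   [x - y] would be in a strip. *)
have main i : `|q%:Z * v1 + i * v2| < (q * m')%N%:Z -> `|i| <= J%:Z.
  move=> hi; rewrite leNgt; apply/negP => iJ.
  have sJ := slope_bound j0.
  have qz : 0 < q%:Z by [].
  have key (u : int) : u = 1 \/ u = - 1 ->
      `|q%:Z * v1 + u * J%:Z * v2| < (q * m')%N%:Z -> False.
    move=> uE hs; move/negP: nostrip; apply; apply/orP.
    have e : q%:Z * v1 + u * J%:Z * v2 = q%:Z * (v1 + u * (2 * L)%N%:Z * v2).
      by rewrite /J (PoszM (2 * L) q); ring.
    rewrite e (PoszM q m') normrM ger0_norm// ltr_pM2l// in hs.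
    by case: uE hs => -> hs; [left|right]; lia.
  have J0 : (0 < J)%N by rewrite /J !muln_gt0 L0.
  have [ip|im] : J%:Z < i \/ i < - J%:Z by lia.
    apply: (key 1); first (by left); rewrite mul1r.
    have [vp|vn] : 0 < v2 \/ v2 < 0 by lia.
      have : slope j0 * v2 <= J%:Z * v2 <= i * v2 by rewrite !ler_wpM2r; lia.
      lia.
    have : i * v2 <= J%:Z * v2 <= slope j0 * v2 by rewrite !ler_wnM2r; lia.
    lia.
  apply: (key (- 1)); first (by right); rewrite mulN1r.
  have [vp|vn] : 0 < v2 \/ v2 < 0 by lia.
    have : i * v2 <= - J%:Z * v2 <= slope j0 * v2 by rewrite !ler_wpM2r; lia.
    lia.
  have : slope j0 * v2 <= - J%:Z * v2 <= i * v2 by rewrite !ler_wnM2r; lia.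
  lia.
have v2R : (`|v2|%:R : R) != 0 by rewrite pnatr_eq0; lia.
(* Each kernel is now the product of its two widths divided by [|v2|], and the combination is
   [4 - 8 + 4 = 0] times [q^2 / |v2|]. *)
rewrite (window_kernel_eq (m' := m') v20)//; [|lia..].
rewrite (window_kernel_eq (m' := m') v20)//; [|lia..].
rewrite (window_kernel_eq (m' := m') v20)//; [|lia..].
rewrite le_eqVlt; apply/orP; left; apply/eqP; rewrite !natrM; field.
by rewrite v2R gt_eqF.
Qed.

End pair.
End kernel.

Section radial_estimate.
Context {R : realType}.
Variables (L M : nat) (I : finType) (pos : I -> int * int) (w : I -> R).
Hypotheses (L0 : (0 < L)%N) (M0 : (0 < M)%N).
Let q := M`!.
Let J := (2 * L * q)%N.
Hypotheses (w0 : forall i, 0 <= w i) (w1 : \sum_i w i = 1).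
Hypothesis pos1 : forall i, 0 <= (pos i).1 < M%:Z.
Hypothesis pos2 : forall i, 0 <= (pos i).2 < M%:Z.
Variables (G : I -> 'I_J.*2.+1 -> R) (E : I -> I -> R).
Hypotheses (G0 : forall i j, 0 <= G i j) (G1 : forall i j, G i j <= 1).
Hypothesis EG : forall x y, (M <= L * `|(pos x).2 - (pos y).2|)%N ->
  forall j, 0 <= q%:Z * ((pos x).1 - (pos y).1) + slope j * ((pos x).2 - (pos y).2) < q%:Z ->
  E x y <= G y j.

Let q0 : (0 < q)%N. Proof. exact: fact_gt0. Qed.
Let pos1' i : 0 <= (pos i).1 <= M%:Z. Proof. by have := pos1 i; lia. Qed.
Let pos2' i : 0 <= (pos i).2 <= M%:Z. Proof. by have := pos2 i; lia. Qed.
Let qR : (0 : R) < q%:R. Proof. by rewrite ltr0n. Qed.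
Let MR : (0 : R) < M%:R. Proof. by rewrite ltr0n. Qed.

Local Notation win := (@window L M).
Local Notation Omega := ('I_J.*2.+1 * 'I_((2 * L + 2) * q * M).*2.+1)%type.

Definition mass (a : nat) (o : Omega) : R := \sum_x w x * (win a (pos x) o)%:R.
Definition weighted_mass (o : Omega) : R :=
  \sum_y w y * G y o.1 * (win q (pos y) o)%:R.

Lemma sum_mass_mass a b : \sum_o mass a o * mass b o =
  \sum_y w y * \sum_x w x * @window_kernel R L M a b (pos x) (pos y).
Proof.
transitivity (\sum_o \sum_x \sum_y w x * w y * (win a (pos x) o && win b (pos y) o)%:R).
  apply: eq_bigr => o _; rewrite /mass mulr_suml; apply: eq_bigr => x _.
  rewrite mulr_sumr; apply: eq_bigr => y _.
  by case: (win a _ _); case: (win b _ _); rewrite /= ?mulr1 ?mulr0 ?mul0r.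
rewrite exchange_big /=; under eq_bigr => x _ do rewrite exchange_big /=.
rewrite exchange_big /=; apply: eq_bigr => y _; rewrite mulr_sumr.
apply: eq_bigr => x _; rewrite /window_kernel !mulr_sumr.
by apply: eq_bigr => o _; rewrite mulrCA mulrA.
Qed.

Lemma mass_le1 a o : mass a o <= 1.
Proof.
rewrite -w1; apply: ler_sum => x _; case: (win a _ _); rewrite ?mulr1// mulr0.
exact: w0.
Qed.

Lemma weighted_mass_ge0 o : 0 <= weighted_mass o.
Proof. by apply: sumr_ge0 => x _; rewrite !mulr_ge0. Qed.

Lemma weighted_mass_le o : weighted_mass o <= mass (q * 1) o.
Proof.
apply: ler_sum => x _; rewrite muln1 ler_wpM2r// ler_piMr//; exact: w0.
Qed.

Lemma weighted_average_le (f : I -> R) c : (forall i, f i <= c) ->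
  \sum_i w i * f i <= c.
Proof.
move=> fc; apply: (@le_trans _ _ (\sum_i w i * c)).
  by apply: ler_sum => i _; rewrite ler_wpM2l ?w0.
by rewrite -mulr_suml w1 mul1r.
Qed.

(** For each slope a point lies in the windows of exactly [q] offsets. *)
Lemma sum_weighted_mass b : (forall y, \sum_j G y j <= b * q%:R) ->
  \sum_o weighted_mass o <= b * q%:R ^+ 2.
Proof.
move=> Gb; rewrite exchange_big /=.
under eq_bigr => y _ do under eq_bigr => o _ do rewrite -mulrA.
under eq_bigr => y _ do rewrite -mulr_sumr.
apply: weighted_average_le => y.
rewrite -(pair_bigA _ (fun j t => G y j * (win q (pos y) (j, t))%:R)) /=.
rewrite expr2 mulrA; apply: le_trans (ler_wpM2r (ler0n _ _) (Gb y)).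
rewrite mulr_suml le_eqVlt; apply/orP; left; apply/eqP; apply: eq_bigr => j _.
rewrite -mulr_sumr; congr (_ * _).
have qM : (q <= q * M)%N by rewrite leq_pmulr.
have := @window_sum R L M L0 M0 q q (pos y) (pos y) j (pos1' y) (pos2' y) qM.
under eq_bigr => t _ do rewrite andbb.
move=> ->; rewrite -[in RHS](card_ord q) -sumr_const; apply: eq_bigr => k _.
by rewrite (_ : (0 <= _ < _) = true)//; have := ltn_ord k; rewrite !subrr mul0r mulr0; lia.
Qed.

(** At least [q / M] slopes in the range join a far pair. For each there are [q] offsets whose
    window of width [q] contains [y], and the window of width [2 q] at the same offset then contains
    [x]. *)
Lemma incidence_pointwise x y : (M <= L * `|(pos x).2 - (pos y).2|)%N ->
  E x y <= M%:R / q%:R ^+ 2 *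
    \sum_(o : Omega) (win (q * 2) (pos x) o)%:R * (G y o.1 * (win q (pos y) o)%:R).
Proof.
set v1 := (pos x).1 - (pos y).1; set v2 := (pos x).2 - (pos y).2 => v2L.
have v20 : v2 != 0 by apply/negP => /eqP v20; move: v2L; rewrite v20; lia.
have v2M : (`|v2| <= M)%N by have := pos2 x; have := pos2 y; rewrite /v2; lia.
have /dvdnP[e qe] : (`|v2| %| q)%N by apply: dvdn_fact; lia.
pose ind (j : 'I_J.*2.+1) : R := (0 <= v2 * slope j + q%:Z * v1 < q%:Z)%R%:R.
have cnt : \sum_(j < J.*2.+1) ind j = e%:R.
  have := @slope_count_eq R J v2 (q%:Z * v1) e v20; rewrite mulnC -qe; apply.
    by case: e qe => //; rewrite mul0n; lia.
  move=> i hi; have v1M : `|v1| <= M%:Z - 1.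
    by have := pos1 x; have := pos1 y; rewrite /v1; lia.
  have h1 : `|q%:Z * v1| <= q%:Z * (M%:Z - 1) by rewrite normrM ler_pM.
  have h2 : `|v2 * i| <= q%:Z * M%:Z by lia.
  have h3 : (`|v2| * `|i| <= q * M)%N by rewrite -abszM; lia.
  have h4 : (M * `|i| <= M * (L * q))%N.
    apply: (@leq_trans (L * (`|v2| * `|i|))); first by rewrite mulnA leq_mul.
    by rewrite [leqRHS]mulnCA leq_mul2l [(M * q)%N]mulnC h3 orbT.
  rewrite leq_pmul2l// in h4; rewrite /J -mulnA; lia.
have eM : q%:R / M%:R <= e%:R :> R.
  by rewrite ler_pdivrMr// -natrM ler_nat qe leq_mul.
have step1 : E x y * (q%:R / M%:R) <= \sum_j ind j * G y j.
  have [En|Ep] := ltP (E x y) 0.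
    apply: (@le_trans _ _ 0); last by apply: sumr_ge0 => j _; rewrite mulr_ge0.
    by rewrite mulr_le0_ge0 ?(ltW En)// divr_ge0.
  apply: le_trans (ler_wpM2l Ep eM) _; rewrite -cnt mulr_sumr.
  apply: ler_sum => j _; rewrite /ind; case: (boolP (0 <= _ < _)%R) => [h|_]; last by rewrite mulr0 mul0r.
  by rewrite mulr1 mul1r; apply: EG => //; rewrite -/v1 -/v2 addrC mulrC.
have step2 : q%:R * \sum_j ind j * G y j <=
    \sum_(o : Omega) (win (q * 2) (pos x) o)%:R * (G y o.1 * (win q (pos y) o)%:R).
  rewrite -(pair_bigA _ (fun j t => (win (q * 2) (pos x) (j, t))%:R *
    (G y j * (win q (pos y) (j, t))%:R))) /= mulr_sumr; apply: ler_sum => j _.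
  have qM : (q <= q * M)%N by rewrite leq_pmulr.
  have := @window_sum R L M L0 M0 (q * 2) q (pos x) (pos y) j (pos1' y) (pos2' y) qM.
  rewrite (eq_bigr (fun t => (win (q * 2) (pos x) (j, t))%:R * (win q (pos y) (j, t))%:R)); last first.
    by move=> t _; case: (win _ _ _); case: (win _ _ _); rewrite ?mulr1 ?mulr0.
  move=> sE; under eq_bigr => t _ do rewrite mulrCA.
  rewrite -mulr_sumr sE mulrA mulrC ler_wpM2l// /ind.
  case: (boolP (0 <= _ < _)) => [h|_]; last by rewrite mulr0 sumr_ge0.
  rewrite mulr1 [leLHS](_ : _ = \sum_(k < q) 1); last by rewrite sumr_const card_ord.
  apply: ler_sum => k _.
  have kq := ltn_ord k; rewrite addrA; move: h; rewrite -/q -/v1 -/v2.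
  set z := v2 * slope j + q%:Z * v1 => h.
  by rewrite (_ : (0 <= _ < _) = true)//; lia.
rewrite [leLHS](_ : _ = M%:R / q%:R ^+ 2 * (q%:R * (E x y * (q%:R / M%:R)))); last first.
  by field; rewrite !gt_eqF.
rewrite ler_wpM2l ?divr_ge0 ?exprn_ge0//; apply: le_trans step2.
by rewrite ler_wpM2l.
Qed.

Lemma incidence_sum :
  \sum_y \sum_(x | (M <= L * `|(pos x).2 - (pos y).2|)%N) w x * w y * E x y
  <= M%:R / q%:R ^+ 2 * \sum_o mass (q * 2) o * weighted_mass o.
Proof.
have -> : M%:R / q%:R ^+ 2 * \sum_o mass (q * 2) o * weighted_mass o
  = \sum_y \sum_x w x * w y * (M%:R / q%:R ^+ 2 *
    \sum_(o : Omega) (win (q * 2) (pos x) o)%:R * (G y o.1 * (win q (pos y) o)%:R)).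
  transitivity (M%:R / q%:R ^+ 2 * \sum_o \sum_y \sum_x (w x * w y) *
      ((win (q * 2) (pos x) o)%:R * (G y o.1 * (win q (pos y) o)%:R))).
    congr (_ * _); apply: eq_bigr => o _; rewrite /mass mulr_suml exchange_big /=.
    apply: eq_bigr => x _; rewrite mulr_sumr; apply: eq_bigr => y _; ring.
  rewrite exchange_big /= mulr_sumr; apply: eq_bigr => y _.
  rewrite exchange_big /= mulr_sumr; apply: eq_bigr => x _.
  by rewrite -mulr_sumr mulrCA.
apply: ler_sum => y _; rewrite big_mkcond; apply: ler_sum => x _.
case: ifP => h; first by rewrite ler_wpM2l ?mulr_ge0 ?w0// incidence_pointwise.
rewrite !mulr_ge0 ?w0 ?invr_ge0 ?exprn_ge0//.
by apply: sumr_ge0 => o _; rewrite !mulr_ge0.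
Qed.

Variables (s A C : R).
Hypotheses (s1 : 1 < s) (fw : frostman pos w s A).
Hypothesis C0 : 0 <= C.
Hypothesis energy : forall (c : int * int) m, (0 < m)%N ->
  \sum_(x | (dinf (pos x) c <= m)%N) w x / (maxn 1 (dinf (pos x) c))%:R
  <= C * A * m%:R `^ (s - 1).

Lemma mass_sqr : \sum_o mass (q * 1) o ^+ 2 <=
  kernel_const L * q%:R ^+ 2 * (C * A * M%:R `^ (s - 1)).
Proof.
under eq_bigr => o _ do rewrite expr2.
rewrite sum_mass_mass; apply: weighted_average_le => y.
have kq : 0 <= kernel_const L * q%:R ^+ 2 :> R by rewrite mulr_ge0 ?ler0n ?exprn_ge0.
apply: le_trans (ler_wpM2l kq (energy (pos y) M0)).
rewrite mulr_sumr big_mkcond [leRHS]big_mkcond /=; apply: ler_sum => x _.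
rewrite ifT; last by have := pos1 x; have := pos2 x; have := pos1 y; have := pos2 y; rewrite /dinf; lia.
have := @window_kernel_bound R L M L0 M0 (pos x) (pos y) (pos1' x) (pos2' x) (pos1' y) (pos2' y) 1.
rewrite -/q => h; have := h ltac:(lia).
by move=> /(ler_wpM2l (w0 x)); congr (_ <= _); rewrite muln1; ring.
Qed.

(** By [window_kernel_diff] only pairs in the two extreme strips contribute. Those at distance at
    most [l] are bounded by the energy; for the others the kernel is of order [1 / l], and
    [frostman_strip] bounds the mass. *)
Lemma mass_diff_sqr m' l : (1 < m' <= M)%N -> (0 < l)%N ->
  \sum_o (mass (q * 2) o - 2 / m'%:R * mass (q * m') o) ^+ 2 <=
  8 * kernel_const L * q%:R ^+ 2 * (C * A * l%:R `^ (s - 1)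
    + 6 * M%:R * A * ((2 * L).+1)%:R `^ s * m'%:R `^ (s - 1) / l%:R).
Proof.
move=> m'M l0; have [m1 mM] := andP m'M.
have m'R : (0 : R) < m'%:R by rewrite ltr0n; lia.
have lR : (0 : R) < l%:R by rewrite ltr0n; lia.
pose strip x y : bool := let v1 := (pos x).1 - (pos y).1 in let v2 := (pos x).2 - (pos y).2 in
  (`|v1 + (2 * L)%:Z * v2| <= m'%:Z) || (`|v1 - (2 * L)%:Z * v2| <= m'%:Z).
have -> : \sum_o (mass (q * 2) o - 2 / m'%:R * mass (q * m') o) ^+ 2 =
  \sum_y w y * \sum_x w x * (@window_kernel R L M (q * 2) (q * 2) (pos x) (pos y)
    - 4 / m'%:R * @window_kernel R L M (q * 2) (q * m') (pos x) (pos y)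
    + 4 / m'%:R ^+ 2 * @window_kernel R L M (q * m') (q * m') (pos x) (pos y)).
  transitivity (\sum_o (mass (q * 2) o * mass (q * 2) o)
    - 4 / m'%:R * \sum_o (mass (q * 2) o * mass (q * m') o)
    + 4 / m'%:R ^+ 2 * \sum_o (mass (q * m') o * mass (q * m') o)).
    rewrite !mulr_sumr -sumrB -big_split; apply: eq_bigr => o _ /=.
    by field; rewrite gt_eqF.
  rewrite !sum_mass_mass !mulr_sumr -sumrB -big_split; apply: eq_bigr => y _ /=.
  rewrite !mulr_sumr -sumrB -big_split; apply: eq_bigr => x _ /=; ring.
apply: weighted_average_le => y.
apply: (@le_trans _ _ (8 * kernel_const L * q%:R ^+ 2 *
   \sum_x w x * (strip x y)%:R / (maxn 1 (dinf (pos x) (pos y)))%:R)).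
  rewrite mulr_sumr; apply: ler_sum => x _.
  have := @window_kernel_diff R L M L0 M0 (pos x) (pos y) (pos1' x) (pos2' x) (pos1' y) (pos2' y) m' m'M.
  by move=> /(ler_wpM2l (w0 x)); congr (_ <= _); rewrite /strip /=; ring.
rewrite ler_wpM2l ?mulr_ge0 ?ler0n ?exprn_ge0//.
have Mpos x : `|(pos x).2 - (pos y).2| <= M%:Z by have := pos2 x; have := pos2 y; lia.
have m'M' : (0 < m' <= M)%N by lia.
have S1 := frostman_strip s1 fw w0 (2 * L)%:Z m'M' Mpos.
have S2 := frostman_strip s1 fw w0 (- (2 * L)%:Z) m'M' Mpos.
rewrite abszN absz_nat in S2; rewrite absz_nat in S1.
apply: (@le_trans _ _ (\sum_(x | (dinf (pos x) (pos y) <= l)%N) w x / (maxn 1 (dinf (pos x) (pos y)))%:R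
  + ((\sum_(x | `|(pos x).1 - (pos y).1 + (2 * L)%:Z * ((pos x).2 - (pos y).2)| <= m'%:Z) w x)
  + (\sum_(x | `|(pos x).1 - (pos y).1 + - (2 * L)%:Z * ((pos x).2 - (pos y).2)| <= m'%:Z) w x)) / l%:R)).
  rewrite mulrDl !mulr_suml [X in _ <= X + _]big_mkcond [X in _ <= _ + (X + _)]big_mkcond.
  rewrite [X in _ <= _ + (_ + X)]big_mkcond -!big_split; apply: ler_sum => x _ /=.
  set D := maxn 1 _; have D0 : (0 : R) < D%:R by rewrite ltr0n /D leq_max.
  have p1 : 0 <= w x / D%:R by rewrite divr_ge0 ?w0.
  have p2 : 0 <= w x / l%:R by rewrite divr_ge0 ?w0.
  case: ifP => dl.
    apply: (@le_trans _ _ (w x / D%:R)); last first.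
      by rewrite lerDl; do 2 case: ifP => _; rewrite ?addr0 ?add0r// addr_ge0.
    by rewrite ler_wpM2r ?invr_ge0// ler_piMr ?w0//; case: (strip x y).
  rewrite add0r.
  have lD : w x / D%:R <= w x / l%:R.
    rewrite ler_wpM2l ?w0// lef_pV2 ?posrE// ler_nat /D leq_max.
    by rewrite orbC ltnW// ltnNge dl.
  case: (boolP (strip x y)) => st; last first.
    rewrite mulr0 mul0r; do 2 case: ifP => _; rewrite ?addr0 ?add0r// addr_ge0//.
  rewrite mulr1; apply: le_trans lD _; move: st; rewrite /strip /= mulNr.
  by case/orP => ->; rewrite ?lerDl ?lerDr; case: ifP.
apply: lerD; first exact: energy.
rewrite ler_wpM2r ?invr_ge0//; apply: le_trans (lerD S1 S2) _.
by rewrite le_eqVlt; apply/orP; left; apply/eqP; ring.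
Qed.

(** Write [mass (q * 2)] as [2 / m'] times the wide mass plus an error [e]. The wide mass is at most
    1, which leaves the total of [weighted_mass], controlled by [b]. The product of [weighted_mass]
    and [e] is split by the arithmetic-geometric inequality with parameter [tau], and both squares
    are second moments already bounded. *)
Lemma radial_estimate m' l b tau : (1 < m' <= M)%N -> (0 < l)%N -> 0 < tau ->
  (forall y, \sum_j G y j <= b * q%:R) ->
  \sum_y \sum_(x | (M <= L * `|(pos x).2 - (pos y).2|)%N) w x * w y * E x y <=
  2 * M%:R * b / m'%:R +
  M%:R * kernel_const L * (tau * (C * A * M%:R `^ (s - 1)) +
   4 / tau * (C * A * l%:R `^ (s - 1)
    + 6 * M%:R * A * ((2 * L).+1)%:R `^ s * m'%:R `^ (s - 1) / l%:R)).
Proof.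
move=> m'M l0 tau0 Gb; have [m1 mM] := andP m'M.
have m'R : (0 : R) < m'%:R by rewrite ltr0n; lia.
apply: le_trans incidence_sum _.
pose e o := mass (q * 2) o - 2 / m'%:R * mass (q * m') o.
have h1 : \sum_o mass (q * 2) o * weighted_mass o <=
    2 / m'%:R * (b * q%:R ^+ 2) + (tau * \sum_o mass (q * 1) o ^+ 2
      + 1 / (2 * tau) * \sum_o e o ^+ 2).
  apply: (@le_trans _ _ (2 / m'%:R * \sum_o weighted_mass o +
     (tau * \sum_o mass (q * 1) o ^+ 2 + 1 / (2 * tau) * \sum_o e o ^+ 2))).
    rewrite !mulr_sumr -!big_split; apply: ler_sum => o _ /=.
    have -> : mass (q * 2) o * weighted_mass o =
      2 / m'%:R * (mass (q * m') o * weighted_mass o) + weighted_mass o * e o.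
      by rewrite /e; ring.
    apply: lerD.
      rewrite ler_wpM2l ?divr_ge0 ?ler0n// ler_piMl ?mass_le1//.
      exact: weighted_mass_ge0.
    have u0 := weighted_mass_ge0 o; have uF := weighted_mass_le o.
    set u := weighted_mass o in u0 uF *; set F := mass _ o in uF *.
    have uF2 : u ^+ 2 <= F ^+ 2 by rewrite ler_sqr ?nnegrE//; apply: le_trans uF.
    apply: (@le_trans _ _ (tau * u ^+ 2 + 1 / (2 * tau) * e o ^+ 2)); last first.
      by rewrite lerD2r ler_wpM2l// ltW.
    rewrite -subr_ge0.
    have -> : tau * u ^+ 2 + 1 / (2 * tau) * e o ^+ 2 - u * e o =
        (tau * u ^+ 2 + (tau * u - e o) ^+ 2 / tau) / 2.
      by field; rewrite gt_eqF.
    have tu : 0 <= tau * u ^+ 2 by rewrite mulr_ge0 ?sqr_ge0// ltW.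
    by rewrite divr_ge0// addr_ge0// divr_ge0 ?sqr_ge0// ltW.
  rewrite lerD2r ler_wpM2l ?divr_ge0//; exact: sum_weighted_mass.
have h2 : M%:R / q%:R ^+ 2 * (2 / m'%:R * (b * q%:R ^+ 2)) = 2 * M%:R * b / m'%:R.
  by field; rewrite !gt_eqF.
apply: le_trans (ler_wpM2l _ h1) _; first by rewrite divr_ge0// exprn_ge0.
rewrite mulrDr h2 lerD2l.
have Mq : 0 <= M%:R / q%:R ^+ 2 :> R by rewrite divr_ge0// exprn_ge0.
apply: le_trans (ler_wpM2l Mq (lerD (ler_wpM2l (ltW tau0) mass_sqr)
  (ler_wpM2l _ (mass_diff_sqr m'M l0)))) _; first by rewrite divr_ge0// mulr_ge0 ?ltW.
rewrite le_eqVlt; apply/orP; left; apply/eqP. field.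
by rewrite !gt_eqF//= ltr0n.
Qed.

End radial_estimate.

Section radial_bound.
Context {R : realType}.
Implicit Types (s K C : R).

Lemma powRn_small C p eps : 0 <= C -> 0 < p -> 0 < eps ->
  exists2 n : nat, (0 < n)%N & C / n%:R `^ p <= eps.
Proof.
move=> C0 p0 e0; set y := C / eps + 1.
have y0 : 0 < y by rewrite /y ltr_wpDl// divr_ge0// ltW.
have [n hn] : exists n : nat, y `^ p^-1 <= n%:R.
  exists (Num.truncn (y `^ p^-1)).+1; apply/ltW/truncnS_gt.
exists n.+1 => //.
have hp : y <= n.+1%:R `^ p.
  have ey : (y `^ p^-1) `^ p = y.
    by rewrite -powRrM mulVf ?gt_eqF// powRr1// ltW.
  rewrite -[leLHS]ey; apply: ge0_ler_powR; rewrite ?nnegrE ?powR_ge0 ?ler0n ?(ltW p0)//.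
  by apply: le_trans hn _; rewrite ler_nat.
rewrite ler_pdivrMr ?powR_gt0 ?ltr0n// mulrC -ler_pdivrMr//.
by apply: le_trans hp; rewrite /y lerDl.
Qed.

(** With the normalization [K / M^s] the bound on a strip of width [M / n] is free of [M]; this is
    why the constants of [radial_bound] can be chosen before [M]. *)
Lemma scaled_powR_le s K (M n : nat) : 1 < s -> 0 <= K -> (0 < M)%N -> (0 < n)%N ->
  M%:R * (K / M%:R `^ s) * ((M %/ n)%N)%:R `^ (s - 1) <= K / n%:R `^ (s - 1).
Proof.
move=> s1 K0 M0 n0; have s0 : 0 <= s - 1 by lra.
have nR : (0 : R) < n%:R by rewrite ltr0n.
have MR : (0 : R) < M%:R by rewrite ltr0n.
have h : ((M %/ n)%N)%:R * n%:R <= M%:R :> R by rewrite -natrM ler_nat leq_trunc_div.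
have h2 : ((M %/ n)%N)%:R `^ (s - 1) * n%:R `^ (s - 1) <= M%:R `^ (s - 1) :> R.
  rewrite -powRM ?ler0n//; apply: ge0_ler_powR => //; rewrite nnegrE ?mulr_ge0 ?ler0n//.
rewrite ler_pdivlMr ?powR_gt0//.
have e : M%:R `^ s = M%:R * M%:R `^ (s - 1) :> R by rewrite mulr_powRB1 ?ler0n//; lra.
have p : 0 <= M%:R * (K / M%:R `^ s) by rewrite mulr_ge0 ?ler0n// divr_ge0// powR_ge0.
rewrite -(mulrA (M%:R * _)); apply: (le_trans (ler_wpM2l p h2)).
rewrite e le_eqVlt; apply/orP; left; apply/eqP; field.
by rewrite !gt_eqF// powR_gt0.
Qed.

(* For all but a small proportion of pairs [(x, y)], the direction of [x - y] is
   typical: a function [G y] of the slope with small mean has small mean along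
   the directions of the points [x] seen from [y]. *)
Lemma radial_bound s K gam : 1 < s -> 0 < K -> 0 < gam ->
  exists L M0 : nat, exists b : R, [/\ (0 < L)%N, 0 < b &
  forall (M : nat) (I : finType) (pos : I -> int * int) (w : I -> R)
    (G : I -> 'I_(2 * L * M`!).*2.+1 -> R) (E : I -> I -> R),
  (M0 <= M)%N ->
  (forall i, 0 <= w i) -> \sum_i w i = 1 ->
  (forall i, 0 <= (pos i).1 < M%:Z) -> (forall i, 0 <= (pos i).2 < M%:Z) ->
  frostman pos w s (K / M%:R `^ s) ->
  (forall i j, 0 <= G i j <= 1) -> (forall y, \sum_j G y j <= b * (M`!)%:R) ->
  (forall x y, (M <= L * `|(pos x).2 - (pos y).2|)%N ->
    forall j, 0 <= (M`!)%:Z * ((pos x).1 - (pos y).1)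
       + slope j * ((pos x).2 - (pos y).2) < (M`!)%:Z -> E x y <= G y j) ->
  \sum_y \sum_x w x * w y *
    (if (M <= L * `|(pos x).2 - (pos y).2|)%N then E x y else 1) <= gam].
Proof.
move=> s1 K0 g0; have sp : 0 < s - 1 by lra.
have [C C0 energy] := @energy_bound R s s1.
(* All constants are independent of [M] and chosen in this order: [L] makes the nearly horizontal
   pairs, which count for 1, weigh at most [gam / 4]; [tau] makes the term in [mass_sqr] equal to
   [gam / 4]; [l0], with [l = M / l0], and then [r0], with [m' = M / r0], make the two parts of the
   difference at most [gam / 8]; finally [b = gam / (16 r0)] makes the main term at most
   [gam / 4]. *)
have [L L0 hL] : exists2 n : nat, (0 < n)%N & 3 * K / n%:R `^ (s - 1) <= gam / 4.
  by apply: powRn_small => //; rewrite ?divr_gt0// mulr_ge0// ltW.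
set kc := @kernel_const R L.
have kc0 : 0 < kc by rewrite ltr0n !muln_gt0 L0.
pose tau := gam / (4 * kc * C * K).
have tau0 : 0 < tau by rewrite divr_gt0// !mulr_gt0.
have [l0 l00 hl0] : exists2 n : nat, (0 < n)%N &
    kc * (4 / tau) * C * K / n%:R `^ (s - 1) <= gam / 8.
  by apply: powRn_small => //; [rewrite ltW// !(mulr_gt0, invr_gt0)|rewrite divr_gt0].
have [r0 r00 hr0] : exists2 n : nat, (0 < n)%N &
    kc * (4 / tau) * (12 * ((2 * L).+1)%:R `^ s * l0%:R) * K / n%:R `^ (s - 1) <= gam / 8.
  apply: powRn_small => //; last by rewrite divr_gt0.
  by rewrite ltW// !(mulr_gt0, invr_gt0)// ?powR_gt0 ?ltr0n.
have r0R : (0 : R) < r0%:R by rewrite ltr0n.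
exists L, (2 * r0 + l0 + L)%N, (gam / (16 * r0%:R)).
split => //; first by rewrite divr_gt0// mulr_gt0.
move=> M I pos w G E MM0 w0 w1 pos1 pos2 fw G01 Gb EG.
have [M0 Mr Ml ML] : [/\ (0 < M)%N, (2 * r0 <= M)%N, (l0 <= M)%N & (L <= M)%N].
  by clear -MM0 L0; split; lia.
have MR : (0 : R) < M%:R by rewrite ltr0n.
set A := K / M%:R `^ s; have A0 : 0 <= A by rewrite divr_ge0 ?powR_ge0 ?ltW.
have G0 i j : 0 <= G i j by case/andP: (G01 i j).
have G1 i j : G i j <= 1 by case/andP: (G01 i j).
pose m' := (M %/ r0)%N; pose l := (M %/ l0)%N; pose m := (M %/ L)%N.
have m'M : (1 < m' <= M)%N by rewrite leq_div andbT /m' leq_divRL.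
have l1 : (0 < l)%N by rewrite divn_gt0.
have m1 : (0 < m <= M)%N by rewrite leq_div andbT divn_gt0.
have en (c : int * int) k : (0 < k)%N ->
    \sum_(x | (dinf (pos x) c <= k)%N) w x / (maxn 1 (dinf (pos x) c))%:R
    <= C * A * k%:R `^ (s - 1).
  by move=> k0; apply: energy => // j j0; exact: fw.
have main := radial_estimate L0 M0 w0 w1 pos1 pos2 G0 G1 EG s1 fw (ltW C0) en m'M l1 tau0 Gb.
have far : \sum_y \sum_(x | ~~ (M <= L * `|(pos x).2 - (pos y).2|)%N) w x * w y <= gam / 4.
  apply: le_trans hL; under eq_bigr => y _ do rewrite -mulr_suml mulrC.
  apply: weighted_average_le => // y.
  have fs := frostman_strip s1 (frostman_swap fw) w0 (c := ((pos y).2, (pos y).1)) 0 m1.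
  have posM i : `|(pos i).1 - (pos y).1| <= M%:Z.
    by have := pos1 i; have := pos1 y; clear; lia.
  move: fs => /(_ posM); rewrite (_ : (absz 0).+1 = 1%N)// powR1 mulr1 /= => h.
  apply: (@le_trans _ _ (\sum_(i | `|(pos i).2 - (pos y).2 + 0 * ((pos i).1 - (pos y).1)| <= m%:Z) w i)).
    rewrite big_mkcond [leRHS]big_mkcond; apply: ler_sum => x _.
    rewrite mul0r addr0; case: ifP => xy; last by case: ifP.
    rewrite ifT// -abszE lez_nat /m leq_divRL// mulnC ltnW// ltnNge.
    by rewrite xy.
  apply: le_trans h _.
  have := scaled_powR_le s1 (ltW K0) M0 L0; rewrite -/A -/m => h2.
  have : 0 <= 3 :> R by [].
  move=> /ler_wpM2l /(_ _ _ h2); congr (_ <= _); ring.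
have split_sum : \sum_y \sum_x w x * w y *
    (if (M <= L * `|(pos x).2 - (pos y).2|)%N then E x y else 1) =
   \sum_y \sum_(x | (M <= L * `|(pos x).2 - (pos y).2|)%N) w x * w y * E x y +
   \sum_y \sum_(x | ~~ (M <= L * `|(pos x).2 - (pos y).2|)%N) w x * w y.
  rewrite -big_split; apply: eq_bigr => y _ /=.
  rewrite (bigID (fun x => (M <= L * `|(pos x).2 - (pos y).2|)%N)) /=.
  by congr (_ + _); apply: eq_bigr => x xy; [rewrite xy|rewrite (negbTE xy) mulr1].
rewrite split_sum; apply: le_trans (lerD main far) _.
have m'R : (0 : R) < m'%:R by rewrite ltr0n; case/andP: m'M => /ltnW.
have lR : (0 : R) < l%:R by rewrite ltr0n.
have t1 : 2 * M%:R * (gam / (16 * r0%:R)) / m'%:R <= gam / 4.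
  have hM : M%:R <= 2 * r0%:R * m'%:R :> R.
    rewrite -!natrM ler_nat; apply: (leq_trans (ltnW (ltn_ceil M r00))).
    by rewrite -/m' mulnAC leq_mul2r; case/andP: m'M => + _; clear; lia.
  rewrite ler_pdivrMr//.
  have p : 0 <= gam / (8 * r0%:R) by rewrite divr_ge0 ?mulr_ge0 ?ltW.
  have := ler_wpM2l p hM; congr (_ <= _); field; rewrite gt_eqF//.
have t2 : M%:R * kc * (tau * (C * A * M%:R `^ (s - 1))) = gam / 4.
  have e : M%:R * A * M%:R `^ (s - 1) = K.
    rewrite /A; have -> : M%:R `^ s = M%:R * M%:R `^ (s - 1) :> R by rewrite mulr_powRB1 ?ler0n//; lra.
    by field; rewrite !gt_eqF// powR_gt0.
  have -> : M%:R * kc * (tau * (C * A * M%:R `^ (s - 1))) = kc * tau * C * (M%:R * A * M%:R `^ (s - 1)) by ring.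
  by rewrite e /tau; move: (kc) kc0 => k k0; field; rewrite !gt_eqF.
have t3 : M%:R * kc * (4 / tau * (C * A * l%:R `^ (s - 1))) <= gam / 8.
  apply: le_trans hl0; have := scaled_powR_le s1 (ltW K0) M0 l00; rewrite -/A -/l.
  have p : 0 <= kc * (4 / tau) * C by rewrite ltW// !(mulr_gt0, invr_gt0).
  by move=> /(ler_wpM2l p); congr (_ <= _); ring.
have t4 : M%:R * kc * (4 / tau * (6 * M%:R * A * ((2 * L).+1)%:R `^ s * m'%:R `^ (s - 1) / l%:R)) <= gam / 8.
  apply: le_trans hr0; have := scaled_powR_le s1 (ltW K0) M0 r00; rewrite -/A -/m' => h.
  have hM : M%:R / l%:R <= 2 * l0%:R :> R.
    rewrite ler_pdivrMr// -!natrM ler_nat; apply: (leq_trans (ltnW (ltn_ceil M l00))).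
    by rewrite -/l mulnAC leq_mul2r; move: l1; clear; lia.
  have p : 0 <= kc * (4 / tau) * (6 * ((2 * L).+1)%:R `^ s) by rewrite ltW// !(mulr_gt0, invr_gt0)// powR_gt0.
  have Kr : 0 <= K / r0%:R `^ (s - 1) by rewrite divr_ge0 ?powR_ge0 ?ltW.
  have Ml' : 0 <= M%:R / l%:R :> R by rewrite divr_ge0.
  have MA : 0 <= M%:R * A * m'%:R `^ (s - 1) by exact: mulr_ge0 (mulr_ge0 (ler0n _ _) A0) (powR_ge0 _ _).
  have := ler_wpM2l p (ler_pM MA Ml' h hM).
  by congr (_ <= _); ring.
rewrite [leRHS](_ : gam = gam / 4 + (gam / 4 + (gam / 8 + gam / 8)) + gam / 4); last by field.
rewrite lerD2r; apply: lerD => //; rewrite -/A -/kc.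
rewrite !mulrDr t2 lerD2l; exact: lerD.
Qed.

End radial_bound.

(** * Values on a tree and collisions of children *)

Section tree.
Context {R : realType}.
Variables (V : finType) (par : V -> V) (anc : nat -> V -> V).
Hypotheses (anc0 : forall z, anc 0 z = z) (ancS : forall h z, anc h.+1 z = par (anc h z)).
Variables (M N : nat) (P : {set V}) (phi : V -> 'I_N).

Definition nodes h : {set V} := [set anc h z | z in P].

Definition values h u : {set 'I_N} := [set phi z | z in P & anc h z == u].

(* Cauchy-Schwarz at every node: the children of [u] whose values lie near
   [beta] share the values of [u] with bounded overlap, so that [values] is
   superadditive up to a factor 7 along the fibres of [beta]. *)
Lemma tree_count (beta : nat -> V -> nat) (b : nat -> V -> R) (H : nat) :
  (forall h u, 0 < b h u) ->
  (forall h z, (h < H)%N -> z \in P -> (beta h (anc h z) <= phi z %/ M ^ h + 3)%N /\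
     (phi z %/ M ^ h <= beta h (anc h z) + 3)%N) ->
  (forall h u, (h < H)%N ->
    7 * \sum_(c in nodes h | par c == u) \sum_(c' in nodes h | par c' == u)
      (beta h c == beta h c')%:R <= b h u ^+ 2) ->
  forall h u, (h <= H)%N ->
  (\sum_(z in P | anc h z == u) \prod_(i < h) (b i (anc i.+1 z))^-1) ^+ 2
  <= #|values h u|%:R.
Proof.
move=> b0 hbeta hcoll; elim=> [|h IH] u hH.
  rewrite (eq_bigr (fun=> 1)); last by move=> z _; rewrite big_ord0.
  have [uP|uP] := boolP (u \in P).
    rewrite (bigD1 u) ?anc0 ?uP ?eqxx//= big1; last first.
      by move=> z /andP[/andP[_]]; rewrite anc0 => ->.
    rewrite addr0 expr1n ler1n card_gt0; apply/set0Pn.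
    by exists (phi u); apply/imsetP; exists u => //; rewrite inE uP anc0 eqxx.
  rewrite big1 ?expr0n/= ?ler0n// => z /andP[zP /eqP]; rewrite anc0 => zu.
  by rewrite -zu zP in uP.
pose S c := \sum_(z in P | anc h z == c) \prod_(i < h) (b i (anc i.+1 z))^-1.
have S0 c : 0 <= S c.
  by apply: sumr_ge0 => z _; apply: prodr_ge0 => i _; rewrite invr_ge0 ltW.
pose Q c := (c \in nodes h) && (par c == u).
have -> : \sum_(z in P | anc h.+1 z == u) \prod_(i < h.+1) (b i (anc i.+1 z))^-1
    = (\sum_(c | Q c) S c) / b h u.
  rewrite (partition_big (anc h) Q) /=; last first.
    by move=> z /andP[zP zu]; rewrite /Q imset_f//= -ancS.
  rewrite mulr_suml; apply: eq_bigr => c /andP[_ /eqP cu].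
  rewrite mulr_suml; apply: eq_big => z.
    by rewrite ancS; have [->|_] := eqVneq (anc h z) c; rewrite ?cu ?eqxx ?andbF ?andbT.
  by case/andP=> /andP[_ /eqP zu] _; rewrite big_ord_recr /= zu.
pose B := (\max_c beta h c).+1.
have betaB c : (beta h c < B)%N by rewrite ltnS; exact: (leq_bigmax_cond (F := beta h)).
pose bt c : 'I_B := Ordinal (betaB c).
(* Children in one fibre of [beta] may have the same values, so only the largest of their sets of
   values, of size [gm t], is counted for the [m t] children in the fibre. The sum of the [m t ^ 2]
   is the number of colliding pairs. *)
pose m t : R := \sum_(c | Q c) (bt c == t)%:R.
pose gm t := (\max_(c | Q c && (bt c == t)) #|values h c|)%N.
have sumS : \sum_(c | Q c) S c <= \sum_t m t * Num.sqrt (gm t)%:R.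
  rewrite (partition_big bt predT)//=; apply: ler_sum => t _.
  rewrite /m mulr_suml [leRHS](bigID (fun c => bt c == t)) /=.
  rewrite [X in _ <= _ + X]big1 ?addr0; last first.
    by move=> c /andP[_ /negbTE ->]; rewrite mul0r.
  apply: ler_sum => c /andP[Qc ct]; rewrite ct mul1r -[leLHS]ger0_norm// -sqrtr_sqr.
  apply: ler_wsqrtr; apply: le_trans (IH c (ltnW hH)) _; rewrite ler_nat.
  by apply: (leq_bigmax_cond (F := fun c => #|values h c|)); rewrite Qc.
have summ : \sum_t m t ^+ 2 = \sum_(c | Q c) \sum_(c' | Q c') (beta h c == beta h c')%:R.
  transitivity (\sum_t \sum_(c | Q c) \sum_(c' | Q c') (bt c == t)%:R * (bt c' == t)%:R : R).
    apply: eq_bigr => t _; rewrite expr2 /m mulr_suml; apply: eq_bigr => c _.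
    by rewrite mulr_sumr.
  rewrite exchange_big; apply: eq_bigr => c _ /=.
  rewrite exchange_big; apply: eq_bigr => c' _ /=.
  rewrite (bigD1 (bt c))//= eqxx mul1r big1 ?addr0; last first.
    by move=> t; rewrite eq_sym => /negbTE ->; rewrite mul0r.
  by rewrite eq_sym -val_eqE.
(* A value [v] of [u] can belong to a child in fibre [t] only if [t] is within 3 of [v %/ M ^ h]:
   seven fibres. *)
have sumg : \sum_t (gm t)%:R <= 7 * #|values h.+1 u|%:R :> R.
  apply: (@le_trans _ _ (\sum_(t < B) \sum_(v in values h.+1 u)
     ((v %/ M ^ h)%N%:Z - 3%:Z <= t%:Z < (v %/ M ^ h)%N%:Z - 3%:Z + 7%:Z)%R%:R)).
    apply: ler_sum => t _; rewrite -natr_sum ler_nat.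
    apply/bigmax_leqP => c /andP[/andP[cn /eqP cu] /eqP ct].
    rewrite -sum1_card big_mkcond [leqRHS]big_mkcond; apply: leq_sum => v _.
    case: ifP => // /imsetP[z]; rewrite inE => /andP[zP /eqP zc] ->.
    have -> : phi z \in values h.+1 u.
      by apply/imsetP; exists z => //; rewrite inE zP ancS zc cu eqxx.
    have [h1 h2] := hbeta h z hH zP; rewrite zc in h1 h2.
    have tc : nat_of_ord t = beta h c by rewrite -ct.
    by rewrite lt0b tc; lia.
  rewrite exchange_big mulr_natr -sumr_const; apply: ler_sum => v _ /=.
  by rewrite sum_indicator ler_nat; exact: (card_int_interval _ _ _).1.
rewrite exprMn exprVn ler_pdivrMr ?exprn_gt0//.
have Ss0 : 0 <= \sum_(c | Q c) S c by apply: sumr_ge0.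
apply: (@le_trans _ _ ((\sum_t m t * Num.sqrt (gm t)%:R) ^+ 2)).
  by rewrite ler_sqr ?nnegrE//; apply: le_trans sumS.
apply: le_trans (sum_mul_sqr_le _ _) _; rewrite summ.
under [X in _ * X]eq_bigr => t _ do rewrite sqr_sqrtr ?ler0n//.
have c0 : 0 <= \sum_(c | Q c) \sum_(c' | Q c') (beta h c == beta h c')%:R :> R.
  by apply: sumr_ge0 => c _; apply: sumr_ge0.
apply: le_trans (ler_wpM2l c0 sumg) _.
rewrite mulrCA mulrA mulrC ler_wpM2l//; exact: hcoll.
Qed.

End tree.

(** * Pairs of children that collide along a slope *)

Section slope_collisions.
Context {R : realType}.
Variables (L M T : nat).
Hypotheses (L0 : (0 < L)%N) (M0 : (0 < M)%N).
Let q := M`!.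
Let J := (2 * L * q)%N.
Let q0 : (0 < q)%N. Proof. exact: fact_gt0. Qed.

(** If [v] has slope [j], that is [q v1 + slope j * v2 = 0], the condition reads
    [|d1 v1 + d2 v2| <= T |v2|]: [d] is orthogonal to [v] up to an error [T]. *)
Definition collide (d : int * int) (j : 'I_J.*2.+1) : bool :=
  `|q%:Z * d.2 - slope j * d.1| <= (q * T)%N%:Z.

Definition collision_const : nat := (5 * L * (2 * L + T + 1) * (2 * T + 1))%N.

(** As slopes are at most [2 L] in size, a colliding [d] has norm comparable to [|d.1|], and the
    slope count with step [|d.1|], a divisor of [q], gives [q (2T + 1) / |d.1|]. If [d.1 = 0] then
    [|d.2| <= T] and all slopes are counted. *)
Lemma collide_count (d : int * int) : `|d.1| <= M%:Z ->
  \sum_j (collide d j)%:R <= (collision_const * q)%:R / (maxn 1 (dinf d (0, 0)%R))%:R :> R.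
Proof.
move=> d1M; have [j0 hj0|nj] := pickP (collide d); last first.
  by rewrite big1 ?divr_ge0// => j _; rewrite nj.
have D0 : (0 : R) < (maxn 1 (dinf d (0, 0)%R))%:R by rewrite ltr0n leq_max.
rewrite ler_pdivlMr//.
have near : (`|d.2| <= T + 2 * L * `|d.1|)%N.
  have sj : `|slope j0 * d.1| <= J%:Z * `|d.1|.
    by rewrite normrM ler_wpM2r// slope_bound.
  have : (q * `|d.2| <= q * (T + 2 * L * `|d.1|))%N.
    have e1 : (q * `|d.2|)%N%:Z = `|q%:Z * d.2| by rewrite normrM PoszM; lia.
    have e2 : (q * (T + 2 * L * `|d.1|))%N%:Z = (q * T)%N%:Z + J%:Z * `|d.1|.
      by rewrite /J; nia.
    by rewrite -lez_nat e1 e2; move: hj0 sj; rewrite /collide; clear; lia.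
  by rewrite leq_pmul2l.
have [d10|d10] := eqVneq d.1 0.
  apply: (@le_trans _ _ ((J.*2.+1)%:R * (T + 1)%:R)).
    apply: ler_pM; rewrite ?ler0n ?sumr_ge0//.
      by rewrite sum_indicator ler_nat -[leqRHS]card_ord; exact: max_card.
    by move: near; rewrite ler_nat /dinf !subr0 d10 absz0 muln0 addn0; clear; lia.
  rewrite -natrM ler_nat /collision_const.
  have : (J.*2.+1 <= 5 * L * q)%N by rewrite /J; nia.
  move=> h; apply: leq_trans (leq_mul h (leqnn _)) _.
  rewrite [leqRHS](_ : _ = 5 * L * q * ((2 * L + T + 1) * (2 * T + 1)))%N; last by ring.
  by rewrite leq_mul//; nia.
have /dvdnP[k qk] : (`|d.1| %| q)%N by apply: dvdn_fact; lia.
have cnt : \sum_j (collide d j)%:R <= (k * (2 * T + 1))%:R :> R.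
  have h := @slope_count_le R J d.1 ((q * T)%N%:Z - q%:Z * d.2) (k * (2 * T + 1)) d10.
  apply: le_trans h; apply: ler_sum => j _; rewrite ler_nat.
  have -> : (`|d.1| * (k * (2 * T + 1)))%N = (q * (2 * T + 1))%N by rewrite qk; ring.
  rewrite /collide; set a := slope j * d.1; rewrite [d.1 * _]mulrC -/a.
  set b := q%:Z * d.2; case: (boolP (`|b - a| <= _)) => // h'.
  rewrite (_ : (0 <= _ < _) = true)//.
  have -> : (q * (2 * T + 1))%N = (2 * (q * T) + q)%N by ring.
  by move: h' q0; clear; lia.
apply: le_trans (ler_wpM2r (ltW D0) cnt) _.
rewrite -natrM ler_nat.
have Dd : (maxn 1 (dinf d (0, 0)%R) <= (2 * L + T + 1) * `|d.1|)%N.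
  have h1 : (T <= T * `|d.1|)%N by rewrite leq_pmulr//; lia.
  by rewrite /dinf !subr0 !mulnDl; move: near h1 d10; clear; lia.
apply: leq_trans (leq_mul (leqnn _) Dd) _.
rewrite [leqLHS](_ : _ = (2 * L + T + 1) * (2 * T + 1) * q)%N; last by rewrite qk; ring.
rewrite /collision_const leq_mul// leq_mul// leq_pmull// muln_gt0.
by rewrite L0.
Qed.

(** After exchanging the sums each pair costs [q / |u - v|]. For each [v] the energy bounds this by
    [M^(s-1)], and there are at most [K M^s] points [v]. As there are about [4 L q] slopes, a
    typical one has [M^(2s-1)] collisions up to a constant. *)
Lemma slope_collisions (V : finType) (pos : V -> int * int) (D : pred V) (s K C : R) :
  1 < s -> 0 <= K -> 0 <= C ->
  (forall c m, (0 < m)%N -> \sum_(u | (dinf (pos u) c <= m)%N) (D u)%:R <= K * m%:R `^ s) ->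
  (forall c, \sum_(u | (dinf (pos u) c <= M)%N) (D u)%:R / (maxn 1 (dinf (pos u) c))%:R
    <= C * K * M%:R `^ (s - 1)) ->
  (forall u v, D u -> D v -> (dinf (pos u) (pos v) <= M)%N) ->
  \sum_j \sum_(u | D u) \sum_(v | D v) (collide ((pos u).1 - (pos v).1, (pos u).2 - (pos v).2) j)%:R
  <= collision_const%:R * C * K ^+ 2 * M%:R `^ (2 * s - 1) * q%:R.
Proof.
move=> s1 K0 C0 fr en diam.
have MR : (0 : R) < M%:R by rewrite ltr0n.
have pair (u v : V) : dinf ((pos u).1 - (pos v).1, (pos u).2 - (pos v).2) (0, 0) = dinf (pos u) (pos v).
  by rewrite /dinf /= !subr0.
have cardD : \sum_(v | D v) 1 <= K * M%:R `^ s.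
  have [v0 Dv0|nD] := pickP D; last first.
    by rewrite big_pred0 ?mulr_ge0 ?powR_ge0.
  apply: le_trans (fr (pos v0) M M0); rewrite big_mkcond [leRHS]big_mkcond.
  apply: ler_sum => v _; case: (boolP (D v)) => Dv /=; last by case: ifP.
  by rewrite diam.
apply: (@le_trans _ _ (\sum_(v | D v) (collision_const * q)%:R * (C * K * M%:R `^ (s - 1)))).
  rewrite exchange_big; under eq_bigr => u _ do rewrite exchange_big /=.
  rewrite exchange_big; apply: ler_sum => v Dv /=.
  apply: le_trans (ler_wpM2l (ler0n _ _) (en (pos v))).
  rewrite mulr_sumr big_mkcond [leRHS]big_mkcond; apply: ler_sum => u _.
  case: (boolP (D u)) => Du; last by case: ifP => //; rewrite mul0r mulr0.
  rewrite diam// mul1r; apply: le_trans (collide_count _) _.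
    by have := diam _ _ Du Dv; rewrite /dinf /=; lia.
  by rewrite pair.
rewrite -[X in \sum_(_ | _) X]mulr1 -mulr_sumr.
have X0 : 0 <= (collision_const * q)%:R * (C * K * M%:R `^ (s - 1)).
  by rewrite !mulr_ge0 ?powR_ge0.
apply: le_trans (ler_wpM2l X0 cardD) _.
have -> : M%:R `^ (2 * s - 1) = M%:R `^ (s - 1) * M%:R `^ s :> R.
  rewrite -powRD; first by congr (_ `^ _); ring.
  by apply/implyP => _; rewrite gt_eqF.
by rewrite natrM le_eqVlt; apply/orP; left; apply/eqP; ring.
Qed.

(** Replacing [v] by the exact direction of slope [j] adds at most [q M] to the [10 q M] of the
    scalar product; division by [|v.2| >= M / L] gives [11 L q]. *)
Lemma collide_of_normal (d v : int * int) (j : 'I_J.*2.+1) : (T = 11 * L)%N ->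
  `|d.1| <= M%:Z -> `|d.1 * v.1 + d.2 * v.2| <= (10 * M)%N%:Z ->
  0 <= q%:Z * v.1 + slope j * v.2 < q%:Z -> (M <= L * `|v.2|)%N -> collide d j.
Proof.
move=> TE d1 dv qv v2L; rewrite /collide.
have v20 : 0 < `|v.2| by move: v2L M0; clear; nia.
rewrite -(ler_pM2l v20) -normrM.
have -> : v.2 * (q%:Z * d.2 - slope j * d.1) =
  q%:Z * (d.1 * v.1 + d.2 * v.2) - d.1 * (q%:Z * v.1 + slope j * v.2) by ring.
apply: le_trans (ler_normB _ _) _.
have h1 : `|q%:Z * (d.1 * v.1 + d.2 * v.2)| <= q%:Z * (10 * M)%N%:Z.
  by rewrite normrM ler_wpM2l.
have h2 : `|d.1 * (q%:Z * v.1 + slope j * v.2)| <= M%:Z * q%:Z.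
  by rewrite normrM ler_pM//; case/andP: qv => h3 h4; rewrite ger0_norm// ltW.
apply: le_trans (lerD h1 h2) _.
have -> : q%:Z * (10 * M)%N%:Z + M%:Z * q%:Z = (11 * q)%N%:Z * M%:Z by rewrite !PoszM; ring.
have -> : `|v.2| * (q * T)%N%:Z = (11 * q)%N%:Z * (L * `|v.2|)%N%:Z.
  by rewrite TE !PoszM abszE; ring.
by rewrite ler_wpM2l.
Qed.

End slope_collisions.

(** * Distances from a pin, linearized *)

Section geometry.
Context {R : realType}.
Implicit Types a l m : R.

Definition planar_dist (x1 x2 z1 z2 : R) : R :=
  Num.sqrt ((x1 - z1) ^+ 2 + (x2 - z2) ^+ 2).

Lemma planar_dist_ge0 x1 x2 z1 z2 : 0 <= planar_dist x1 x2 z1 z2.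
Proof. exact: sqrtr_ge0. Qed.

Lemma planar_dist_sqr x1 x2 z1 z2 :
  planar_dist x1 x2 z1 z2 ^+ 2 = (x1 - z1) ^+ 2 + (x2 - z2) ^+ 2.
Proof. by rewrite sqr_sqrtr// addr_ge0// sqr_ge0. Qed.

Lemma planar_dist_ge1 x1 x2 z1 z2 : `|x1 - z1| <= planar_dist x1 x2 z1 z2.
Proof. by rewrite -sqrtr_sqr ler_wsqrtr// lerDl sqr_ge0. Qed.

Lemma planar_dist_ge2 x1 x2 z1 z2 : `|x2 - z2| <= planar_dist x1 x2 z1 z2.
Proof. by rewrite -sqrtr_sqr ler_wsqrtr// lerDr sqr_ge0. Qed.

Lemma planar_dist_le x1 x2 z1 z2 a : `|x1 - z1| <= a -> `|x2 - z2| <= a ->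
  planar_dist x1 x2 z1 z2 <= 2 * a.
Proof.
move=> h1 h2; have a0 : 0 <= a by apply: le_trans h1.
have n1 := normr_ge0 (x1 - z1); have n2 := normr_ge0 (x2 - z2).
have q1 : (x1 - z1) ^+ 2 <= a ^+ 2 by rewrite -real_normK ?num_real// ler_sqr ?nnegrE.
have q2 : (x2 - z2) ^+ 2 <= a ^+ 2 by rewrite -real_normK ?num_real// ler_sqr ?nnegrE.
rewrite -[leRHS]ger0_norm ?mulr_ge0// -sqrtr_sqr ler_wsqrtr// exprMn.
have a2 : 0 <= a ^+ 2 by rewrite sqr_ge0.
by lra.
Qed.

(** A difference of squares. It replaces angles by a bilinear form: the first factors are the
    displacement of the two points, the second ones twice the vector from the pin to their
    midpoint. *)
Lemma planar_dist_sub x1 x2 z1 z2 y1 y2 :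
  (planar_dist x1 x2 z1 z2 - planar_dist x1 x2 y1 y2)
    * (planar_dist x1 x2 z1 z2 + planar_dist x1 x2 y1 y2) =
  (z1 - y1) * (z1 + y1 - 2 * x1) + (z2 - y2) * (z2 + y2 - 2 * x2).
Proof. by rewrite -subr_sqr !planar_dist_sqr; ring. Qed.

Lemma planar_dist_lipschitz x1 x2 z1 z2 y1 y2 a : 0 <= a ->
  `|z1 - y1| <= a -> `|z2 - y2| <= a ->
  `|planar_dist x1 x2 z1 z2 - planar_dist x1 x2 y1 y2| <= 2 * a.
Proof.
move=> a0 h1 h2; have E := planar_dist_sub x1 x2 z1 z2 y1 y2.
have D1 := planar_dist_ge0 x1 x2 z1 z2; have D2 := planar_dist_ge0 x1 x2 y1 y2.
have b1 := planar_dist_ge1 x1 x2 z1 z2; have b2 := planar_dist_ge2 x1 x2 z1 z2.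
have b3 := planar_dist_ge1 x1 x2 y1 y2; have b4 := planar_dist_ge2 x1 x2 y1 y2.
move: E D1 D2 b1 b2 b3 b4; set f := planar_dist _ _ z1 _; set g := planar_dist _ _ y1 _.
move=> E D1 D2 b1 b2 b3 b4.
have [fg0|fg0] := eqVneq (f + g) 0.
  have -> : f = 0 by lra.
  have -> : g = 0 by lra.
  by rewrite subr0 normr0 mulr_ge0.
have fgp : 0 < f + g by rewrite lt_neqAle eq_sym fg0 addr_ge0.
rewrite -(ler_pM2r fgp) -{1}(ger0_norm (ltW fgp)) -normrM E.
apply: le_trans (ler_normD _ _) _; rewrite !normrM.
have n1 : `|z1 + y1 - 2 * x1| <= f + g.
  have -> : z1 + y1 - 2 * x1 = - ((x1 - z1) + (x1 - y1)) by ring.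
  by rewrite normrN; apply: le_trans (ler_normD _ _) _; apply: lerD.
have n2 : `|z2 + y2 - 2 * x2| <= f + g.
  have -> : z2 + y2 - 2 * x2 = - ((x2 - z2) + (x2 - y2)) by ring.
  by rewrite normrN; apply: le_trans (ler_normD _ _) _; apply: lerD.
have -> : 2 * a * (f + g) = a * (f + g) + a * (f + g) by ring.
by apply: lerD; apply: ler_pM.
Qed.

Lemma product_perturbation a l m d v zeta eta : 0 <= a -> 0 <= l ->
  `|d| <= m -> `|v| <= m -> `|zeta - a * d| <= a -> `|eta + 2 * l * v| <= 2 * l ->
  `|zeta * eta + 2 * a * l * (d * v)| <= 2 * a * l * (2 * m + 1).
Proof.
move=> a0 l0 dm vm hz he.
set r := zeta - a * d; set t := eta + 2 * l * v.
have -> : zeta * eta + 2 * a * l * (d * v) = a * (d * t) - 2 * l * (v * r) + r * t.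
  by rewrite /r /t; ring.
have m0 : 0 <= m by apply: le_trans dm.
apply: le_trans (ler_normD _ _) _; apply: le_trans (lerD (ler_normB _ _) (lexx _)) _.
have h1 : `|a * (d * t)| <= a * (m * (2 * l)).
  by rewrite normrM ger0_norm// ler_wpM2l// normrM ler_pM.
have h2 : `|2 * l * (v * r)| <= 2 * l * (m * a).
  by rewrite normrM ger0_norm ?mulr_ge0// ler_wpM2l ?mulr_ge0// normrM ler_pM.
have h3 : `|r * t| <= a * (2 * l) by rewrite normrM ler_pM.
apply: le_trans (lerD (lerD h1 h2) h3) _.
by rewrite le_eqVlt; apply/orP; left; apply/eqP; ring.
Qed.

(* The equation [dist x z = dist x y] linearizes to [z - y] being orthogonal to
   the direction [v] of [x], at the resolution of the grid cells. *)
Lemma equidistant_normal (a l : R) (M : nat) (x1 x2 z1 z2 y1 y2 : R)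
    (d v : int * int) : 0 < a -> 0 < l -> (0 < M)%N ->
  `|d.1| <= M%:Z -> `|d.2| <= M%:Z -> `|v.1| <= M%:Z -> `|v.2| <= M%:Z ->
  `|z1 - y1 - a * d.1%:~R| <= a -> `|z2 - y2 - a * d.2%:~R| <= a ->
  `|z1 - x1 + l * v.1%:~R| <= l -> `|z2 - x2 + l * v.2%:~R| <= l ->
  `|y1 - x1 + l * v.1%:~R| <= l -> `|y2 - x2 + l * v.2%:~R| <= l ->
  `|x1 - z1| <= M%:R * l -> `|x2 - z2| <= M%:R * l ->
  `|x1 - y1| <= M%:R * l -> `|x2 - y2| <= M%:R * l ->
  `|planar_dist x1 x2 z1 z2 - planar_dist x1 x2 y1 y2| <= 2 * a ->
  `|d.1 * v.1 + d.2 * v.2| <= (10 * M)%N%:Z.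
Proof.
move=> a0 l0 M0 d1 d2 v1 v2 zy1 zy2 zx1 zx2 yx1 yx2 xz1 xz2 xy1 xy2 fg.
have MR : (1 : R) <= M%:R by rewrite ler1n.
have toR (k : int) : `|k| <= M%:Z -> `|k%:~R| <= M%:R :> R.
  by move=> kM; rewrite -intr_norm -[M%:R]/(M%:Z%:~R) ler_int.
have sum2 (p r w : R) : `|p + w| <= l -> `|r + w| <= l -> `|p + r + 2 * w| <= 2 * l.
  move=> h1 h2; have -> : p + r + 2 * w = (p + w) + (r + w) by ring.
  by apply: le_trans (ler_normD _ _) _; lra.
have e1 : `|z1 + y1 - 2 * x1 + 2 * l * v.1%:~R| <= 2 * l.
  have := sum2 _ _ _ zx1 yx1; congr (`|_| <= _); ring.
have e2 : `|z2 + y2 - 2 * x2 + 2 * l * v.2%:~R| <= 2 * l.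
  have := sum2 _ _ _ zx2 yx2; congr (`|_| <= _); ring.
have p1 := product_perturbation (ltW a0) (ltW l0) (toR _ d1) (toR _ v1) zy1 e1.
have p2 := product_perturbation (ltW a0) (ltW l0) (toR _ d2) (toR _ v2) zy2 e2.
have E := planar_dist_sub x1 x2 z1 z2 y1 y2.
have f0 : planar_dist x1 x2 z1 z2 + planar_dist x1 x2 y1 y2 <= 4 * (M%:R * l).
  by move: (planar_dist_le xz1 xz2) (planar_dist_le xy1 xy2); clear; lra.
have g0 : 0 <= planar_dist x1 x2 z1 z2 + planar_dist x1 x2 y1 y2.
  by rewrite addr_ge0 ?planar_dist_ge0.
have E2 : `|(z1 - y1) * (z1 + y1 - 2 * x1) + (z2 - y2) * (z2 + y2 - 2 * x2)|
    <= 2 * a * (4 * (M%:R * l)).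
  by rewrite -E normrM ler_pM// ger0_norm.
move: p1 p2 E2; set P1 := (z1 - y1) * _; set P2 := (z2 - y2) * _ => p1 p2 E2.
have al : 0 < 2 * a * l by rewrite !mulr_gt0.
(* Each of the two products contributes [2 M + 1] to the error; the distances, at most [2 a] apart
   and of sum at most [4 M l], contribute [4 M]. The total [8 M + 2] is at most [10 M]. *)
have fin : `|2 * a * l * (d.1%:~R * v.1%:~R + d.2%:~R * v.2%:~R)|
    <= 2 * a * l * (8 * M%:R + 2).
  have -> : 2 * a * l * (d.1%:~R * v.1%:~R + d.2%:~R * v.2%:~R) =
    (P1 + 2 * a * l * (d.1%:~R * v.1%:~R)) + (P2 + 2 * a * l * (d.2%:~R * v.2%:~R))
     - (P1 + P2) by ring.
  apply: le_trans (ler_normB _ _) _; apply: le_trans (lerD (ler_normD _ _) (lexx _)) _.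
  apply: le_trans (lerD (lerD p1 p2) E2) _.
  by rewrite le_eqVlt; apply/orP; left; apply/eqP; ring.
rewrite normrM ger0_norm ?(ltW al)// ler_pM2l// in fin.
rewrite -(ler_int R) intr_norm rmorphD !rmorphM /=.
apply: le_trans fin _; rewrite -[(10 * M)%N%:Z%:~R]/((10 * M)%N%:R) natrM; move: MR; clear; lra.
Qed.

End geometry.

(** * Grid cells and distances from a pin *)

Lemma same_quotient (M a b : nat) : (0 < M)%N -> (a %/ M = b %/ M)%N ->
  `|a%:Z - b%:Z| < M%:Z.
Proof.
move=> M0 ab; rewrite {1}(divn_eq a M) {1}(divn_eq b M) ab.
have := ltn_pmod a M0; have := ltn_pmod b M0.
by move: (a %% M)%N (b %% M)%N (b %/ M * M)%N; clear; lia.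
Qed.

Section cells.
Variables (M n : nat).
Hypothesis M0 : (0 < M)%N.

(* Cells of all heights [h] of the [M]-adic grid of the square [0, M^n)^2 are
   represented in the same finite type, by their indices. *)
Definition cell : finType := ('I_(M ^ n) * 'I_(M ^ n))%type.

Definition ord_div k (i : 'I_(M ^ n)) : 'I_(M ^ n) :=
  Ordinal (leq_ltn_trans (leq_div i k) (ltn_ord i)).

Definition ancestor h (z : cell) : cell := (ord_div (M ^ h) z.1, ord_div (M ^ h) z.2).

Definition parent (z : cell) : cell := (ord_div M z.1, ord_div M z.2).

Definition cell_pos (z : cell) : int * int := ((z.1 : nat)%:Z, (z.2 : nat)%:Z).

Lemma ancestor0 z : ancestor 0 z = z.
Proof. by case: z => i j; congr (_, _); apply: val_inj; rewrite /= divn1. Qed.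

Lemma ancestorD k h z : ancestor (h + k) z = ancestor k (ancestor h z).
Proof. by congr (_, _); apply: val_inj; rewrite /= expnD divnMA. Qed.

Lemma ancestorS h z : ancestor h.+1 z = parent (ancestor h z).
Proof. by congr (_, _); apply: val_inj; rewrite /= expnSr divnMA. Qed.

Lemma ancestor_top z z' : ancestor n z = ancestor n z'.
Proof. by congr (_, _); apply: val_inj; rewrite /= !divn_small. Qed.

Lemma ancestor_near h (z u : cell) : ancestor h z = u ->
  (dinf (cell_pos z) ((u.1 * M ^ h)%N%:Z, (u.2 * M ^ h)%N%:Z) < M ^ h)%N.
Proof.
move=> <-; have Mh : (0 < M ^ h)%N by rewrite expn_gt0 M0.
rewrite /dinf /= {1}(divn_eq z.1 (M ^ h)) {1}(divn_eq z.2 (M ^ h)).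
have := ltn_pmod z.1 Mh; have := ltn_pmod z.2 Mh.
move: (z.1 %% M ^ h)%N (z.2 %% M ^ h)%N (z.1 %/ M ^ h * M ^ h)%N (z.2 %/ M ^ h * M ^ h)%N.
by clear; lia.
Qed.

Lemma parent_near (u v : cell) : parent u = parent v ->
  `|(cell_pos u).1 - (cell_pos v).1| < M%:Z /\ `|(cell_pos u).2 - (cell_pos v).2| < M%:Z.
Proof.
by case=> h1 h2; split; exact: same_quotient.
Qed.

Context {R : realType}.
Variables (P : {set cell}) (s K : R).

Definition leaves h (u : cell) : nat := #|[set z in P | ancestor h z == u]|.

Local Notation node := (nodes ancestor P).

Hypothesis frost : forall h c m, (h <= n)%N -> (0 < m)%N ->
  #|[set u in node h | (dinf (cell_pos u) c <= m)%N]|%:R <= K * m%:R `^ s.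

Lemma leaves_le h u : (h <= n)%N -> (leaves h u)%:R <= K * (M ^ h)%N%:R `^ s.
Proof.
move=> hn; apply: le_trans (frost ((u.1 * M ^ h)%N%:Z, (u.2 * M ^ h)%N%:Z) (leq0n n) _);
  last by rewrite expn_gt0 M0.
rewrite ler_nat; apply: subset_leq_card; apply/fintype.subsetP => z.
rewrite !inE => /andP[zP /eqP zu]; rewrite ltnW ?ancestor_near// andbT.
by apply/imsetP; exists z => //; rewrite ancestor0.
Qed.

Lemma leaves_parent h u : leaves h.+1 u = (\sum_(c | parent c == u) leaves h c)%N.
Proof.
rewrite /leaves -sum1_card (partition_big (ancestor h) (fun c => parent c == u)) /=.
  apply: eq_bigr => c /eqP cu; rewrite -sum1_card; apply: eq_bigl => z.
  rewrite !inE ancestorS; case: (z \in P) => //=.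
  by have [->|_] := eqVneq (ancestor h z) c; rewrite ?cu ?eqxx ?andbF.
by move=> z; rewrite inE ancestorS => /andP[].
Qed.

(** Descend from the root, moving to a child as long as one holds more than [2 M^-s] of the leaves
    of the current node. Each move doubles the number of leaves relative to the [s]-th power of the
    side, a ratio that [leaves_le] bounds by [K]; so fewer than [J] moves are possible. *)
Lemma rich_node J : (J <= n)%N -> K * (M ^ n)%N%:R `^ s < 2 ^+ J * #|P|%:R ->
  exists h i u, [/\ (h.+1 + i = n)%N, (i < J)%N, (0 < leaves h.+1 u)%N,
    #|P|%:R <= (M ^ i)%N%:R `^ s * (leaves h.+1 u)%:R &
    forall c, parent c = u -> M%:R `^ s * (leaves h c)%:R <= 2 * (leaves h.+1 u)%:R].
Proof.
move=> Jn big.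
have P0 : (0 < #|P|)%N.
  rewrite lt0n; apply/negP => /eqP P0; move: big; rewrite P0 mulr0 ltNge => /negP; apply.
  have Mn : (0 < M ^ n)%N by rewrite expn_gt0 M0.
  exact: le_trans (ler0n _ _) (frost (0%R, 0%R) (leq0n n) Mn).
have /card_gt0P[z0 z0P] := P0.
have good j : (j <= J)%N ->
  (exists h i u, [/\ (h.+1 + i = n)%N, (i < J)%N, (0 < leaves h.+1 u)%N,
    #|P|%:R <= (M ^ i)%N%:R `^ s * (leaves h.+1 u)%:R &
    forall c, parent c = u -> M%:R `^ s * (leaves h c)%:R <= 2 * (leaves h.+1 u)%:R]) \/
  exists u, 2 ^+ j * #|P|%:R <= (M ^ j)%N%:R `^ s * (leaves (n - j) u)%:R.
  elim: j => [_|j IH jJ].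
    right; exists (ancestor n z0); rewrite expr0 expn0 powR1 !mul1r subn0 ler_nat.
    apply: subset_leq_card; apply/fintype.subsetP => z zP.
    by rewrite inE zP; apply/eqP/ancestor_top.
  case: (IH (ltnW jJ)) => [?|[u hu]]; first by left.
  have jn : (j < n)%N by apply: leq_trans Jn.
  have hj : (n - j = (n - j.+1).+1)%N by rewrite -subSn ?subSS.
  rewrite hj in hu.
  have [/forallP h|] := boolP [forall c, (parent c == u) ==>
     (M%:R `^ s * (leaves (n - j.+1) c)%:R <= 2 * (leaves (n - j.+1).+1 u)%:R)].
    have hu1 : #|P|%:R <= (M ^ j)%N%:R `^ s * (leaves (n - j.+1).+1 u)%:R.
      by apply: le_trans hu; rewrite ler_peMl// exprn_ege1// ler1n.
    left; exists (n - j.+1)%N, j, u; split => //.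
    - by rewrite -hj subnK// ltnW.
    - rewrite lt0n; apply/negP => /eqP l0; move: hu1; rewrite l0 mulr0.
      by rewrite lern0 -leqn0 leqNgt P0.
    - by move=> c cu; have := h c; rewrite cu eqxx.
  rewrite negb_forall => /existsP[c]; rewrite negb_imply -ltNge => /andP[_ hc].
  right; exists c; rewrite exprS expnS natrM powRM ?ler0n// -mulrA.
  have h2 : 2 * (2 ^+ j * #|P|%:R) <= 2 * ((M ^ j)%N%:R `^ s * (leaves (n - j.+1).+1 u)%:R).
    by rewrite ler_wpM2l.
  apply: le_trans h2 _; set X := (M ^ j)%N%:R `^ s.
  rewrite [leLHS](_ : _ = X * (2 * (leaves (n - j.+1).+1 u)%:R)); last by ring.
  rewrite [leRHS](_ : _ = X * (M%:R `^ s * (leaves (n - j.+1) c)%:R)); last by ring.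
  by rewrite ler_wpM2l ?powR_ge0// ltW.
case: (good J (leqnn J)) => // -[u hu].
have h1 := lt_le_trans big hu.
have : (M ^ J)%N%:R `^ s * (leaves (n - J) u)%:R <= K * (M ^ n)%N%:R `^ s.
  have e : (M ^ n)%N%:R `^ s = (M ^ J)%N%:R `^ s * (M ^ (n - J))%N%:R `^ s :> R.
    by rewrite -powRM ?ler0n// -natrM -expnD subnKC.
  rewrite e mulrCA ler_wpM2l ?powR_ge0//; exact: leaves_le (leq_subr _ _).
by move=> h2; move: (lt_le_trans h1 h2); rewrite ltxx.
Qed.

End cells.

Lemma exists_le_average (R : realDomainType) (I : finType) (w f : I -> R) c :
  (forall i, 0 <= w i) -> \sum_i w i = 1 -> \sum_i w i * f i <= c ->
  exists2 i, 0 < w i & f i <= c.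
Proof.
move=> w0 w1 h; have [/existsP[i /andP[wi fi]]|] := boolP [exists i, (0 < w i) && (f i <= c)].
  by exists i.
rewrite negb_exists => /forallP no; move: h; rewrite leNgt => /negP[].
rewrite -[X in X < _]mul1r -w1 mulr_suml.
have [i wi] : exists i, 0 < w i.
  have [/existsP//|] := boolP [exists i, 0 < w i]; rewrite negb_exists => /forallP no'.
  move: w1; rewrite big1 => [/eqP|i _]; first by rewrite eq_sym oner_eq0.
  by apply/eqP; rewrite eq_le w0 leNgt no'.
rewrite [ltLHS](bigD1 i)// [ltRHS](bigD1 i)//=; apply: ltr_leD.
  by have := no i; rewrite wi /= -ltNge => fi; rewrite ltr_pM2l.
apply: ler_sum => j _; have := no j; rewrite negb_and -!leNgt => /orP[wj|].
  have -> : w j = 0 by apply/eqP; rewrite eq_le w0 wj.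
  by rewrite !mul0r.
by rewrite -ltNge => /ltW fj; rewrite ler_wpM2l.
Qed.

(** For empty [D] the quotient is 0, since [0^-1 = 0]; hence [0 <= c]. *)
Lemma average_le (R : realFieldType) (I : finType) (D : pred I) (f : I -> R) c :
  0 <= c -> (forall i, D i -> f i <= c) -> (\sum_(i | D i) f i) / #|D|%:R <= c.
Proof.
move=> c0 fc; have [D0|D0] := posnP #|D|; first by rewrite D0 invr0 mulr0.
rewrite ler_pdivrMr ?ltr0n// mulr_natr -sumr_const; exact: ler_sum.
Qed.

(** * Choice of the pin *)

Section pin.
Variables (M n : nat).
Hypothesis M0 : (0 < M)%N.
Context {R : realType}.
Variables (P : {set cell M n}) (s K C : R).
Hypotheses (s1 : 1 < s) (K0 : 0 < K) (C0 : 0 <= C).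
Local Notation cell := (cell M n).
Local Notation node := (nodes (@ancestor M n) P).
Local Notation anc := (@ancestor M n).
Hypothesis frost : forall h c m, (h <= n)%N -> (0 < m)%N ->
  #|[set u in node h | (dinf (cell_pos u) c <= m)%N]|%:R <= K * m%:R `^ s.
Hypothesis energy : forall (w : cell -> R) (d : cell -> nat) A,
  (forall i, 0 <= w i) ->
  (forall m, (0 < m)%N -> \sum_(i | (d i <= m)%N) w i <= A * m%:R `^ s) ->
  forall m, (0 < m)%N ->
  \sum_(i | (d i <= m)%N) w i / (maxn 1 (d i))%:R <= C * A * m%:R `^ (s - 1).

Definition child h (u c : cell) : bool := (c \in node h) && (parent c == u).

Definition displacement (c c' : cell) : int * int :=
  ((cell_pos c).1 - (cell_pos c').1, (cell_pos c).2 - (cell_pos c').2).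

(** Ordered pairs, the diagonal included, as in the hypothesis of [tree_count]. The threshold [10 M]
    is that of [equidistant_normal]. *)
Definition normal_collisions h (u : cell) (v : int * int) : R :=
  \sum_(c | child h u c) \sum_(c' | child h u c')
   (`|(displacement c c').1 * v.1 + (displacement c c').2 * v.2| <= (10 * M)%N%:Z)%R%:R.

Lemma children_frostman h u : (h <= n)%N ->
  frostman (@cell_pos M n) (fun x => (child h u x)%:R) s K.
Proof.
move=> hn c m m0; apply: le_trans (frost c hn m0).
rewrite -sum1_card natr_sum big_mkcond [leRHS]big_mkcond; apply: ler_sum => x _.
rewrite inE /child; case: (x \in node h) => /=; last by case: ifP.
by case: ifP => // _; case: (_ == _).
Qed.

Lemma child_near h u c c' : child h u c -> child h u c' ->
  `|(displacement c c').1| < M%:Z /\ `|(displacement c c').2| < M%:Z.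
Proof.
by move=> /andP[_ /eqP h1] /andP[_ /eqP h2]; apply: (parent_near M0); rewrite h1.
Qed.

Variables (L : nat) (b gam : R).
Hypotheses (L0 : (0 < L)%N).
Let J := (2 * L * M`!)%N.

Definition slope_collisions_at h (u : cell) (j : 'I_J.*2.+1) : R :=
  \sum_(c | child h u c) \sum_(c' | child h u c')
   (@collide L M (11 * L) (displacement c c') j)%:R.

Lemma sum_slope_collisions h u : (h <= n)%N ->
  \sum_j slope_collisions_at h u j <=
  (collision_const L (11 * L))%:R * C * K ^+ 2 * M%:R `^ (2 * s - 1) * (M`!)%:R.
Proof.
move=> hn; have fr := children_frostman u hn.
apply: slope_collisions => //; first exact: ltW.
  by move=> c; apply: energy => // m m0; exact: fr.
move=> x y hx hy; have := child_near hx hy; rewrite /displacement /dinf /=; clear; lia.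
Qed.

Lemma normal_le_slope h u v j :
  0 <= (M`!)%:Z * v.1 + slope j * v.2 < (M`!)%:Z -> (M <= L * `|v.2|)%N ->
  normal_collisions h u v <= slope_collisions_at h u j.
Proof.
move=> qv v2; apply: ler_sum => c hc; apply: ler_sum => c' hc'.
rewrite ler_nat; case: (boolP (`|_| <= _)) => // h1.
rewrite (collide_of_normal M0 erefl _ h1 qv v2)//.
by have [h2 _] := child_near hc hc'; exact: ltW.
Qed.

Hypothesis radial : forall (pos : cell -> int * int) (w : cell -> R)
    (G : cell -> 'I_J.*2.+1 -> R) (E : cell -> cell -> R),
  (forall i, 0 <= w i) -> \sum_i w i = 1 ->
  (forall i, 0 <= (pos i).1 < M%:Z) -> (forall i, 0 <= (pos i).2 < M%:Z) ->
  frostman pos w s (2 * K / M%:R `^ s) ->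
  (forall i j, 0 <= G i j <= 1) -> (forall y, \sum_j G y j <= b * (M`!)%:R) ->
  (forall x y, (M <= L * `|(pos x).2 - (pos y).2|)%N ->
    forall j, 0 <= (M`!)%:Z * ((pos x).1 - (pos y).1)
       + slope j * ((pos x).2 - (pos y).2) < (M`!)%:Z -> E x y <= G y j) ->
  \sum_y \sum_x w x * w y *
    (if (M <= L * `|(pos x).2 - (pos y).2|)%N then E x y else 1) <= gam.

Variables (thr : R) (h0 : nat) (u0 : cell).
Hypotheses (b0 : 0 <= b) (thr0 : 0 < thr) (h00 : (0 < h0)%N) (h0n : (h0 < n)%N).
Hypothesis few : (collision_const L (11 * L))%:R * C * K ^+ 2 * M%:R `^ (2 * s - 1) <= b * thr.
Hypothesis leaves0 : (0 < leaves P h0.+1 u0)%N.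
Hypothesis spread : forall c, parent c = u0 ->
  M%:R `^ s * (leaves P h0 c)%:R <= 2 * (leaves P h0.+1 u0)%:R.

(* Seen from the cell [x] of the pin, [z] lies in an almost horizontal direction,
   or too many pairs of children of its ancestor at height [h.+1] are at nearly
   the same distance. *)
Definition bad h (x z : cell) : bool :=
  ~~ (M <= L * `|(displacement x (anc h0 z)).2|)%N ||
  (thr <= normal_collisions h (anc h.+1 z) (displacement x (anc h0 z))).

(** Residues modulo [M] put the children of [u0] in the square [[0, M)^2] of the radial estimate.
    The weight [w] of a child is its share of the leaves under [u0]; by [spread] it is at most
    [2 / M^s], so the children inherit a Frostman bound with constant [2 K / M^s]. *)
Let rel_pos (x : cell) : int * int := ((x.1 %% M)%N%:Z, (x.2 %% M)%N%:Z).
Let w (x : cell) : R := (parent x == u0)%:R * (leaves P h0 x)%:R / (leaves P h0.+1 u0)%:R.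
Let under y (z : cell) : bool := (z \in P) && (anc h0 z == y).

Let rel_posE x y : parent x = parent y ->
  ((rel_pos x).1 - (rel_pos y).1, (rel_pos x).2 - (rel_pos y).2) = displacement x y.
Proof.
move=> xy; have /(congr1 (fun u : cell => u.1 : nat)) /= h1 := xy.
have /(congr1 (fun u : cell => u.2 : nat)) /= h2 := xy.
rewrite /displacement /cell_pos /= (divn_eq x.1 M) (divn_eq x.2 M) (divn_eq y.1 M) (divn_eq y.2 M) h1 h2.
by rewrite !modnMDl !modn_mod !PoszD; congr (_, _); ring.
Qed.

Let leavesR : (0 : R) < (leaves P h0.+1 u0)%:R. Proof. by rewrite ltr0n. Qed.
Let w0 x : 0 <= w x. Proof. by rewrite divr_ge0 ?mulr_ge0. Qed.

Let w1 : \sum_x w x = 1.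
Proof.
rewrite -mulr_suml; have -> : \sum_x (parent x == u0)%:R * (leaves P h0 x)%:R = (leaves P h0.+1 u0)%:R :> R.
  rewrite leaves_parent natr_sum [RHS]big_mkcond; apply: eq_bigr => x _.
  by case: (_ == _); rewrite ?mul1r ?mul0r.
by rewrite divff// gt_eqF.
Qed.

Let w_frost : frostman rel_pos w s (2 * K / M%:R `^ s).
Proof.
move=> c m m0.
have Ms : 0 < M%:R `^ s :> R by apply: powR_gt0; rewrite ltr0n.
have fr := children_frostman u0 (ltnW h0n).
apply: le_trans (_ : (2 / M%:R `^ s) *
   \sum_(i | (dinf (cell_pos i) (c.1 + (u0.1 * M)%N%:Z, c.2 + (u0.2 * M)%N%:Z)%R <= m)%N) (child h0 u0 i)%:R <= _).
  rewrite mulr_sumr big_mkcond [leRHS]big_mkcond; apply: ler_sum => x _.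
  have [xu|xu] := eqVneq (parent x) u0; last first.
    by rewrite /w (negbTE xu) !mul0r /child (negbTE xu) andbF mulr0; do 2 case: ifP.
  have -> : dinf (cell_pos x) (c.1 + (u0.1 * M)%N%:Z, c.2 + (u0.2 * M)%N%:Z)%R = dinf (rel_pos x) c.
    rewrite -xu /dinf /rel_pos /= {1}(divn_eq x.1 M) {1}(divn_eq x.2 M) !PoszD.
    by congr (maxn `|_|%N `|_|%N); ring.
  case: ifP => // _; rewrite /w /child xu eqxx mul1r andbT.
  have [xn|xn] := boolP (x \in node h0).
    rewrite mulr1 ler_pdivlMr// mulrAC ler_pdivrMr// mulrC; exact: spread.
  rewrite mulr0 (_ : leaves P h0 x = 0%N) ?mul0r//.
  apply/eqP; rewrite cards_eq0; apply/eqP/setP => z; rewrite !inE.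
  apply/negP => /andP[zP /eqP zx]; move/negP: xn; apply.
  by apply/imsetP; exists z.
have p : 0 <= 2 / M%:R `^ s by rewrite divr_ge0 ?powR_ge0.
have := ler_wpM2l p (fr (c.1 + (u0.1 * M)%N%:Z, c.2 + (u0.2 * M)%N%:Z)%R m m0).
by congr (_ <= _); ring.
Qed.

(** The radial estimate bounds an average over pairs of children of [u0], so some child [x] of
    positive weight is at most average. As [bad] sees the pin only through its ancestor at height
    [h0], any leaf under [x] can be the pin. *)
Lemma good_pin : exists x, [/\ x \in P, anc h0.+1 x = u0 &
  \sum_(z in P | anc h0.+1 z == u0) \sum_(h < h0) (bad h (anc h0 x) z)%:R
    <= gam * h0%:R * (leaves P h0.+1 u0)%:R].
Proof.
pose Ez x z : R := \sum_(h < h0)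
  (thr <= normal_collisions h (anc h.+1 z) (displacement x (anc h0 z)))%R%:R.
pose Gz (z : cell) j : R := \sum_(h < h0) (thr <= slope_collisions_at h (anc h.+1 z) j)%R%:R.
(* [E x y] and [G y j] are proportions among the pairs of a leaf [z] under [y] and a height
   [h < h0]: those exceptional along the displacement from [y] to [x], respectively along the slope
   [j]. Only for siblings does [rel_pos] give the displacement, and [w] vanishes off the children of
   [u0]. *)
pose E x y := if parent x == parent y then
  (\sum_(z | under y z) Ez x z / h0%:R) / #|under y|%:R else 0.
pose G y j := (\sum_(z | under y z) Gz z j / h0%:R) / #|under y|%:R.
have h0R : (0 : R) < h0%:R by rewrite ltr0n.
have le1 (B : 'I_h0 -> bool) : (\sum_h (B h)%:R) / h0%:R <= 1 :> R.
  rewrite ler_pdivrMr// mul1r sum_indicator ler_nat -[leqRHS]card_ord.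
  exact: max_card.
have G01 y j : 0 <= G y j <= 1.
  rewrite divr_ge0 ?sumr_ge0//=; last first.
    by move=> z _; rewrite divr_ge0 ?ler0n// sumr_ge0.
  by apply: average_le => // z _; exact: le1.
(* Markov's inequality: by [few], at most [b * M!] slopes have [thr] collisions or more at a given
   node. *)
have sumG y : \sum_j G y j <= b * (M`!)%:R.
  rewrite /G -mulr_suml exchange_big /=.
  apply: average_le => [|z _]; first by rewrite mulr_ge0.
  rewrite -mulr_suml ler_pdivrMr// exchange_big /=.
  rewrite [leRHS](_ : _ = \sum_(h < h0) (b * (M`!)%:R)); last first.
    by rewrite sumr_const card_ord -[RHS]mulr_natr.
  apply: ler_sum => h _.
  apply: (@le_trans _ _ ((\sum_j slope_collisions_at h (anc h.+1 z) j) / thr)).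
    rewrite mulr_suml; apply: ler_sum => j _.
    have sc0 : 0 <= slope_collisions_at h (anc h.+1 z) j.
      by do 2 (apply: sumr_ge0 => ? _).
    case: (leP thr) => ht; last by rewrite divr_ge0// ltW.
    by rewrite ler_pdivlMr// mul1r.
  have hn : (h <= n)%N by apply: ltnW; apply: leq_trans (ltn_ord h) (ltnW h0n).
  rewrite ler_pdivrMr//; apply: le_trans (sum_slope_collisions _ hn) _.
  by rewrite [leRHS]mulrAC; apply: ler_wpM2r few.
have EG x y : (M <= L * `|(rel_pos x).2 - (rel_pos y).2|)%N ->
    forall j : 'I_J.*2.+1, 0 <= (M`!)%:Z * ((rel_pos x).1 - (rel_pos y).1)
       + slope j * ((rel_pos x).2 - (rel_pos y).2) < (M`!)%:Z -> E x y <= G y j.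
  move=> far j qv; rewrite /E; case: eqP => [pxy|_]; last by case/andP: (G01 y j).
  have /(congr1 (fun v => v.1)) /= e1 := rel_posE pxy.
  have /(congr1 (fun v => v.2)) /= e2 := rel_posE pxy.
  rewrite ler_wpM2r ?invr_ge0// ler_sum// => z /andP[_ /eqP zy].
  rewrite ler_wpM2r ?invr_ge0// ler_sum// => h _; rewrite ler_nat zy.
  case: (boolP (thr <= normal_collisions _ _ _)) => // ht.
  rewrite (le_trans ht)//; apply: normal_le_slope.
    by move: qv; rewrite e1 e2.
  by move: far; rewrite e2.
have pos1 x : 0 <= (rel_pos x).1 < M%:Z by rewrite /= ltz_nat ltn_pmod.
have pos2 x : 0 <= (rel_pos x).2 < M%:Z by rewrite /= ltz_nat ltn_pmod.
have := radial w0 w1 pos1 pos2 w_frost G01 sumG EG.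
rewrite exchange_big /=; under eq_bigr => x _.
  under eq_bigr => y _ do rewrite -mulrA.
  rewrite -mulr_sumr; over.
move=> /(exists_le_average w0 w1)[x wx hx].
have [xu xl] : parent x = u0 /\ (0 < leaves P h0 x)%N.
  move: wx; rewrite /w; have [->|_] := eqVneq (parent x) u0; last by rewrite !mul0r ltxx.
  rewrite mul1r => h; split => //; rewrite lt0n; apply/eqP => l0.
  by move: h; rewrite l0 mul0r ltxx.
have /card_gt0P[z0] := xl; rewrite inE => /andP[z0P /eqP z0x].
exists z0; split => //; first by rewrite ancestorS z0x.
rewrite z0x.
have -> : \sum_(z in P | anc h0.+1 z == u0) \sum_(h < h0) (bad h x z)%:R =
    h0%:R * (leaves P h0.+1 u0)%:R * \sum_y w y *
      (if (M <= L * `|(rel_pos x).2 - (rel_pos y).2|)%N then E x y else 1); last first.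
  by rewrite [leRHS](_ : _ = h0%:R * (leaves P h0.+1 u0)%:R * gam) ?ler_wpM2l ?mulr_ge0//; ring.
rewrite (partition_big (anc h0) (fun y => parent y == u0)) /=; last first.
  by move=> z /andP[_]; rewrite ancestorS.
rewrite mulr_sumr big_mkcond; apply: eq_bigr => y _.
have [yu|yu] := eqVneq (parent y) u0; last by rewrite /w (negbTE yu) !mul0r mulr0.
have dxy : parent x = parent y by rewrite xu yu.
have e2 : (x.2 %% M)%N%:Z - (y.2 %% M)%N%:Z = (displacement x y).2.
  by rewrite -(rel_posE dxy).
have lE : leaves P h0 y = #|under y|.
  by rewrite /leaves; apply: eq_card => z; rewrite !inE.
rewrite /w yu eqxx mul1r lE.
have cancel (a r t e : R) : r != 0 -> a * r * (t / r * e) = a * t * e.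
  by move=> r0; field.
rewrite cancel ?gt_eqF//.
rewrite (eq_bigl (under y)); last first.
  move=> z; rewrite /under ancestorS; have [->|_] := eqVneq (anc h0 z) y; rewrite ?andbF//.
  by rewrite yu eqxx !andbT.
rewrite [in LHS](eq_bigr (fun z => if (M <= L * `|(x.2 %% M)%N%:Z - (y.2 %% M)%N%:Z|)%N then Ez x z else h0%:R)); last first.
  move=> z /andP[_ /eqP zy]; rewrite /bad /Ez zy -e2.
  case: ifP => far /=; first by [].
  by rewrite sumr_const card_ord.
case: ifP => far; last by rewrite sumr_const mulr1 mulr_natr.
rewrite /E dxy eqxx -mulr_suml.
have [u00|u0p] := posnP #|under y|.
  rewrite u00 mulr0 mul0r big1// => z zy.
  by have := card0_eq u00 z; move: zy; rewrite -!topredE /= => ->.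
by field; rewrite !gt_eqF// ltr0n.
Qed.

End pin.

Section truncation.
Context {R : realType}.
Implicit Types f g : R.

Lemma truncn_div_close f g (m : nat) : 0 <= f -> 0 <= g -> (0 < m)%N ->
  `|f - g| <= 2 * m%:R -> (Num.truncn f %/ m <= Num.truncn g %/ m + 3)%N.
Proof.
move=> f0 g0 m0 fg.
have /andP[f1 f2] := truncn_itv f0; have /andP[g1 g2] := truncn_itv g0.
have lt : (Num.truncn f < Num.truncn g + 1 + 2 * m)%N.
  rewrite -(ltr_nat R) (natrD _ (_ + 1)%N) (natrD _ (Num.truncn g)) natrM.
  by move: f1 g2 fg; rewrite ler_norml -natr1 => ? ? /andP[]; lra.
have : (Num.truncn f %/ m <= (Num.truncn g + 2 * m) %/ m)%N by apply: leq_div2r; lia.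
by rewrite addnC divnMDl//; lia.
Qed.

Lemma truncn_div_eq f g (m : nat) : 0 <= f -> 0 <= g -> (0 < m)%N ->
  (Num.truncn f %/ m = Num.truncn g %/ m)%N -> `|f - g| <= 2 * m%:R.
Proof.
move=> f0 g0 m0 fg; have h := same_quotient m0 fg.
have /andP[f1 f2] := truncn_itv f0; have /andP[g1 g2] := truncn_itv g0.
have h1 : (Num.truncn f < Num.truncn g + m)%N by lia.
have h2 : (Num.truncn g < Num.truncn f + m)%N by lia.
have m1 : (1 : R) <= m%:R by rewrite ler1n.
move: h1 h2; rewrite -!(ltr_nat R) !natrD => h1 h2.
by rewrite ler_norml; move: f1 f2 g1 g2; rewrite -!natr1; move: m1 h1 h2; move=> *; apply/andP; split; lra.
Qed.

End truncation.

(** * Counting the values seen from a good pin *)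

Section pinned.
Variables (M n : nat).
Hypothesis M0 : (0 < M)%N.
Context {R : realType}.
Variables (P : {set cell M n}) (s K : R).
Hypotheses (s1 : 1 < s).
Local Notation cell := (cell M n).
Local Notation anc := (@ancestor M n).
Hypothesis frost : forall h c m, (h <= n)%N -> (0 < m)%N ->
  #|[set u in nodes anc P h | (dinf (cell_pos u) c <= m)%N]|%:R <= K * m%:R `^ s.
Variables (p1 p2 : cell -> R).
Hypothesis p1P : forall z, z \in P -> (z.1 : nat)%:R <= p1 z < (z.1 : nat)%:R + 1.
Hypothesis p2P : forall z, z \in P -> (z.2 : nat)%:R <= p2 z < (z.2 : nat)%:R + 1.

Lemma quotient_bounds (k i : nat) (p : R) : (0 < k)%N -> i%:R <= p < i%:R + 1 ->
  k%:R * (i %/ k)%N%:R <= p < k%:R * (i %/ k)%N%:R + k%:R.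
Proof.
move=> k0 /andP[h1 h2]; have := leq_trunc_div i k; have := ltn_ceil i k0.
rewrite -(ler_nat R) -(ler_nat R _ i) mulSn natrD natrM.
have -> : i.+1%:R = i%:R + 1 :> R by rewrite natr1.
move=> h3 h4.
by apply/andP; split; [move: h1 h4|move: h2 h3];  lra.
Qed.

Lemma cell_difference h z z' : z \in P -> z' \in P ->
  `|p1 z - p1 z' - (M ^ h)%N%:R * (displacement (anc h z) (anc h z')).1%:~R| <= (M ^ h)%N%:R /\
  `|p2 z - p2 z' - (M ^ h)%N%:R * (displacement (anc h z) (anc h z')).2%:~R| <= (M ^ h)%N%:R.
Proof.
move=> zP zP'; have Mh : (0 < M ^ h)%N by rewrite expn_gt0 M0.
have q1 := quotient_bounds Mh (p1P zP); have q2 := quotient_bounds Mh (p2P zP).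
have q3 := quotient_bounds Mh (p1P zP'); have q4 := quotient_bounds Mh (p2P zP').
rewrite /displacement /cell_pos /= !rmorphB /= !ler_norml.
split; [move: q1 q3|move: q2 q4]; rewrite -!pmulrn => /andP[? ?] /andP[? ?];
  by apply/andP; split; lra.
Qed.

Variables (x0 : cell) (x0P : x0 \in P).

Definition pin_dist (z : cell) : R := planar_dist (p1 x0) (p2 x0) (p1 z) (p2 z).

Definition pin_value (z : cell) : 'I_(2 * M ^ n).+1 := inord (Num.truncn (pin_dist z)).

Lemma pin_dist_ge0 z : 0 <= pin_dist z.
Proof. exact: planar_dist_ge0. Qed.

Lemma pin_valueE z : z \in P -> pin_value z = Num.truncn (pin_dist z) :> nat.
Proof.
move=> zP; rewrite inordK// ltnS.
have [h1 h2] := cell_difference n x0P zP.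
rewrite (ancestor_top x0 z) /displacement !subrr mulr0 !subr0 in h1 h2.
have := planar_dist_le h1 h2; rewrite -/(pin_dist z) => h.
have /andP[h3 _] := truncn_itv (pin_dist_ge0 z).
by rewrite -(ler_nat R) natrM; apply: le_trans h.
Qed.

Variables (L h0 : nat) (thr gam : R) (u0 : cell).
Hypotheses (thr1 : 1 <= thr) (gam0 : 0 < gam) (h00 : (0 < h0)%N) (h0n : (h0 < n)%N).
Hypothesis x0u0 : anc h0.+1 x0 = u0.
Hypothesis rarely_bad : \sum_(z in P | anc h0.+1 z == u0)
    \sum_(h < h0) (bad P L thr h0 h (anc h0 x0) z)%:R
    <= gam * h0%:R * (leaves P h0.+1 u0)%:R.

Let nb z : R := \sum_(h < h0) (bad P L thr h0 h (anc h0 x0) z)%:R.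
(** Leaves with at most twice the average number of bad heights; by Markov's inequality they are at
    least half of the leaves under [u0]. *)
Let P' : {set cell} := [set z in P | (anc h0.+1 z == u0) && (nb z <= 2 * gam * h0%:R)].

Let half : (leaves P h0.+1 u0)%:R <= 2 * #|P'|%:R :> R.
Proof.
pose Q : {set cell} := [set z in P | (anc h0.+1 z == u0) && ~~ (nb z <= 2 * gam * h0%:R)].
have h0R : (0 : R) < h0%:R by rewrite ltr0n.
have e : leaves P h0.+1 u0 = (#|P'| + #|Q|)%N.
  rewrite /leaves -(cardsID [set z | nb z <= 2 * gam * h0%:R]); congr (_ + _)%N.
    by apply: eq_card => z; rewrite !inE andbA.
  by apply: eq_card => z; rewrite !inE andbC andbA.
have : #|Q|%:R * (2 * gam * h0%:R) <= gam * h0%:R * (leaves P h0.+1 u0)%:R.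
  apply: le_trans rarely_bad; rewrite mulr_natl -sumr_const.
  rewrite big_mkcond [leRHS]big_mkcond; apply: ler_sum => z _; rewrite inE.
  case: (z \in P) => //=; case: (_ == u0) => //=.
  rewrite -ltNge; case: ifP => [/ltW//|_]; exact: sumr_ge0.
have gh : 0 < gam * h0%:R by rewrite mulr_gt0.
have -> : #|Q|%:R * (2 * gam * h0%:R) = gam * h0%:R * (2 * #|Q|%:R) :> R by ring.
by rewrite ler_pM2l// e natrD;  lra.
Qed.

(** [tree_count] needs a function of the node, so the distance is taken at a representative leaf.
    Another leaf of the same cell of side [M^h] changes it by at most [2 M^h], which the slack of 3
    allows. *)
Let rep h c : cell := odflt x0 [pick z in P' | anc h z == c].
Let beta h c : nat := (pin_value (rep h c) %/ M ^ h)%N.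
Let beta_coll h u : R :=
  \sum_(c in nodes anc P' h | parent c == u) \sum_(c' in nodes anc P' h | parent c' == u)
    (beta h c == beta h c')%:R.

Let P'P z : z \in P' -> z \in P. Proof. by rewrite inE => /andP[]. Qed.
Let P'u z : z \in P' -> anc h0.+1 z = u0. Proof. by rewrite inE => /and3P[_ /eqP]. Qed.

Let repP h c : c \in nodes anc P' h -> rep h c \in P' /\ anc h (rep h c) = c.
Proof.
move=> /imsetP[z zP' ->]; rewrite /rep; case: pickP => [y /andP[yP /eqP ya]|/(_ z)].
  by [].
by rewrite zP' eqxx.
Qed.

Let beta_close h z : z \in P' -> (beta h (anc h z) <= pin_value z %/ M ^ h + 3)%N /\
  (pin_value z %/ M ^ h <= beta h (anc h z) + 3)%N.
Proof.
move=> zP'; have Mh : (0 < M ^ h)%N by rewrite expn_gt0 M0.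
have [rP ra] := repP (imset_f _ zP' : anc h z \in nodes anc P' h).
rewrite /beta (pin_valueE (P'P rP)) (pin_valueE (P'P zP')).
have [d1 d2] := cell_difference h (P'P rP) (P'P zP').
rewrite ra /displacement !subrr mulr0 !subr0 in d1 d2.
have lip := planar_dist_lipschitz (p1 x0) (p2 x0) (ler0n R (M ^ h)) d1 d2.
split; apply: truncn_div_close; rewrite ?pin_dist_ge0//.
by rewrite distrC.
Qed.

Let beta_coll_le h z : (h < h0)%N -> z \in P' ->
  beta_coll h (anc h.+1 z) <=
  normal_collisions P h (anc h.+1 z) (displacement (anc h0 x0) (anc h0 z)).
Proof.
move=> hh zP'; have Mh : (0 < M ^ h)%N by rewrite expn_gt0 M0.
have Mh0 : (0 < M ^ h0)%N by rewrite expn_gt0 M0.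
have sub c : c \in nodes anc P' h -> c \in nodes anc P h.
  by move=> /imsetP[y yP ->]; apply: imset_f; exact: P'P.
have sub_child (f g : cell -> R) : (forall c, 0 <= g c) ->
    (forall c, c \in nodes anc P' h -> parent c = anc h.+1 z -> f c <= g c) ->
    \sum_(c in nodes anc P' h | parent c == anc h.+1 z) f c <=
    \sum_(c | child P h (anc h.+1 z) c) g c.
  move=> g0 fg; rewrite big_mkcond [leRHS]big_mkcond; apply: ler_sum => c _.
  case: ifP => [/andP[cn cu]|_]; last by case: ifP.
  by rewrite /child sub// cu; apply: fg => //; exact/eqP.
apply: (sub_child _ _) => [c|c cn cu]; first exact: sumr_ge0.
apply: (sub_child _ _) => // c' cn' cu'.
rewrite ler_nat; case: eqP => // bcc; rewrite lt0b.
have [rP ra] := repP cn; have [rP' ra'] := repP cn'.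
have under (y : cell) : parent (anc h y) = anc h.+1 z -> anc h0 y = anc h0 z.
  move=> yz; rewrite -(subnKC hh) !ancestorD; congr (ancestor _ _).
  by rewrite ancestorS.
have rz := under (rep h c); have rz' := under (rep h c').
rewrite ra in rz; rewrite ra' in rz'; have {rz}rz := rz cu; have {rz'}rz' := rz' cu'.
have [a1 a2] := cell_difference h (P'P rP) (P'P rP'); rewrite ra ra' in a1 a2.
have [b1 b2] := cell_difference h0 x0P (P'P rP); rewrite rz in b1 b2.
have [c1 c2] := cell_difference h0 x0P (P'P rP'); rewrite rz' in c1 c2.
have [d1 d2] := cell_difference h0.+1 x0P (P'P rP).
have [e1 e2] := cell_difference h0.+1 x0P (P'P rP').
rewrite x0u0 (P'u rP) /displacement !subrr mulr0 !subr0 expnS natrM in d1 d2.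
rewrite x0u0 (P'u rP') /displacement !subrr mulr0 !subr0 expnS natrM in e1 e2.
have ch : child P h (anc h.+1 z) c by rewrite /child sub// cu eqxx.
have ch' : child P h (anc h.+1 z) c' by rewrite /child sub// cu' eqxx.
have [f1 f2] := child_near M0 ch ch'.
have [g1 g2] : `|(displacement (anc h0 x0) (anc h0 z)).1| < M%:Z /\
    `|(displacement (anc h0 x0) (anc h0 z)).2| < M%:Z.
  by apply: (parent_near M0); rewrite -!ancestorS x0u0 P'u.
have neg (u v w l : R) : `|u - v - w| <= l -> `|v - u + w| <= l.
  by move=> h1; rewrite -normrN; move: h1; congr (`|_| <= _); ring.
apply: (@equidistant_normal R (M ^ h)%N%:R (M ^ h0)%N%:R M (p1 x0) (p2 x0)
  (p1 (rep h c)) (p2 (rep h c)) (p1 (rep h c')) (p2 (rep h c'))) => //;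
  rewrite ?ltr0n//; try exact: ltW; try exact: neg.
apply: truncn_div_eq; rewrite ?planar_dist_ge0//.
by have := bcc; rewrite /beta !pin_valueE ?P'P.
Qed.

Let K1 : 1 <= K.
Proof.
have := frost (cell_pos x0) (leq0n n) (isT : (0 < 1)%N); rewrite powR1 mulr1.
apply: le_trans; rewrite ler1n card_gt0; apply/set0Pn; exists x0.
rewrite !inE /dinf !subrr andbT; apply/imsetP; exists x0 => //.
by rewrite ancestor0.
Qed.

(** The factors [b] of [tree_count]: [good] if the node has at most [thr] collisions; otherwise
    [big], where all pairs of its at most [K M^s] children may collide. *)
Let big : R := Num.sqrt (7 * (K * M%:R `^ s) ^+ 2).
Let good : R := Num.sqrt (7 * thr).
Let cost h u : R := if beta_coll h u <= thr then good else big.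

Let KM1 : 1 <= K * M%:R `^ s.
Proof.
have M1 : 1 <= M%:R `^ s :> R.
  have : M%:R `^ 0 <= M%:R `^ s :> R by apply: ler_powR; [rewrite ler1n|exact: ltW (lt_trans ltr01 s1)].
  by rewrite powRr0.
by rewrite mulr_ege1.
Qed.

Let good1 : 1 <= good.
Proof. by rewrite -sqrtr1 ler_wsqrtr//; move: thr1;  lra. Qed.

Let big1' : 1 <= big.
Proof.
rewrite -sqrtr1 ler_wsqrtr//; have : 1 <= (K * M%:R `^ s) ^+ 2 by rewrite exprn_ege1.
by lra.
Qed.

Let cost_coll h u : (h < h0.+1)%N -> 7 * beta_coll h u <= cost h u ^+ 2.
Proof.
move=> hh; have hn : (h <= n)%N by rewrite (leq_trans _ h0n)// ltnW.
rewrite /cost; case: ifP => [bt|_].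
  rewrite sqr_sqrtr; first by rewrite ler_wpM2l.
  by rewrite mulr_ge0//; move: thr1;  lra.
rewrite sqr_sqrtr; last by rewrite mulr_ge0 ?sqr_ge0.
apply: ler_wpM2l => //.
have card_children : \sum_(c in nodes anc P' h | parent c == u) 1 <= K * M%:R `^ s.
  have fr := children_frostman frost u hn.
  apply: le_trans (fr ((u.1 * M)%N%:Z, (u.2 * M)%N%:Z) M M0).
  rewrite big_mkcond [leRHS]big_mkcond; apply: ler_sum => c _.
  case: ifP => [/andP[cn /eqP cu]|_]; last by case: ifP.
  have -> : child P h u c.
    rewrite /child cu eqxx andbT; case/imsetP: cn => y yP ->.
    by apply: imset_f; exact: P'P.
  rewrite ifT//; have := @ancestor_near M n M0 1 c u; rewrite expn1 => near.
  by apply: ltnW; apply: near; rewrite -cu (ancestorS 0) ancestor0.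
have KM0 : 0 <= K * M%:R `^ s by apply: le_trans KM1.
rewrite expr2; apply: (@le_trans _ _ (\sum_(c in nodes anc P' h | parent c == u) 1 * (K * M%:R `^ s))).
  apply: ler_sum => c _; rewrite mul1r; apply: le_trans card_children.
  by apply: ler_sum => c' _; case: (_ == _).
by rewrite -mulr_suml ler_wpM2r.
Qed.

(** At most [2 gam h0] heights below [h0] are bad. The height [h0] itself is not covered by
    [rarely_bad], whence the extra 1 in the exponent. *)
Let prod_cost z : z \in P' -> \prod_(i < h0.+1) cost i (anc i.+1 z) <=
  good ^+ h0.+1 * big `^ (2 * gam * h0%:R + 1).
Proof.
move=> zP'; have zP := P'P zP'.
pose e (i : nat) : nat := ~~ (beta_coll i (anc i.+1 z) <= thr).
have g0 : 0 <= good by apply: le_trans good1.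
have bg0 : 0 <= big by apply: le_trans big1'.
apply: (@le_trans _ _ (\prod_(i < h0.+1) (good * big ^+ e i))).
  apply: ler_prod => i _; apply/andP; split; first by rewrite /cost; case: ifP.
  rewrite /cost /e; case: ifP => _ /=; first by rewrite expr0 mulr1.
  by rewrite expr1 ler_peMl.
rewrite big_split prodr_const card_ord /= -expr_sum ler_wpM2l ?exprn_ge0//.
rewrite -powR_mulrn//; apply: ler_powR => //.
rewrite big_ord_recr /= natrD; apply: lerD; last by rewrite lern1 leq_b1.
have : nb z <= 2 * gam * h0%:R by move: zP'; rewrite inE => /and3P[].
apply: le_trans; rewrite natr_sum; apply: ler_sum => i _; rewrite /e ler_nat.
have key : ~~ (beta_coll i (anc i.+1 z) <= thr) -> bad P L thr h0 i (anc h0 x0) z.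
  rewrite -ltNge => ht; rewrite /bad; apply/orP; right.
  by apply: le_trans (beta_coll_le (ltn_ord i) zP'); exact: ltW.
by case: (~~ _) key => // ->.
Qed.

Lemma pinned_values :
  ((leaves P h0.+1 u0)%:R / 2) ^+ 2 /
    ((7 * thr) ^+ h0.+1 * (7 * (K * M%:R `^ s) ^+ 2) `^ (2 * gam * h0%:R + 1)) <=
  #|[set pin_value z | z in P]|%:R.
Proof.
have thr7 : 0 <= 7 * thr by rewrite mulr_ge0//; move: thr1;  lra.
have KM7 : 0 <= 7 * (K * M%:R `^ s) ^+ 2 by rewrite mulr_ge0 ?sqr_ge0.
have cost0 h u : 0 < cost h u.
  by rewrite /cost; case: ifP => _; [exact: lt_le_trans ltr01 good1|exact: lt_le_trans ltr01 big1'].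
have tc := @tree_count R cell (@parent M n) anc (@ancestor0 M n) (@ancestorS M n) M _ P' pin_value
  beta cost h0.+1 cost0 (fun h z _ zP => beta_close h zP) (fun h u hh => cost_coll u hh)
  h0.+1 u0 (leqnn _).
have sub : (#|values anc P' pin_value h0.+1 u0| <= #|[set pin_value z | z in P]|)%N.
  apply: subset_leq_card; apply/fintype.subsetP => v /imsetP[z].
  by rewrite inE => /andP[zP _] ->; apply: imset_f; exact: P'P.
apply: le_trans (le_trans tc _); last by rewrite ler_nat.
set X := good ^+ h0.+1 * big `^ (2 * gam * h0%:R + 1).
have X0 : 0 < X by rewrite mulr_gt0 ?exprn_gt0 ?powR_gt0//; apply: lt_le_trans ltr01 _.
have X2 : X ^+ 2 = (7 * thr) ^+ h0.+1 * (7 * (K * M%:R `^ s) ^+ 2) `^ (2 * gam * h0%:R + 1).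
  rewrite /X exprMn -powR_expn ?sqrtr_ge0// sqr_sqrtr// exprAC.
  by rewrite /good sqr_sqrtr.
rewrite -X2 -expr_div_n ler_sqr ?nnegrE; last 2 first.
- by rewrite divr_ge0 ?divr_ge0// ltW.
- by apply: sumr_ge0 => z _; apply: prodr_ge0 => i _; rewrite invr_ge0 ltW.
rewrite (eq_bigl (fun z => z \in P')); last first.
  by move=> z; case: (boolP (z \in P')) => //= zP; rewrite P'u// eqxx.
apply: (@le_trans _ _ (\sum_(z in P') X^-1)).
  rewrite sumr_const -[leRHS]mulr_natl; apply: ler_wpM2r; first by rewrite invr_ge0 ltW.
  by rewrite ler_pdivrMr// mulrC.
apply: ler_sum => z zP'; rewrite prodfV lef_pV2 ?posrE//; first exact: prod_cost.
exact: prodr_gt0.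
Qed.

End pinned.

(** * The discrete theorem: choice of [M] and [eps] *)

Section discrete.
Context {R : realType}.

Lemma powRn_large (A p : R) : 0 < p ->
  exists N : nat, forall n, (N <= n)%N -> A <= n%:R `^ p.
Proof.
move=> p0; have [N N0 hN] := @powRn_small R (`|A|) p 1 (normr_ge0 _) p0 ltr01.
exists N => n Nn; apply: le_trans (ler_norm A) _.
have NR : (0 : R) < N%:R by rewrite ltr0n.
move: hN; rewrite ler_pdivrMr ?powR_gt0// mul1r => /le_trans; apply.
by apply: powRn_le => //; exact: ltW.
Qed.

Lemma pow2_large (A p : R) : 0 < p ->
  exists N : nat, forall n, (N <= n)%N -> A <= 2 `^ (n%:R * p).
Proof.
move=> p0; have [N hN] := powRn_large A p0; exists N => n /hN /le_trans; apply.
rewrite powRrM; apply: ge0_ler_powR; rewrite ?nnegrE ?powR_ge0 ?ler0n ?(ltW p0)//.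
by rewrite powR_mulrn// -natrX ler_nat ltnW// ltn_expl.
Qed.

Lemma natX_powR (M n : nat) (a : R) : (M ^ n)%N%:R `^ a = M%:R `^ (n%:R * a).
Proof. by rewrite natrX -powR_mulrn ?ler0n// -powRrM. Qed.

(** Here [y = M]. The squared number of leaves has exponent [2 s (h0 + 1) - 2 eps n], and the
    divisors leave [(1 - 3 eta) (h0 + 1)] up to a constant. As [h0 + 1 >= (1 - eta) n], this loses
    at most [4 eta n]; [2 eps n] and the constants cost [eta n] each, hence [6 eta]. *)
Lemma leaves_sqr_bound (y lv s eps eta c h0 i n : R) : 1 <= y -> 0 < c ->
  0 < eta -> eta <= 1 / 4 -> 1 < s -> 2 * eps <= eta -> 0 <= h0 -> 0 <= n ->
  n = h0 + 1 + i -> i <= eta * n ->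
  c * y `^ (n * (s - eps)) <= y `^ (i * s) * lv ->
  4 * y `^ (2 * s + eta) / c ^+ 2 <= y `^ (n * eta) ->
  y `^ (n * (1 - 6 * eta)) <=
  (lv / 2) ^+ 2 / (y `^ ((2 * s - 1 + 2 * eta) * (h0 + 1)) * y `^ (eta * h0 + 2 * s + eta)).
Proof.
move=> y1 c0 eta0 eta4 s1 eps_eta h00 n0 nE iE hlv hc.
have y0 : 0 < y by apply: lt_le_trans y1.
have pwD a b : y `^ (a + b) = y `^ a * y `^ b.
  by rewrite powRD//; apply/implyP => _; rewrite gt_eqF.
have pw0 a : 0 < y `^ a by exact: powR_gt0.
rewrite -pwD ler_pdivlMr// -pwD.
have lv_ge : c * y `^ (n * (s - eps) - i * s) <= lv.
  have -> : lv = y `^ (- (i * s)) * (y `^ (i * s) * lv).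
    by rewrite mulrA -pwD addNr powRr0 mul1r.
  rewrite pwD mulrA mulrC; apply: ler_wpM2l hlv; exact: ltW.
have sq : (c * y `^ (n * (s - eps) - i * s) / 2) ^+ 2 <= (lv / 2) ^+ 2.
  have p : 0 <= c * y `^ (n * (s - eps) - i * s) by rewrite mulr_ge0// ltW.
  by rewrite ler_sqr ?nnegrE ?divr_ge0// ?ler_pM2r//; apply: le_trans lv_ge.
apply: le_trans sq.
have -> : (c * y `^ (n * (s - eps) - i * s) / 2) ^+ 2 =
   c ^+ 2 / 4 * y `^ (2 * (n * (s - eps) - i * s)).
  move: (n * (s - eps) - i * s) => t; have -> : 2 * t = t + t by ring.
  by rewrite pwD; field.
have c2 : 0 < c ^+ 2 by rewrite exprn_gt0.
have hc' : y `^ (2 * s + eta) <= c ^+ 2 / 4 * y `^ (n * eta).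
  by move: hc; rewrite ler_pdivrMr// => hc; move: hc; lra.
have expo : n * (1 - 6 * eta) + ((2 * s - 1 + 2 * eta) * (h0 + 1) + (eta * h0 + 2 * s + eta))
  <= (2 * (n * (s - eps) - i * s) - n * eta) + (2 * s + eta).
  have e1 : 2 * (n * (s - eps) - i * s) = 2 * s * (h0 + 1) - n * (2 * eps).
    by rewrite nE; ring.
  have e2 : n * (2 * eps) <= n * eta by rewrite ler_wpM2l.
  have e3 : (1 - 3 * eta) * ((1 - eta) * n) <= (1 - 3 * eta) * (h0 + 1).
    rewrite ler_wpM2l//; first by lra.
    by rewrite mulrBl mul1r; lra.
  have e4 : 0 <= eta ^+ 2 * n by rewrite mulr_ge0// sqr_ge0.
  rewrite e1; nra.
apply: le_trans (ler_powR y1 expo) _; rewrite pwD.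
apply: le_trans (ler_wpM2l (ltW (pw0 _)) hc') _.
by rewrite mulrCA -pwD subrK.
Qed.

(* A set of cells of nearly maximal cardinality, at most [(M^n)^eps] times
   smaller than what the Frostman bound allows, has nearly as many distances as
   the scale permits. The constant [c] only influences how large [n] must be. *)
Theorem discrete_distances (s K eta : R) : 1 < s -> 0 < K -> 0 < eta -> eta <= 1 / 4 ->
  exists M : nat, (1 < M)%N /\ exists2 eps : R, 0 < eps <= 1 & forall c, 0 < c ->
  exists n0 : nat, forall n, (n0 <= n)%N ->
  forall (P : {set cell M n}) (p1 p2 : cell M n -> R),
  (forall h c m, (h <= n)%N -> (0 < m)%N ->
    #|[set u in nodes (@ancestor M n) P h | (dinf (cell_pos u) c <= m)%N]|%:R
      <= K * m%:R `^ s) ->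
  (forall z, z \in P -> (z.1 : nat)%:R <= p1 z < (z.1 : nat)%:R + 1) ->
  (forall z, z \in P -> (z.2 : nat)%:R <= p2 z < (z.2 : nat)%:R + 1) ->
  c * (M ^ n)%N%:R `^ (s - eps) <= #|P|%:R ->
  exists2 x0, x0 \in P & (M ^ n)%N%:R `^ (1 - 6 * eta)
    <= #|[set pin_value p1 p2 x0 z | z in P]|%:R.
Proof.
move=> s1 K0 eta0 eta4.
have [C C0 energy] := @energy_bound R s s1.
(* Solves [2 gam (2 s + eta) = eta]: heights that cost [M^(2s + eta)] each, in number [2 gam h0],
   cost [M^(eta h0)] together. *)
pose gam := eta / (4 * s + 2 * eta).
have d0 : 0 < 4 * s + 2 * eta by lra.
have gam0 : 0 < gam by rewrite divr_gt0.
have K20 : 0 < 2 * K by rewrite mulr_gt0.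
have [L [M0 [b [L0 b0 radial]]]] := radial_bound s1 K20 gam0.
(* [M^eta] has to absorb the 7 of [tree_count], the cost [7 K^2] of an exceptional height, and the
   collision constant over [b]; [L] and [b] are already fixed. *)
have [N1 hN1] := powRn_large (7 + 7 * K ^+ 2 + (collision_const L (11 * L))%:R * C * K ^+ 2 / b) eta0.
pose M := (M0 + N1 + 2)%N; exists M; split; first by rewrite /M addn2.
have Mp : (0 < M)%N by rewrite /M addn2.
set y : R := M%:R.
have y1 : 1 <= y by rewrite ler1n.
have y0 : 0 < y by apply: lt_le_trans y1.
have pwD a e : y `^ (a + e) = y `^ a * y `^ e.
  by rewrite powRD//; apply/implyP => _; rewrite gt_eqF.
have pw0 a : 0 < y `^ a by exact: powR_gt0.
have [h7 hK7 hb] : [/\ 7 <= y `^ eta, 7 * K ^+ 2 <= y `^ eta &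
    (collision_const L (11 * L))%:R * C * K ^+ 2 <= b * y `^ eta].
  have h : 7 + 7 * K ^+ 2 + (collision_const L (11 * L))%:R * C * K ^+ 2 / b <= y `^ eta.
    by apply: hN1; rewrite /M -addnA addnCA leq_addr.
  have q1 : 0 <= 7 * K ^+ 2 by rewrite mulr_ge0 ?sqr_ge0.
  have q2 : 0 <= (collision_const L (11 * L))%:R * C * K ^+ 2 / b.
    apply: divr_ge0; last exact: ltW.
    by rewrite mulr_ge0 ?sqr_ge0// mulr_ge0// ltW.
  split; [by lra|by lra|].
  by rewrite [leRHS]mulrC -ler_pdivrMr//; lra.
(* As [M <= 2^M], this gives [M^eps <= 2^(eta / 2)], so that the deficit [M^(eps n)] in the number
   of leaves is less than what [eta n] doublings in [rich_node] produce. *)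
pose eps := eta / (2 * y).
have eps0 : 0 < eps by rewrite divr_gt0// mulr_gt0.
have eps_eta : 2 * eps <= eta.
  have -> : 2 * eps = eta / y by rewrite /eps; field; rewrite gt_eqF.
  by rewrite ler_pdivrMr// ler_peMr// ltW.
have yeps : y `^ eps <= 2 `^ (eta / 2).
  have yM : y <= 2 `^ y.
    by rewrite powR_mulrn// -natrX ler_nat ltnW// ltn_expl.
  have -> : eta / 2 = y * eps by rewrite /eps; field; rewrite gt_eqF.
  by rewrite powRrM; apply: ge0_ler_powR; rewrite ?nnegrE ?powR_ge0 ?(ltW eps0) ?(ltW y0).
exists eps => [|c c0]; first by rewrite eps0; move: eps_eta eta4; lra.
pose A := K / c + 1 + 4 * y `^ (2 * s + eta) / c ^+ 2.
have eta20 : 0 < eta / 2 by rewrite divr_gt0.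
have [n1 hn1] := pow2_large A eta20.
exists (n1 + 4)%N => n nn P p1 p2 frost p1P p2P cP.
have nR : 4 <= n%:R :> R by rewrite ler_nat; apply: leq_trans nn; rewrite leq_addl.
(* [2^J] exceeds the square of [2^(n eta / 2)]: one factor pays for [M^(eps n)], the other for
   [K / c]. *)
pose J := (Num.truncn (eta * n%:R)).+1.
have en0 : 0 <= eta * n%:R by rewrite mulr_ge0// ltW.
have /andP[J1 J2] := truncn_itv en0.
have en : eta * n%:R <= n%:R / 4.
  by rewrite mulrC ler_wpM2l//; move: eta4; lra.
have Jn : (J <= n)%N by rewrite -(ler_nat R) /J -natr1; lra.
have cc0 : 0 < c ^+ 2 by rewrite exprn_gt0.
have A1 : 0 <= 4 * y `^ (2 * s + eta) / c ^+ 2 by rewrite divr_ge0 ?mulr_ge0 ?ltW.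
have A2 : 0 <= K / c by rewrite divr_ge0 ?ltW.
have hA : A <= 2 `^ (n%:R * (eta / 2)) by apply: hn1; apply: leq_trans nn; rewrite leq_addr.
have big : K * (M ^ n)%N%:R `^ s < 2 ^+ J * #|P|%:R.
  have e1 : 2 `^ (n%:R * (eta / 2)) * 2 `^ (n%:R * (eta / 2)) <= 2 ^+ J :> R.
    rewrite -powRD; last by apply/implyP => _; rewrite pnatr_eq0.
    rewrite -powR_mulrn//; apply: ler_powR; first by rewrite ler1n.
    have -> : n%:R * (eta / 2) + n%:R * (eta / 2) = eta * n%:R by field.
    exact: ltW.
  have e2 : (M ^ n)%N%:R `^ s <= 2 `^ (n%:R * (eta / 2)) * (M ^ n)%N%:R `^ (s - eps) :> R.
    rewrite !natX_powR -/y.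
    have -> : n%:R * s = n%:R * eps + n%:R * (s - eps) by ring.
    rewrite pwD; apply: ler_wpM2r; first exact: ltW (pw0 _).
    rewrite [n%:R * eps]mulrC [n%:R * (eta / 2)]mulrC (powRrM y eps) (powRrM 2 (eta / 2)).
    by apply: ge0_ler_powR => //; rewrite nnegrE powR_ge0.
  have X0 : 0 <= (M ^ n)%N%:R `^ (s - eps) :> R by exact: powR_ge0.
  set T := 2 `^ _ in e1 e2 hA; set X := _ `^ (s - eps) in e2 X0 cP.
  have T0 : 0 < T by rewrite powR_gt0.
  have KT : K < T * c by rewrite -ltr_pdivrMr//; apply: lt_le_trans hA; rewrite /A; lra.
  have Xp : 0 < X by rewrite powR_gt0// ltr0n expn_gt0 Mp.
  have s1' : K * (M ^ n)%N%:R `^ s <= K * (T * X) by rewrite ler_wpM2l// ltW.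
  apply: (le_lt_trans s1').
  have s2 : K * (T * X) < T * c * (T * X) by rewrite ltr_pM2r// mulr_gt0.
  apply: (lt_le_trans s2).
  have -> : T * c * (T * X) = T * T * (c * X) by ring.
  by apply: ler_pM => //; rewrite mulr_ge0// ltW.
have [h0 [i [u0 [hin iJ lv0 hlv spread]]]] := rich_node Mp frost Jn big.
have iR : i%:R <= eta * n%:R.
  by apply: le_trans J1; rewrite ler_nat.
have nE : n%:R = h0%:R + 1 + i%:R :> R by rewrite -hin natrD -natr1.
have h00 : (0 < h0)%N by rewrite -(ltr_nat R); lra.
have h0n : (h0 < n)%N by rewrite -hin addSn ltnS leq_addr.
pose thr := y `^ (2 * s - 1 + eta).
have thr1 : 1 <= thr.
  rewrite /thr -[X in X <= _](powRr0 y); apply: ler_powR => //; lra.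
have thr0 : 0 < thr by apply: lt_le_trans thr1.
have few : (collision_const L (11 * L))%:R * C * K ^+ 2 * M%:R `^ (2 * s - 1) <= b * thr.
  rewrite [leRHS](_ : _ = b * y `^ eta * y `^ (2 * s - 1)); last first.
    by rewrite /thr (pwD (2 * s - 1) eta); ring.
  by apply: ler_wpM2r hb; exact: ltW (pw0 _).
have MM0 : (M0 <= M)%N by rewrite /M -addnA leq_addr.
have [x0 [x0P x0u0 rare]] := good_pin Mp s1 K0 (ltW C0) frost
  (fun w d A => @energy (cell M n) w d A) L0 (fun pos w G E => @radial M (cell M n) pos w G E MM0)
  (ltW b0) thr0 h00 h0n few lv0 spread.
exists x0 => //.
have pv := pinned_values Mp s1 frost p1P p2P x0P thr1 gam0 h00 h0n x0u0 rare.
apply: le_trans pv; rewrite natX_powR -/y.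
have hc2 : 4 * y `^ (2 * s + eta) / c ^+ 2 <= y `^ (n%:R * eta).
  apply: (@le_trans _ _ (2 `^ (n%:R * (eta / 2)))); first by apply: le_trans hA; rewrite /A; lra.
  apply: (@le_trans _ _ (2 `^ (n%:R * eta))).
    by apply: ler_powR; rewrite ?ler1n// ler_wpM2l//; lra.
  by apply: ge0_ler_powR; rewrite ?nnegrE ?ler0n// ?ler_nat; [exact: mulr_ge0 (ler0n _ _) (ltW eta0)|rewrite /M addn2].
have hlv' : c * y `^ (n%:R * (s - eps)) <= y `^ (i%:R * s) * (leaves P h0.+1 u0)%:R.
  by move: (le_trans cP hlv); rewrite !natX_powR.
have := leaves_sqr_bound y1 c0 eta0 eta4 s1 eps_eta (ler0n R h0) (ler0n R n) nE iR hlv' hc2.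
move/le_trans; apply.
apply: ler_wpM2l; first exact: sqr_ge0.
have D1 : 0 < (7 * thr) ^+ h0.+1 by rewrite exprn_gt0// mulr_gt0.
have KM0 : 0 < 7 * (K * M%:R `^ s) ^+ 2 by rewrite mulr_gt0// exprn_gt0// mulr_gt0.
rewrite lef_pV2 ?posrE ?mulr_gt0 ?powR_gt0//.
apply: ler_pM; rewrite ?powR_ge0 ?(ltW D1)//.
  rewrite (natr1 _ : h0%:R + 1 = h0.+1%:R :> R) powRrM powR_mulrn ?powR_ge0//; apply: lerXn2r; rewrite ?nnegrE ?powR_ge0 ?mulr_ge0 ?(ltW thr0)//.
  have -> : 2 * s - 1 + 2 * eta = eta + (2 * s - 1 + eta) by ring.
  by rewrite pwD ler_wpM2r// ltW.
have -> : eta * h0%:R + 2 * s + eta = (2 * s + eta) * (2 * gam * h0%:R + 1).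
  by rewrite /gam; field; rewrite gt_eqF.
rewrite powRrM; apply: ge0_ler_powR; rewrite ?nnegrE ?powR_ge0 ?(ltW KM0)//.
  by rewrite addr_ge0// mulr_ge0// mulr_ge0// ltW.
have -> : 2 * s + eta = eta + s * 2%:R by ring.
rewrite pwD powRrM powR_mulrn ?powR_ge0// exprMn mulrA.
by rewrite ler_wpM2r// exprn_ge0// powR_ge0.
Qed.

End discrete.

(** * Ahlfors regular sets *)

Section packing.
Context {R : realType}.

Lemma packing_measure d (T : ringOfSetsType d) (mu : {content set T -> \bar R})
    (I : eqType) (r : seq I) (F : I -> set T) (c : R) (B : set T) :
  uniq r -> measurable B ->
  (forall i, i \in r -> [/\ measurable (F i), (F i `<=` B)%classic & (c%:E <= mu (F i))%E]) ->
  (forall i j, i \in r -> j \in r -> i != j -> (F i `&` F j = set0)%classic) ->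
  (((size r)%:R * c)%:E <= mu B)%E.
Proof.
elim: r B => [|i r IH] B /= ur mB hF dF; first by rewrite mul0r measure_ge0.
have [mi iB ci] := hF i (mem_head _ _).
case/andP: ur => ir ur.
have -> : (B = F i `|` (B `\` F i))%classic by rewrite setDUK.
rewrite measureU//; [|exact: measurableD|by rewrite setDE setICA setICr setI0].
rewrite -natr1 mulrDl mul1r EFinD addeC; apply: leeD => //; apply: IH => //.
- exact: measurableD.
- move=> j jr; have [mj jB cj] := hF j (mem_behead (s := i :: r) jr).
  split => // x xj; split; first exact: jB.
  move=> xi; have ij : i != j by apply: contraNneq ir => ->.
  have := dF i j (mem_head _ _) (mem_behead (s := i :: r) jr) ij.
  by move/seteqP => [/(_ x) h _]; apply: h.
- by move=> j k jr kr; apply: dF; rewrite inE ?jr ?kr orbT.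
Qed.

Lemma edist_ge d (x y : 'rV[R]_d) i : `|x ord0 i - y ord0 i| <= Defs.edist x y.
Proof.
rewrite -sqrtr_sqr ler_wsqrtr// (bigD1 i)//= lerDl.
by apply: sumr_ge0 => j _; exact: sqr_ge0.
Qed.

Lemma edist_le d (x y : 'rV[R]_d) a : 0 <= a ->
  (forall i, `|x ord0 i - y ord0 i| <= a) -> Defs.edist x y <= d%:R * a.
Proof.
move=> a0 h; rewrite -[leRHS]ger0_norm ?mulr_ge0// -sqrtr_sqr ler_wsqrtr//.
apply: (@le_trans _ _ (\sum_(i < d) a ^+ 2)).
  apply: ler_sum => i _; rewrite -real_normK ?num_real//.
  by rewrite ler_sqr ?nnegrE.
rewrite sumr_const card_ord exprMn -[leLHS]mulr_natl ler_wpM2r ?sqr_ge0//.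
by rewrite -natrX ler_nat; case: d {x y h} => // d; rewrite leq_pmulr.
Qed.

Lemma measurable_eball d (x : 'rV[R]_d) (r : R) :
  measurable (eball x r : set (borelRd R d)).
Proof.
rewrite -[eball x r]setCK; apply: measurableC; apply: sub_sigma_algebra.
rewrite /= openC.
apply: (preimage_closed (f := @Defs.edist R d x) _ (@closed_le R r)) => y _.
apply: continuous_comp; last exact: sqrt_continuous.
apply: (@cvg_big R 'I_d +%R 0 xpredT _ _ (nbhs y) _ (fun i (z : 'rV[R]_d) => (x ord0 i - z ord0 i) ^+ 2)
  (fun i => (x ord0 i - y ord0 i) ^+ 2)) => [|i _].
  by move=> z; apply: cvgD; [exact: cvg_fst|exact: cvg_snd].
have h : (x ord0 i - z ord0 i @[z --> nbhs y] --> x ord0 i - y ord0 i)%classic.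
  by apply: (@cvgB R); [exact: cvg_cst|exact: coord_continuous].
by rewrite expr2; apply: (@cvgM R).
Qed.

(** The balls of radius [r] about the points are disjoint and lie in the ball of radius [d (a + r)]
    about [x0]. All centres are in [E] and all radii at most 1, so both regularity bounds apply; [d]
    compares the Euclidean norm with the sup norm. *)
Lemma ahlfors_packing d (E : set 'rV[R]_d) (s C a r : R) (I : finType) (D : {set I})
    (f : I -> 'rV[R]_d) (x0 : 'rV[R]_d) :
  0 < s -> 0 < C -> ahlfors_regular s C E -> 0 <= a -> 0 < r ->
  d%:R * (a + r) <= 1 -> (0 < d)%N -> E x0 ->
  (forall i, i \in D -> E (f i)) ->
  (forall i k, i \in D -> `|x0 ord0 k - f i ord0 k| <= a) ->
  (forall i j, i \in D -> j \in D -> i != j ->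
    exists k, 2 * r < `|f i ord0 k - f j ord0 k|) ->
  #|D|%:R <= C ^+ 2 * (d%:R * (a + r) / r) `^ s.
Proof.
move=> s0 C0 [mu [_ hmu]] a0 r0 ar1 d0 Ex0 Ef near sep.
have d1 : (1 : R) <= d%:R by rewrite ler1n.
have rho0 : 0 < d%:R * (a + r) by rewrite mulr_gt0 ?ltr0n// ltr_wpDl.
have r1 : r <= 1.
  by apply: le_trans ar1; apply: le_trans (ler_peMl _ d1); rewrite ?addr_ge0 ?(ltW r0)// lerDr.
have := @packing_measure _ (borelRd R d) mu I (enum D) (fun i => eball (f i) r)
  (C^-1 * r `^ s) (eball x0 (d%:R * (a + r))) (enum_uniq _) (measurable_eball _ _) _ _.
rewrite -cardE => h.
have : ((#|D|%:R * (C^-1 * r `^ s))%:E <= (C * (d%:R * (a + r)) `^ s)%:E)%E.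
  have rr : 0 < d%:R * (a + r) <= 1 by rewrite rho0.
  have /andP[_ ub] := hmu _ _ Ex0 rr.
  apply: le_trans ub.
  apply: h => [i|i j]; rewrite !mem_enum => iD.
    split; first exact: measurable_eball.
      move=> y; rewrite /eball /= => fy.
      apply: edist_le => [|k]; first by rewrite addr_ge0// ltW.
      have -> : x0 ord0 k - y ord0 k = (x0 ord0 k - f i ord0 k) + (f i ord0 k - y ord0 k) by ring.
      apply: le_trans (ler_normD _ _) _; apply: lerD; first exact: near.
      exact: le_trans (edist_ge _ _ _) fy.
    have r2 : 0 < r <= 1 by rewrite r0.
    by have /andP[] := hmu _ _ (Ef i iD) r2.
  move=> jD ij; rewrite -subset0 => y [fy gy]; have [k] := sep i j iD jD ij.
  apply/negP; rewrite -leNgt.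
  have -> : f i ord0 k - f j ord0 k = (f i ord0 k - y ord0 k) - (f j ord0 k - y ord0 k) by ring.
  apply: le_trans (ler_normB _ _) _.
  have -> : 2 * r = r + r by ring.
  by apply: lerD; [exact: le_trans (edist_ge _ _ _) fy|exact: le_trans (edist_ge _ _ _) gy].
rewrite lee_fin => h2.
rewrite powRM; [|exact: ltW|by rewrite invr_ge0 ltW].
have rs : 0 < r `^ s by exact: powR_gt0.
have -> : r^-1 `^ s = (r `^ s)^-1 by rewrite -powR_inv1 ?(ltW r0)// -powRrM mulN1r powRN.
rewrite mulrA ler_pdivlMr//.
move: h2; rewrite mulrCA ler_pdivrMl// => h2.
by apply: le_trans h2 _; rewrite expr2 mulrA.
Qed.

End packing.

Section node_packing.
Context {R : realType}.

Lemma coordinate_close (t u u' m L x x' delta : R) : 0 <= delta -> 0 <= L ->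
  (t + u * L) * delta <= x < (t + (u + 1) * L) * delta ->
  (t + u' * L) * delta <= x' < (t + (u' + 1) * L) * delta ->
  `|u - u'| <= m -> `|x - x'| <= (m + 1) * L * delta.
Proof.
move=> d0 L0 /andP[h1 h2] /andP[h3 h4] um.
have um' : u - u' <= m := le_trans (ler_norm _) um.
have um2 : u' - u <= m by rewrite distrC in um; exact: le_trans (ler_norm _) um.
have Ld : 0 <= L * delta by exact: mulr_ge0.
have k1 := ler_wpM2r Ld um'; have k2 := ler_wpM2r Ld um2.
rewrite ler_norml; apply/andP; split; nra.
Qed.

Lemma coordinate_far (t u u' L x x' delta : R) : 0 < delta -> 0 < L ->
  (t + u * L) * delta <= x < (t + (u + 1) * L) * delta ->
  (t + u' * L) * delta <= x' < (t + (u' + 1) * L) * delta ->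
  2 <= `|u - u'| -> L * delta < `|x - x'|.
Proof.
move=> d0 L0 /andP[h1 h2] /andP[h3 h4].
have Ld : 0 <= L * delta by rewrite ltW// mulr_gt0.
rewrite ler_normr => /orP[] um; have k1 := ler_wpM2r Ld um.
  by apply: lt_le_trans (ler_norm _); nra.
by rewrite distrC; apply: lt_le_trans (ler_norm _); nra.
Qed.

Definition coordinate M n (z : cell M n) (k : 'I_2) : nat := if k == ord0 then z.1 else z.2.

(** [T] is the index of a square of side [M^n delta], and [z] one of its cells of side [delta]. *)
Definition grid_index M n (T : 'rV[int]_2) (z : cell M n) : 'rV[int]_2 :=
  \row_k (T ord0 k * (M ^ n)%N%:Z + (coordinate z k)%:Z).

Lemma coordinate_ancestor M n h (z : cell M n) k :
  coordinate (ancestor h z) k = (coordinate z k %/ M ^ h)%N.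
Proof. by rewrite /coordinate; case: ifP. Qed.

Lemma grid_cube_ancestor M n (T : 'rV[int]_2) h (z : cell M n) (delta : R) (x : 'rV[R]_2) k :
  (0 < M)%N -> 0 <= delta -> grid_cube delta (grid_index T z) x ->
  let t := (T ord0 k * (M ^ n)%N%:Z)%:~R in
  let u := (coordinate (ancestor h z) k)%:R in
  (t + u * (M ^ h)%N%:R) * delta <= x ord0 k < (t + (u + 1) * (M ^ h)%N%:R) * delta.
Proof.
move=> M0 d0 /(_ k); rewrite mxE coordinate_ancestor rmorphD /= -pmulrn.
set t := _%:~R; set c := coordinate z k => /andP[h1 h2].
have Mh : (0 < M ^ h)%N by rewrite expn_gt0 M0.
apply/andP; split.
  apply: le_trans h1; rewrite ler_wpM2r// lerD2l -natrM ler_nat; exact: leq_divM.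
apply: lt_le_trans h2 _; rewrite ler_wpM2r// -addrA lerD2l !natr1 -natrM ler_nat.
exact: ltn_ceil.
Qed.

(** Packing in each of 4 parity classes, with [a = 2 m' l] and [r = l / 2] for cells of side [l].
    The ratio [2 (a + r) / r] is [8 m' + 2], at most [20 m]. *)
Lemma nodes_frostman (E : set 'rV[R]_2) (s C delta : R) M n (T : 'rV[int]_2)
    (P : {set cell M n}) (a : cell M n -> 'rV[R]_2) h c m :
  0 < s -> 0 < C -> ahlfors_regular s C E -> (0 < M)%N -> 0 < delta ->
  (M ^ n)%N%:R * delta <= 1 / 8 ->
  (forall z, z \in P -> E (a z) /\ grid_cube delta (grid_index T z) (a z)) ->
  (h <= n)%N -> (0 < m)%N ->
  #|[set u in nodes (@ancestor M n) P h | (dinf (cell_pos u) c <= m)%N]|%:R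
    <= 4 * C ^+ 2 * 20 `^ s * m%:R `^ s.
Proof.
move=> s0 C0 hE M0 d0 Md Pa hn m0.
set N := [set u in _ | _].
have Mh : (0 < M ^ h)%N by rewrite expn_gt0 M0.
have Mnh : (0 < M ^ (n - h))%N by rewrite expn_gt0 M0.
have Mh0 : (0 : R) < (M ^ h)%N%:R by rewrite ltr0n.
pose l : R := (M ^ h)%N%:R * delta.
have l0 : 0 < l by rewrite mulr_gt0.
(* The indices differ by at most [2 m], and also by less than [M^(n-h)] since all cells lie in one
   square. The minimum gives [m' l <= 1/8], which keeps the radius in the packing below 1 however
   large [m] is. *)
pose m' := minn (2 * m) (M ^ (n - h)).
have m'0 : (0 < m')%N by rewrite leq_min muln_gt0 m0.
have [N0|[u0 u0N]] := set_0Vmem N.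
  by rewrite N0 cards0 mulr_ge0 ?powR_ge0// mulr_ge0 ?powR_ge0// mulr_ge0 ?sqr_ge0.
have /fin_all_exists [rep hrep] u : exists z, u \in N -> z \in P /\ ancestor h z = u.
  have [uN|_] := boolP (u \in N); last by exists u.
  by move: uN; rewrite !inE => /andP[/imsetP[z zP ->] _]; exists z.
have small u k : u \in N -> (coordinate u k < M ^ (n - h))%N.
  move=> /hrep [_ <-]; rewrite coordinate_ancestor ltn_divLR// -expnD subnK//.
  by rewrite /coordinate; case: ifP => _; exact: ltn_ord.
have close u v k : u \in N -> v \in N -> `|(coordinate u k)%:Z - (coordinate v k)%:Z| <= m'%:Z.
  move=> uN vN; have su := small _ k uN; have sv := small _ k vN.
  have : `|(coordinate u k)%:Z - (coordinate v k)%:Z| <= (2 * m)%N%:Z.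
    move: uN vN; rewrite !inE => /andP[_ uc] /andP[_ vc].
    by move: uc vc; rewrite /dinf /cell_pos /coordinate /=; clear; case: ifP => _; lia.
  rewrite /m'; move: su sv; clear; lia.
have box u k : u \in N -> _ := fun uN =>
  @grid_cube_ancestor M n T h (rep u) delta (a (rep u)) k M0 (ltW d0) (Pa _ (hrep u uN).1).2.
(* Distinct cells whose indices have the same parities are more than a side
   apart, so that the balls of half that radius around their points are disjoint. *)
pose cls (b : bool * bool) := [set u in N | (odd (u.1 : 'I__), odd (u.2 : 'I__)) == b].
have m'l : m'%:R * l <= 1 / 8.
  apply: le_trans Md; rewrite mulrA ler_pM2r// -natrM ler_nat.
  by rewrite -[X in (_ <= M ^ X)%N](subnK hn) expnD leq_mul2r geq_minr orbT.
have m'1 : (1 : R) <= m'%:R by rewrite ler1n.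
have m'm : (m'%:R : R) <= 2 * m%:R by rewrite -natrM ler_nat geq_minl.
have lm' : l <= m'%:R * l by rewrite ler_peMl// ltW.
have cls_le b : #|cls b|%:R <= C ^+ 2 * (20 * m%:R) `^ s.
  have := @ahlfors_packing R 2 E s C (2 * m'%:R * l) (l / 2) _ (cls b) (a \o rep) (a (rep u0))
    s0 C0 hE.
  have h1 : 0 <= 2 * m'%:R * l by rewrite !mulr_ge0// ltW.
  have h2 : 0 < l / 2 by rewrite divr_gt0.
  have h3 : 2%:R * (2 * m'%:R * l + l / 2) <= 1 by lra.
  move=> /(_ h1 h2 h3 isT (Pa _ (hrep _ u0N).1).1) H.
  apply: (le_trans (H _ _ _)) => {H}.
  - by move=> u; rewrite inE => /andP[uN _]; exact: (Pa _ (hrep _ uN).1).1.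
  - move=> u k; rewrite inE => /andP[uN _].
    have := coordinate_close (ltW d0) (ltW Mh0) (box _ k u0N) (box _ k uN).
    rewrite (hrep _ u0N).2 (hrep _ uN).2 => /(_ m'%:R) H.
    apply: (le_trans (H _)) => {H}.
      by have := close _ _ k u0N uN; rewrite -(ler_int R) intr_norm rmorphB /= -!pmulrn.
    by rewrite -mulrA -/l ler_pM2r//; lra.
  - move=> u v; rewrite inE => /andP[uN /eqP pu]; rewrite inE => /andP[vN /eqP pv] uv.
    have [k hk] : exists k, 2 <= `|(coordinate u k)%:Z - (coordinate v k)%:Z|.
      move: pv uv; rewrite -pu => -[odd1 odd2].
      case: u v odd1 odd2 {uN vN pu} => [u1 u2] [v1 v2] /= odd1 odd2 uv.
      have [e1|n1] := eqVneq (u1 : nat) v1.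
        have n2 : (u2 : nat) != v2.
          by apply: contraNneq uv => e2; apply/eqP; congr (_, _); exact: val_inj.
        exists (lift ord0 ord0); rewrite /coordinate /=.
        by move: odd2 n2; clear; lia.
      by exists ord0; rewrite /coordinate /=; move: odd1 n1; clear; lia.
    exists k.
    have := coordinate_far d0 Mh0 (box _ k uN) (box _ k vN).
    rewrite (hrep _ uN).2 (hrep _ vN).2 [2 * (l / 2)]mulrC divfK// => far; apply: far.
    by move: hk; rewrite -(ler_int R) intr_norm rmorphB /= -!pmulrn.
  rewrite ler_wpM2l ?sqr_ge0//; apply: ge0_ler_powR; rewrite ?nnegrE ?mulr_ge0 ?(ltW s0)//.
  - exact: addr_ge0 h1 (ltW h2).
  - by rewrite invr_ge0 ltW.
  rewrite ler_pdivrMr//.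
  have := ler_wpM2r (ltW l0) m'm; lra.
have -> : (#|N|%:R : R) = \sum_b #|cls b|%:R.
  rewrite -natr_sum; congr (_%:R); rewrite -sum1_card.
  rewrite (partition_big (fun u : cell M n => (odd u.1, odd u.2)) xpredT)//=.
  apply: eq_bigr => b _; rewrite -sum1_card; apply: eq_bigl => u.
  by rewrite [in RHS]inE.
apply: (le_trans (ler_sum _ (fun b _ => cls_le b))).
rewrite sumr_const card_prod card_bool powRM// -[leLHS]mulr_natl -!mulrA.
by rewrite lexx.
Qed.

End node_packing.

Local Open Scope classical_set_scope.

(** * Box counting *)

Section grid.
Context {R : realType}.

Lemma grid_number_le d (F : set 'rV[R]_d) (delta : R) (r : seq 'rV[int]_d) :
  (forall k, F `&` grid_cube delta k !=set0 -> k \in r) ->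
  (grid_number F delta <= size r)%N.
Proof.
move=> h; have fin := sub_finite_set (h : _ `<=` [set` r]) (finite_seq r).
apply: leq_trans (size_undup r); rewrite -card_fseq.
apply: fsubset_leq_card; apply/fsubsetP => k; rewrite in_fset_set// inE in_fset.
exact: h.
Qed.

(** The list [r'] only witnesses finiteness, without which [fset_set] would be empty. *)
Lemma grid_number_ge d (F : set 'rV[R]_d) (delta : R) (r r' : seq 'rV[int]_d) :
  (forall k, F `&` grid_cube delta k !=set0 -> k \in r') ->
  uniq r -> (forall k, k \in r -> F `&` grid_cube delta k !=set0) ->
  (size r <= grid_number F delta)%N.
Proof.
move=> h ur hr; have fin := sub_finite_set (h : _ `<=` [set` r']) (finite_seq r').
rewrite -(undup_id ur) -card_fseq.
apply: fsubset_leq_card; apply/fsubsetP => k; rewrite in_fset_set// in_fset => kr.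
by rewrite inE; exact: hr.
Qed.

Lemma grid_index_bound (delta x D : R) (k : int) : 0 < delta -> `|x| <= D ->
  k%:~R * delta <= x < (k%:~R + 1) * delta -> `|k%:~R| <= D / delta + 1.
Proof.
move=> d0 xD /andP[h1 h2].
have h1' : k%:~R <= D / delta.
  by rewrite ler_pdivlMr//; apply: le_trans h1 _; exact: le_trans (ler_norm _) xD.
have h2' : - (D / delta) < k%:~R + 1.
  rewrite -mulNr ltr_pdivrMr//; apply: le_lt_trans h2.
  by rewrite lerNl; apply: le_trans xD; rewrite -normrN ler_norm.
by rewrite ler_norml; apply/andP; split; lra.
Qed.

Lemma top_coordinate (k : int) (tau W : nat) : (0 < tau)%N -> `|k| <= (W * tau)%N%:Z ->
  exists (i : 'I_(W + W).+1) (z : 'I_tau), k = (i%:Z - W%:Z) * tau%:Z + z%:Z.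
Proof.
move=> t0 kW; pose N := absz (k + (W * tau)%N%:Z).
have NE : N%:Z = k + (W * tau)%N%:Z by rewrite /N; lia.
have Nle : (N <= (W + W) * tau)%N by rewrite -lez_nat NE; lia.
have iW : (N %/ tau < (W + W).+1)%N by rewrite ltnS -(mulnK (W + W) t0) leq_div2r.
exists (Ordinal iW), (Ordinal (ltn_pmod N t0)) => /=.
have := divn_eq N tau; rewrite -[k](addrK ((W * tau)%N%:Z)) -NE => {1}->.
by rewrite mulrBl PoszD !PoszM; ring.
Qed.

Definition top_cell (W : nat) (i : 'I_(W + W).+1 * 'I_(W + W).+1) : 'rV[int]_2 :=
  \row_k ((if k == ord0 then i.1 : nat else i.2 : nat)%:Z - W%:Z).

Lemma ord2P (P : 'I_2 -> Prop) : P ord0 -> P (lift ord0 ord0) -> forall k, P k.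
Proof.
move=> P0 P1 k; case: (unliftP ord0 k) => [j ->|->//].
by rewrite (ord1 j).
Qed.

Definition occupied (A : set 'rV[R]_2) (delta : R) M n (T : 'rV[int]_2) : {set cell M n} :=
  [set z | `[< A `&` grid_cube delta (grid_index T z) !=set0 >]]%SET.

(** Of the [(2 W + 1)^2] squares of side [M^n delta] that cover [A], take one with the most occupied
    cells. *)
Lemma occupied_pigeonhole (A : set 'rV[R]_2) (delta D : R) M n (W : nat) :
  0 < delta -> (0 < M)%N -> (forall x, A x -> forall k, `|x ord0 k| <= D) ->
  D / delta + 1 <= (W * M ^ n)%N%:R ->
  exists T, (grid_number A delta <= (W + W).+1 ^ 2 * #|@occupied A delta M n T|)%N.
Proof.
move=> d0 M0 AD hW; have t0 : (0 < M ^ n)%N by rewrite expn_gt0 M0.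
pose I := ('I_(W + W).+1 * 'I_(W + W).+1)%type.
pose r := [seq grid_index (top_cell i) z |
  i <- enum {: I}, z <- enum (@occupied A delta M n (top_cell i))].
have Nr : (grid_number A delta <= size r)%N.
  apply: grid_number_le => k Ak.
  have kW j : `|k ord0 j| <= (W * M ^ n)%N%:Z.
    have [x [Ax kx]] := Ak.
    rewrite -(ler_int R) intr_norm -pmulrn; apply: le_trans hW.
    exact: grid_index_bound d0 (AD _ Ax j) (kx j).
  have [i0 [z0 e0]] := top_coordinate t0 (kW ord0).
  have [i1 [z1 e1]] := top_coordinate t0 (kW (lift ord0 ord0)).
  have ek : k = grid_index (top_cell (i0, i1)) ((z0, z1) : cell M n).
    by apply/rowP; apply: ord2P; rewrite /grid_index /top_cell !mxE /coordinate /=.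
  apply/allpairsPdep; exists (i0, i1), (z0, z1); split => //; rewrite mem_enum// inE.
  by apply/asboolP; rewrite -ek.
pose i0 := [arg max_(i > ((ord0, ord0) : I)) #|@occupied A delta M n (top_cell i)|].
exists (top_cell i0); apply: (leq_trans Nr).
rewrite size_allpairs_dep sumnE big_map big_enum/=.
apply: (@leq_trans (\sum_(i : I) #|@occupied A delta M n (top_cell i0)|)).
  apply: leq_sum => i _; rewrite -cardE /i0; case: arg_maxnP => // j _; exact.
by rewrite sum_nat_const card_prod !card_ord.
Qed.

Lemma scale_exists M (delta : R) : (1 < M)%N -> 0 < delta -> delta <= 1 / 8 ->
  exists n, (M ^ n)%N%:R * delta <= 1 / 8 < (M ^ n.+1)%N%:R * delta.
Proof.
move=> M1 d0 d8; pose N := Num.truncn (1 / 8 / delta).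
have x0 : 0 <= 1 / 8 / delta by rewrite !divr_ge0// ltW.
have /andP[N1 N2] := truncn_itv x0.
have N0 : (0 < N)%N by rewrite /N truncn_gt0 ler_pdivlMr// (mul1r delta).
have /andP[b1 b2] := trunc_log_bounds M1 N0.
exists (trunc_log M N); apply/andP; split.
  rewrite -ler_pdivlMr//; apply: le_trans N1; by rewrite ler_nat.
by rewrite -ltr_pdivrMr//; apply: lt_le_trans N2 _; rewrite ler_nat.
Qed.

End grid.

Section distances.
Context {R : realType}.
Variables (A : set 'rV[R]_2) (D : R).
Hypothesis AD : forall x, A x -> forall k, `|x ord0 k| <= D.

Local Notation dist := (line_set (distance_set A)).

Lemma distance_set_bound t : distance_set A t -> 0 <= t <= 4 * D.
Proof.
move=> [x [y [Ax Ay ->]]]; rewrite sqrtr_ge0 /=.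
have D0 : 0 <= D := le_trans (normr_ge0 _) (AD Ax ord0).
have -> : 4 * D = 2%:R * (D + D) by ring.
apply: edist_le => [|k]; first exact: addr_ge0.
by apply: le_trans (ler_normB _ _) _; rewrite lerD// AD.
Qed.

Lemma distance_grid_index (delta : R) k : 0 < delta ->
  dist `&` grid_cube delta k !=set0 ->
  k \in [seq const_mx i%:Z | i <- iota 0 (Num.truncn (4 * D / delta)).+1].
Proof.
move=> d0 [_ [[t At <-] /(_ ord0)]]; rewrite mxE => /andP[h1 h2].
have /andP[t0 tD] := distance_set_bound At.
have k0 : 0 <= k ord0 ord0.
  have : 0 < (k ord0 ord0)%:~R + 1 :> R.
    by rewrite -(pmulr_lgt0 _ d0); exact: le_lt_trans h2.
  by rewrite -intrD1 ltr0z; lia.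
apply/mapP; exists `|k ord0 ord0|%N; last first.
  by apply/rowP => i; rewrite ord1 mxE gez0_abs.
rewrite mem_iota /= add0n ltnS truncn_ge_nat.
  rewrite ler_pdivlMr// pmulrn gez0_abs//; exact: le_trans h1 tD.
by rewrite divr_ge0 ?(ltW d0)//; exact: le_trans tD.
Qed.

Lemma grid_number_distance_le (delta : R) : 0 <= D -> 0 < delta ->
  (grid_number dist delta)%:R <= 4 * D / delta + 1.
Proof.
move=> D0 d0; have := grid_number_le (fun k => @distance_grid_index delta k d0).
rewrite size_map size_iota => h.
apply: (@le_trans _ _ (Num.truncn (4 * D / delta)).+1%:R); first by rewrite ler_nat.
by rewrite -natr1 lerD2r truncn_le// divr_ge0 ?mulr_ge0// ltW.
Qed.

Lemma edist_planar (x y : 'rV[R]_2) (delta t0 t1 : R) : 0 < delta ->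
  Defs.edist x y = delta * planar_dist
    (x ord0 ord0 / delta - t0) (x ord0 (lift ord0 ord0) / delta - t1)
    (y ord0 ord0 / delta - t0) (y ord0 (lift ord0 ord0) / delta - t1).
Proof.
move=> d0; have dn := lt0r_neq0 d0.
rewrite /planar_dist -{1}[delta](gtr0_norm d0) -sqrtr_sqr -sqrtrM ?sqr_ge0//.
rewrite /Defs.edist !big_ord_recl big_ord0; congr Num.sqrt.
by field.
Qed.

(** A value [v] is the integer part of a distance divided by [delta], hence the index of a grid
    interval that contains this distance. *)
Lemma pin_values_grid (delta : R) M n (T : 'rV[int]_2) (P : {set cell M n})
    (a : cell M n -> 'rV[R]_2) (p1 p2 : cell M n -> R) x0 :
  (0 < M)%N -> 0 < delta ->
  (forall z, z \in P -> A (a z) /\ grid_cube delta (grid_index T z) (a z)) ->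
  p1 = (fun z => a z ord0 ord0 / delta - (T ord0 ord0 * (M ^ n)%N%:Z)%:~R) ->
  p2 = (fun z => a z ord0 (lift ord0 ord0) / delta
                   - (T ord0 (lift ord0 ord0) * (M ^ n)%N%:Z)%:~R) ->
  (forall z, z \in P -> (z.1 : nat)%:R <= p1 z < (z.1 : nat)%:R + 1) ->
  (forall z, z \in P -> (z.2 : nat)%:R <= p2 z < (z.2 : nat)%:R + 1) ->
  x0 \in P ->
  (#|[set pin_value p1 p2 x0 z | z in P]%SET| <= grid_number dist delta)%N.
Proof.
move=> M0 d0 Pa p1E p2E p1P p2P x0P.
rewrite cardE -(size_map (fun v : 'I__ => const_mx (v : nat)%:Z : 'rV[int]_1)).
apply: grid_number_ge (fun k => @distance_grid_index delta k d0) _ _.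
  rewrite map_inj_uniq ?enum_uniq// => u v /rowP/(_ ord0); rewrite !mxE => -[e].
  exact: val_inj.
move=> _ /mapP[v + ->]; rewrite mem_enum => /imsetP[z zP ->].
exists (const_mx (Defs.edist (a x0) (a z))); split.
  exists (Defs.edist (a x0) (a z)) => //; exists (a x0), (a z).
  by split => //; [exact: (Pa _ x0P).1|exact: (Pa _ zP).1].
move=> i; rewrite !mxE (pin_valueE M0 p1P p2P x0P zP).
have e : Defs.edist (a x0) (a z) = delta * pin_dist p1 p2 x0 z.
  by rewrite /pin_dist p1E p2E; exact: edist_planar.
rewrite e [delta * _]mulrC ler_pM2r// ltr_pM2r// -pmulrn.
by rewrite natr1; exact: truncn_itv (pin_dist_ge0 _ _ _ _).
Qed.

End distances.

(** * Many distances at a single scale *)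

Section many_distances.
Context {R : realType}.

Lemma grid_coordinate (x t c delta : R) : 0 < delta ->
  (t + c) * delta <= x < (t + c + 1) * delta -> c <= x / delta - t < c + 1.
Proof.
move=> d0; rewrite -ler_pdivlMr// -ltr_pdivrMr// => /andP[h1 h2].
by apply/andP; split; lra.
Qed.

(** Choose [n] with [M^n delta] between [1 / (8 M)] and [1 / 8]. The pigeonhole over a bounded
    number of squares only affects the constant [c] of [discrete_distances], and the passage from
    [M^n] to [1 / delta] loses at most a factor [8 M], which turns [6 eta] into [7 eta]. *)
Lemma many_distances (s C D eta : R) (E A : set 'rV[R]_2) :
  1 < s -> 0 < C -> ahlfors_regular s C E -> A `<=` E ->
  (forall x, A x -> forall k, `|x ord0 k| <= D) -> 0 <= D ->
  0 < eta -> eta <= 1 / 8 ->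
  exists2 eps, 0 < eps <= 1 & exists2 delta0, 0 < delta0 & forall delta, 0 < delta < delta0 ->
    delta^-1 `^ (s - eps) <= (grid_number A delta)%:R ->
    delta^-1 `^ (1 - 7 * eta) <= (grid_number (line_set (distance_set A)) delta)%:R.
Proof.
move=> s1 C0 hE AE AD D0 eta0 eta8.
have eta4 : eta <= 1 / 4 by lra.
have s0 : 0 < s := lt_trans ltr01 s1.
have K0 : 0 < 4 * C ^+ 2 * 20 `^ s :> R by rewrite mulr_gt0 ?powR_gt0// mulr_gt0 ?exprn_gt0.
have [M [M1 [eps /andP[eps0 eps1] main]]] := discrete_distances s1 K0 eta0 eta4.
exists eps; first by rewrite eps0.
have M0 : (0 < M)%N := ltnW M1.
have y0 : (0 : R) < M%:R by rewrite ltr0n.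
pose W := (Num.truncn (8 * M%:R * D)).+2.
have hW : 8 * M%:R * D + 1 <= W%:R.
  have /andP[_ h] := truncn_itv (mulr_ge0 (mulr_ge0 (ler0n R 8) (ler0n R M)) D0).
  have -> : W%:R = (Num.truncn (8 * M%:R * D)).+1%:R + 1 :> R by rewrite natr1.
  by rewrite lerD2r ltW.
pose w := ((W + W).+1 ^ 2)%N; have w0 : (0 : R) < w%:R by rewrite ltr0n expn_gt0.
have [|n0 hn0] := main w%:R^-1; first by rewrite invr_gt0.
(* [delta < d1] forces [n >= n0]; [delta < d2] gives [8 M <= delta^-eta]. *)
pose d1 : R := (8 * (M ^ n0)%N%:R)^-1; pose d2 : R := ((8 * M%:R) `^ eta^-1)^-1.
have Mn0 : (1 : R) <= (M ^ n0)%N%:R by rewrite ler1n expn_gt0 M0.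
have d10 : 0 < d1 by rewrite invr_gt0 mulr_gt0// (lt_le_trans ltr01).
have d20 : 0 < d2 by rewrite invr_gt0 powR_gt0// mulr_gt0.
exists (Num.min d1 d2); first by rewrite lt_min d10.
move=> delta /andP[d0]; rewrite lt_min => /andP[dd1 dd2] NA.
have d8 : delta <= 1 / 8.
  apply: le_trans (ltW dd1) _.
  by rewrite div1r lef_pV2 ?posrE ?mulr_gt0 ?(lt_le_trans ltr01 Mn0)// ler_peMr.
have [n /andP[nl nu]] := scale_exists M1 d0 d8.
have n0n : (n0 <= n)%N.
  rewrite leqNgt; apply/negP => nn; move: nu; rewrite ltNge; apply/negP; rewrite negbK.
  have h1 : ((M ^ n.+1)%N%:R : R) <= (M ^ n0)%N%:R by rewrite ler_nat leq_exp2l.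
  apply: (@le_trans _ _ ((M ^ n0)%N%:R * d1)).
    by apply: ler_pM => //; exact: ltW.
  by rewrite /d1 invfM mulrCA divff ?mulr1 ?div1r// gt_eqF// (lt_le_trans ltr01).
set t := delta^-1 in NA *.
have t0 : 0 < t by rewrite invr_gt0.
have tn : t < 8 * M%:R * (M ^ n)%N%:R.
  rewrite -mulrA -natrM -expnS /t -[ltLHS]div1r ltr_pdivrMr// -mulrA; lra.
have nt : (M ^ n)%N%:R <= t.
  by rewrite /t -[leRHS]div1r ler_pdivlMr//; apply: le_trans nl _; lra.
have Mn1 : (1 : R) <= (M ^ n)%N%:R by rewrite ler1n expn_gt0 M0.
have hWn : D / delta + 1 <= (W * M ^ n)%N%:R.
  rewrite natrM.
  have h1 := ler_wpM2l D0 (ltW tn).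
  have h2 := ler_wpM2r (ler0n R (M ^ n)) hW.
  move: h1 h2 Mn1; rewrite -/t; nra.
have [T hT] := occupied_pigeonhole d0 M0 AD hWn.
set P := occupied A delta M n T in hT.
have /fin_all_exists [a Pa] z : exists x, z \in P -> A x /\ grid_cube delta (grid_index T z) x.
  have [|_] := boolP (z \in P); last by exists 0.
  by rewrite inE => /asboolP[x [Ax xz]]; exists x.
pose p1 z := a z ord0 ord0 / delta - (T ord0 ord0 * (M ^ n)%N%:Z)%:~R.
pose p2 z := a z ord0 (lift ord0 ord0) / delta - (T ord0 (lift ord0 ord0) * (M ^ n)%N%:Z)%:~R.
have p1P z : z \in P -> (z.1 : nat)%:R <= p1 z < (z.1 : nat)%:R + 1.
  move=> /Pa[_ /(_ ord0)]; rewrite mxE /coordinate /= rmorphD /= -[_%:Z%:~R in X in X -> _]pmulrn.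
  exact: grid_coordinate.
have p2P z : z \in P -> (z.2 : nat)%:R <= p2 z < (z.2 : nat)%:R + 1.
  move=> /Pa[_ /(_ (lift ord0 ord0))]; rewrite mxE /coordinate /= rmorphD /= -[_%:Z%:~R in X in X -> _]pmulrn.
  exact: grid_coordinate.
have frost h c m : (h <= n)%N -> (0 < m)%N ->
    #|[set u in nodes (@ancestor M n) P h | (dinf (cell_pos u) c <= m)%N]%SET|%:R
      <= 4 * C ^+ 2 * 20 `^ s * m%:R `^ s.
  apply: nodes_frostman s0 C0 hE M0 d0 nl _ => z /Pa[Az cz]; split; last exact: cz.
  exact: AE.
have cP : w%:R^-1 * (M ^ n)%N%:R `^ (s - eps) <= #|P|%:R.
  rewrite mulrC ler_pdivrMr//.
  apply: (@le_trans _ _ (t `^ (s - eps))).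
    apply: ge0_ler_powR => //; rewrite ?nnegrE ?(ltW t0)//.
    by rewrite subr_ge0 (le_trans eps1)// ltW.
  by apply: le_trans NA _; rewrite -natrM ler_nat mulnC.
have [x0 x0P many] := hn0 _ n0n P p1 p2 frost p1P p2P cP.
have := pin_values_grid AD M0 d0 Pa erefl erefl p1P p2P x0P.
rewrite -(ler_nat R) => h; apply: le_trans h; apply: le_trans many.
have e6 : 0 <= 1 - 6 * eta by lra.
have M80 : 0 < 8 * M%:R :> R by rewrite mulr_gt0.
have M81 : 1 <= 8 * M%:R :> R.
  by apply: (@le_trans _ _ M%:R); rewrite ?ler1n// ler_peMl ?ler1n.
have small : 8 * M%:R <= t `^ eta.
  have -> : 8 * M%:R = ((8 * M%:R) `^ eta^-1) `^ eta :> R.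
    by rewrite -powRrM mulVf ?gt_eqF// powRr1// ltW.
  apply: ge0_ler_powR; rewrite ?nnegrE ?powR_ge0 ?(ltW eta0) ?(ltW t0)//.
  by rewrite -[leLHS]invrK -/d2 /t lef_pV2 ?posrE// ltW.
have X0 : 0 < (8 * M%:R) `^ (1 - 6 * eta) :> R by exact: powR_gt0.
suff : (8 * M%:R) `^ (1 - 6 * eta) * t `^ (1 - 7 * eta)
    <= (8 * M%:R) `^ (1 - 6 * eta) * (M ^ n)%N%:R `^ (1 - 6 * eta) by rewrite ler_pM2l.
apply: (@le_trans _ _ (t `^ (1 - 6 * eta))); last first.
  rewrite -powRM ?ler0n ?(ltW M80)//; apply: ge0_ler_powR => //.
  - by rewrite nnegrE ltW.
  - by rewrite nnegrE mulr_ge0// ltW.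
  - exact: ltW.
have -> : t `^ (1 - 6 * eta) = t `^ eta * t `^ (1 - 7 * eta).
  rewrite -powRD; last by rewrite (gt_eqF t0) implybT.
  by congr powR; ring.
rewrite ler_wpM2r ?powR_ge0//; apply: le_trans small.
rewrite -[leRHS]powRr1 ?(ltW M80)//; apply: ler_powR => //; lra.
Qed.

End many_distances.

(** * Box dimensions as limits *)

Section limits.
Context {R : realType} (T : choiceType) (X : filteredType T).
Variables (f : X -> \bar R) (F : set_system X).

Lemma limf_einf_ge (a : \bar R) : (\forall x \near F, (a <= f x)%E) -> (a <= limf_einf f F)%E.
Proof.
move=> h; rewrite limf_einfE.
apply: le_trans (ereal_sup_ubound _); last by exists [set x | (a <= f x)%E].
by apply: le_ereal_inf_tmp => _ [x ax <-].
Qed.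

Lemma limf_esup_le (a : \bar R) : (\forall x \near F, (f x <= a)%E) -> (limf_esup f F <= a)%E.
Proof.
move=> h; rewrite limf_esupE.
apply: le_trans (ereal_inf_lbound _) _; first by exists [set x | (f x <= a)%E].
by apply: ge_ereal_sup => _ [x ax <-].
Qed.

Lemma limf_einf_near {FF : Filter F} (a : \bar R) :
  (a < limf_einf f F)%E -> \forall x \near F, (a < f x)%E.
Proof.
rewrite limf_einfE => /ereal_sup_gt[_ [V FV <-] aV].
by apply: filterS FV => x Vx; apply: lt_le_trans aV (ereal_inf_lbound _); exists x.
Qed.

Lemma limf_esup_near {FF : Filter F} (a : \bar R) :
  (limf_esup f F < a)%E -> \forall x \near F, (f x < a)%E.
Proof.
rewrite limf_esupE => /ereal_inf_lt[_ [V FV <-] aV].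
by apply: filterS FV => x Vx; apply: le_lt_trans aV; apply: ereal_sup_ubound; exists x.
Qed.

Lemma limf_einf_le {FF : ProperFilter F} (a : \bar R) :
  (\forall x \near F, (f x <= a)%E) -> (limf_einf f F <= a)%E.
Proof.
move=> fa; rewrite leNgt; apply/negP => /limf_einf_near af.
near F => x.
have : (a < f x)%E by near: x.
by rewrite ltNge; apply/negP; rewrite negbK; near: x.
Unshelve. all: by end_near. Qed.

End limits.

Section box_ratio.
Context {R : realType} (d : nat) (A : set 'rV[R]_d) (delta a : R).
Hypothesis delta01 : 0 < delta < 1.

Local Notation t := (delta^-1).
Local Notation N := ((grid_number A delta)%:R : R).

Lemma powR_invE : t `^ a = expR (a * - ln delta).
Proof.
have /andP[d0 _] := delta01.
by rewrite /powR gt_eqF ?invr_gt0// lnV.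
Qed.

Lemma opp_ln_gt0 : 0 < - ln delta.
Proof. by rewrite oppr_gt0 ln_lt0. Qed.

(** [0 < a] excludes a count of 0, for which the ratio is 0 because [ln 0 = 0]. *)
Lemma box_ratio_ge_powR : 0 < a -> (a%:E <= box_ratio A delta)%E -> t `^ a <= N.
Proof.
move=> a0; rewrite lee_fin ler_pdivlMr ?opp_ln_gt0// powR_invE => h.
have N0 : 0 < N.
  rewrite lt0r ler0n andbT; apply/eqP => N0; move: h; rewrite N0 [ln 0]ln0// leNgt => /negP; apply.
  by rewrite mulr_gt0 ?opp_ln_gt0.
by rewrite -[leRHS]lnK// ler_expR.
Qed.

Lemma box_ratio_ge : t `^ a <= N -> (a%:E <= box_ratio A delta)%E.
Proof.
rewrite powR_invE => h; have N0 : 0 < N := lt_le_trans (expR_gt0 _) h.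
by rewrite lee_fin ler_pdivlMr ?opp_ln_gt0// -ler_expR lnK.
Qed.

Lemma box_ratio_le : 0 <= a -> N <= t `^ a -> (box_ratio A delta <= a%:E)%E.
Proof.
move=> a0; rewrite powR_invE => h; rewrite lee_fin ler_pdivrMr ?opp_ln_gt0//.
have [N0|N0] := leP N 0; first by rewrite ln0// mulr_ge0// ltW ?opp_ln_gt0.
by rewrite -ler_expR lnK.
Qed.

End box_ratio.

Section main.
Context {R : realType}.

Lemma near_right0 (d0 : R) : 0 < d0 -> \forall delta \near 0^'+, 0 < delta < d0.
Proof.
move=> h; near=> delta; apply/andP; split; first by near: delta; exact: nbhs_right_gt.
by near: delta; exact: nbhs_right_lt.
Unshelve. all: by end_near. Qed.

Lemma bounded_coordinates (A : set 'rV[R]_2) : bounded_set A ->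
  exists2 D, 0 <= D & forall x, A x -> forall k, `|x ord0 k| <= D.
Proof.
move=> /pinfty_ex_gt0[D D0 AD]; exists D; first exact: ltW.
move=> x Ax k; apply: le_trans (AD x Ax).
by rewrite [leRHS]/Num.norm /= mx_normrE (le_bigmax _ (fun ij => `|x ij.1 ij.2|) (ord0, k)).
Qed.

Section distances.
Variables (A : set 'rV[R]_2) (D : R).
Hypotheses (D0 : 0 <= D) (AD : forall x, A x -> forall k, `|x ord0 k| <= D).

Local Notation dist := (line_set (distance_set A)).

Lemma box_ratio_distance_le (e : R) : 0 < e ->
  \forall delta \near 0^'+, (box_ratio dist delta <= (1 + e)%:E)%E.
Proof.
move=> e0; pose c := 4 * D + 1.
have c0 : 0 < c by rewrite ltr_wpDl ?mulr_ge0.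
apply: filterS2 (near_right0 ltr01) (near_right0 (d0 := (c `^ e^-1)^-1) _); last first.
  by rewrite invr_gt0 powR_gt0.
move=> delta /andP[d0 d1] /andP[_ dc].
have t0 : 0 < delta^-1 by rewrite invr_gt0.
apply: box_ratio_le; rewrite ?d0// ?addr_ge0 ?(ltW e0)//.
apply: le_trans (grid_number_distance_le AD D0 d0) _.
rewrite powRD; last by rewrite (gt_eqF t0) implybT.
rewrite powRr1 ?(ltW t0)//.
apply: (@le_trans _ _ (delta^-1 * c)).
  by rewrite /c mulrDr mulr1 mulrC lerD2l invf_ge1// ltW.
rewrite ler_pM2l//.
have -> : c = (c `^ e^-1) `^ e by rewrite -powRrM mulVf ?gt_eqF// powRr1// ltW.
apply: ge0_ler_powR; rewrite ?nnegrE ?powR_ge0 ?(ltW e0) ?(ltW t0)//.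
by rewrite -[leLHS]invrK lef_pV2 ?posrE ?invr_gt0 ?powR_gt0// ltW.
Qed.

Lemma lower_box_dim_distance_le1 : (lower_box_dim dist <= 1)%E.
Proof.
by apply/lee_addgt0Pr => e e0; apply: limf_einf_le; exact: box_ratio_distance_le.
Qed.

Lemma upper_box_dim_distance_le1 : (upper_box_dim dist <= 1)%E.
Proof.
by apply/lee_addgt0Pr => e e0; apply: limf_esup_le; exact: box_ratio_distance_le.
Qed.

(** Premise and conclusion concern the same [delta], so the implication passes to the lower as well
    as to the upper limit. *)
Lemma box_ratio_distance_ge (E : set 'rV[R]_2) (s C e : R) :
  1 < s -> 0 < C -> ahlfors_regular s C E -> A `<=` E -> 0 < e ->
  exists2 eps, 0 < eps & \forall delta \near 0^'+,
    ((s - eps)%:E <= box_ratio A delta -> (1 - e)%:E <= box_ratio dist delta)%E.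
Proof.
move=> s1 C0 hE AE e0; pose eta := Num.min (1 / 8) (e / 7).
have eta0 : 0 < eta by rewrite lt_min !divr_gt0.
have eta8 : eta <= 1 / 8 by rewrite ge_min lexx.
have etae : 7 * eta <= e by rewrite mulrC -ler_pdivlMr// ge_min lexx orbT.
have [eps /andP[eps0 eps1] [d0 d00 main]] := many_distances s1 C0 hE AE AD D0 eta0 eta8.
exists eps => //.
apply: filterS2 (near_right0 ltr01) (near_right0 d00) => delta d01 dd hA.
apply: (@le_trans _ _ (1 - 7 * eta)%:E); first by rewrite lee_fin lerD2l lerN2.
apply: box_ratio_ge => //; apply: main => //; apply: box_ratio_ge_powR => //.
by rewrite subr_gt0 (le_lt_trans eps1).
Qed.

End distances.

End main.

Theorem corollary1p3 (R : realType) (s C : R) (hs : 1 < s) (hC : 0 < C)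
    (E A : set 'rV[R]_2) (hE : ahlfors_regular s C E)
    (hAE : A `<=` E) (hA : bounded_set A) :
  (lower_box_dim A = s%:E -> lower_box_dim (line_set (distance_set A)) = 1%E) /\
  (upper_box_dim A = s%:E -> upper_box_dim (line_set (distance_set A)) = 1%E).
Proof.
have [D D0 AD] := bounded_coordinates hA.
split => dimA; apply/eqP; rewrite eq_le.
  rewrite (lower_box_dim_distance_le1 D0 AD) /=; apply/lee_subgt0Pr => e e0.
  have [eps eps0 main] := box_ratio_distance_ge D0 AD hs hC hE hAE e0.
  have hlow : ((s - eps)%:E < lower_box_dim A)%E by rewrite dimA lte_fin ltrBlDr ltrDl.
  apply: limf_einf_ge; apply: filterS2 main (limf_einf_near hlow) => delta h1 h2.
  exact/h1/ltW.
rewrite (upper_box_dim_distance_le1 D0 AD) /=; apply/lee_subgt0Pr => e e0.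
have [eps eps0 main] := box_ratio_distance_ge D0 AD hs hC hE hAE e0.
(* By contraposition, without extracting a sequence of scales: if the ratio of the distances were
   below [1 - e] at all small scales, that of [A] would stay below [s - eps]. *)
rewrite leNgt; apply/negP => hup.
have : (upper_box_dim A <= (s - eps)%:E)%E.
  apply: limf_esup_le; apply: filterS2 main (limf_esup_near hup) => delta h1 h2.
  by rewrite leNgt; apply/negP => /ltW/h1; rewrite leNgt h2.
by rewrite dimA lee_fin leNgt ltrBlDr ltrDl eps0.
Qed.
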